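(* Let $T$ be a linear o-minimal expansion of $\mathsf{DOAG}$ (the theory of divisible ordered abelian groups), with monster model $\mathfrak U$. Then in $T$ every invariant type is domination-equivalent to a product of $1$-types. More precisely, let $p\in S^{\mathrm{inv}}(U)$, let $a\models p$, and let $p_0,\dots,p_k\in S^{\mathrm{inv}}_1(U)$ be any maximal tuple of pairwise weakly orthogonal, non-realised invariant $1$-types realised in $\mathrm{dcl}(Ua)$. Then there is an extremal witness of $p\sim_D p_0\otimes\cdots\otimes p_k$.
   Context: $T$ is a complete first-order theory, $\mathfrak U=(U,\dots)$ a monster model, i.e. $\kappa$-saturated and $\kappa$-strongly homogeneous for a fixed strong limit cardinal $\kappa>|T|$; small means of size $<\kappa$. Realisations of types over $U$ are taken in a larger monster model $\mathfrak V\succ\mathfrak U$. ''Definable'' means definable with parameters from $U$. $S^{\mathrm{inv}}(U)$ is the set of types over $U$ in finitely many variables fixed by $\mathrm{Aut}(\mathfrak U/A)$ for some small $A\subseteq U$; $S_1^{\mathrm{inv}}(U)$ those in one variable. A type over $U$ is realised if it is realised in $U$. If $p(x)$ is $A$-invariant and $B\supseteq U$, then $p\mid B$ is the type over $B$ with $\varphi(x,b)\in p\mid B$ iff $\varphi(x,d)\in p$ for some (equivalently every) $d\in U$ with $d\equiv_A b$; $p(x)\otimes q(y)$ is: for $b\models q$, $\varphi(x,y)\in p\otimes q$ iff $\varphi(x,b)\in p\mid Ub$. Types $p(x),q(y)$ over $U$ are weakly orthogonal if $p(x)\cup q(y)$ implies a complete type over $U$. Domination: $p(x)\ge_D q(y)$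 means there are a small $A\subseteq U$ and a complete type $r(x,y)$ over $A$ extending $(p(x)\cup q(y))\restriction A$ with $p(x)\cup r(x,y)\vdash q(y)$; $r$ is a witness. $p\sim_D q$ means $p\ge_D q$ and $q\ge_D p$. A witness $r(x,y)$ of $p\ge_D q$ is extremal if (1) there is a definable function $\tau$ with $r(x,y)\vdash y=\tau(x)$, and (2) if $(a,b)\models p(x)\cup r(x,y)$, there is no $c\in\mathrm{dcl}(Ua)\setminus U$ such that $\mathrm{tp}(c/U)$ is realised in $\mathrm{dcl}(Ub)$ and $\mathrm{tp}(bc/U)=\mathrm{tp}(b/U)\otimes\mathrm{tp}(c/U)$. If the same $r$ also witnesses $q\ge_D p$ (i.e. $q(y)\cup r(x,y)\vdash p(x)$), then $r$ is an extremal witness of $p\sim_D q$. Linear: an o-minimal expansion $\mathcal M=\langle M,<,+,0,\dots\rangle$ of an ordered group is linear if every definable set is definable in $\langle M,<,+,0,\{\lambda\}_{\lambda\in\Lambda}\rangle$, where $\Lambda$ is the set of $\emptyset$-definable partial endomorphisms of $\langle M,<,+,0\rangle$ (maps $\lambda$ from $M$ or a symmetric interval $(-a,a)$ to $M$ with $\lambda(x+y)=\lambda(x)+\lambda(y)$ whenever $x,y,x+y$ are in the domain). A theory is linear if its models are. Convention: if the maximal tuple is empty (which happens when $p$ is realised), its product is the unique type in the empty tuple of variables. *)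

(* Defs.v *)
From mathcomp Require Import all_boot.
From mathcomp Require Import boolp classical_sets functions cardinality.

Set Implicit Arguments.
Unset Strict Implicit.
Unset Printing Implicit Defensive.

Local Open Scope classical_set_scope.
Local Open Scope card_scope.

Definition card_lt (S S' : Type) (A : set S) (B : set S') : Prop :=
  (A #<= B) /\ ~ (B #<= A).

Definition copair (A B C : Type) (f : A -> C) (g : B -> C) (s : A + B) : C :=
  match s with inl x => f x | inr y => g y end.

Definition tcat (n m : nat) (C : Type) (a : 'I_n -> C) (b : 'I_m -> C) :
    'I_(n + m) -> C :=
  fun i => copair a b (fintype.split i).

Record language := Language { Fsym : nat -> Type ; Rsym : nat -> Type }.

Inductive term (L : language) (X : Type) : Type :=
| Var (x : X)
| App (k : nat) (f : Fsym L k) (ts : 'I_k -> term L X).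

(* A formula of [formula L X] has its free variables in [X]; under a quantifier
   [None] is the bound variable.  Formulas with variables [x : 'I_n] and
   parameters named by a type [P] are those of [formula L ('I_n + P)]. *)
Inductive formula (L : language) (X : Type) : Type :=
| Eq (s t : term L X)
| Rel (k : nat) (R : Rsym L k) (ts : 'I_k -> term L X)
| Bot
| Imp (phi psi : formula L X)
| All (phi : formula L (option X)).

Arguments Bot {L X}.

Definition Neg (L : language) (X : Type) (phi : formula L X) : formula L X :=
  Imp phi Bot.

Fixpoint trename (L : language) (X Y : Type) (f : X -> Y) (t : term L X) :
    term L Y :=
  match t with
  | Var x => Var L (f x)
  | App k g ts => App g (fun i => trename f (ts i))
  end.

Fixpoint rename (L : language) (X Y : Type) (f : X -> Y) (phi : formula L X) :
    formula L Y :=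
  match phi with
  | Eq s t => Eq (trename f s) (trename f t)
  | Rel k R ts => Rel R (fun i => trename f (ts i))
  | Bot => Bot
  | Imp phi psi => Imp (rename f phi) (rename f psi)
  | All phi => All (rename (omap f) phi)
  end.

Record structure (L : language) := Structure {
  carrier :> Type ;
  fint : forall k, Fsym L k -> ('I_k -> carrier) -> carrier ;
  rint : forall k, Rsym L k -> ('I_k -> carrier) -> Prop }.

Fixpoint eval (L : language) (M : structure L) (X : Type) (v : X -> M)
    (t : term L X) : M :=
  match t with
  | Var x => v x
  | App k f ts => fint f (fun i => eval v (ts i))
  end.

Fixpoint sat (L : language) (M : structure L) (X : Type) (v : X -> M)
    (phi : formula L X) : Prop :=
  match phi with
  | Eq s t => eval v s = eval v t
  | Rel k R ts => rint R (fun i => eval v (ts i))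
  | Bot => False
  | Imp phi psi => sat v phi -> sat v psi
  | All phi => forall m : M, sat (oapp v m) phi
  end.

Definition sentence (L : language) : Type := formula L void.

Definition truth (L : language) (M : structure L) (phi : sentence L) : Prop :=
  sat (of_void M) phi.

Definition model (L : language) (T : set (sentence L)) (M : structure L) : Prop :=
  forall phi, T phi -> truth M phi.

Definition complete_theory (L : language) (T : set (sentence L)) : Prop :=
  (exists M : structure L, model T M) /\
  (forall phi : sentence L,
     (forall M : structure L, model T M -> truth M phi) \/
     (forall M : structure L, model T M -> truth M (Neg phi))).

Definition automorphism (L : language) (M : structure L) (sigma : M -> M) : Prop :=
  [/\ bijective sigma,
      (forall k (f : Fsym L k) (v : 'I_k -> M),
         sigma (fint f v) = fint f (sigma \o v)) &
      (forall k (R : Rsym L k) (v : 'I_k -> M),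
         rint R v <-> rint R (sigma \o v))].

Definition elementary_embedding (L : language) (M N : structure L) (e : M -> N) :
    Prop :=
  forall (X : Type) (phi : formula L X) (v : X -> M),
    sat v phi <-> sat (e \o v) phi.

Definition definable (L : language) (M : structure L) (n : nat)
    (X : set ('I_n -> M)) : Prop :=
  exists phi : formula L ('I_n + M), forall a, X a <-> sat (copair a id) phi.

(* Parameter sets are given as families [i : P -> M]: a subset [A] of [M] is the
   family [set_val : A -> M], and the union of two families is their [copair].
   A set of formulas over [i] in [n] variables is a [set (formula L ('I_n + P))]. *)

Definition tp (L : language) (M : structure L) (P : Type) (i : P -> M) (n : nat)
    (a : 'I_n -> M) : set (formula L ('I_n + P)) :=
  [set phi | sat (copair a i) phi].

Definition realises (L : language) (M : structure L) (P : Type) (i : P -> M)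
    (n : nat) (a : 'I_n -> M) (p : set (formula L ('I_n + P))) : Prop :=
  p `<=` tp i a.

Definition complete_type (L : language) (M : structure L) (P : Type) (i : P -> M)
    (n : nat) (p : set (formula L ('I_n + P))) : Prop :=
  (forall (k : nat) (phi : 'I_k -> formula L ('I_n + P)),
     (forall j, p (phi j)) ->
     exists a : 'I_n -> M, forall j, sat (copair a i) (phi j)) /\
  (forall phi, p phi \/ p (Neg phi)).

(* The cardinal kappa is represented by a type [kappa] of that cardinality. *)
Definition strong_limit (kappa : Type) : Prop :=
  forall A : set kappa, card_lt A [set: kappa] ->
    card_lt [set B : set kappa | B `<=` A] [set: kappa].

Definition small (kappa S : Type) (A : set S) : Prop := card_lt A [set: kappa].

Definition saturated (kappa : Type) (L : language) (M : structure L) : Prop :=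
  forall A : set M, small kappa A ->
  forall (n : nat) (p : set (formula L ('I_n + A))),
    complete_type (@set_val M A) p ->
    exists a : 'I_n -> M, realises (@set_val M A) a p.

Definition strongly_homogeneous (kappa : Type) (L : language) (M : structure L) :
    Prop :=
  forall A : set M, small kappa A ->
  forall f : A -> M,
    (forall phi : formula L A, sat (@set_val M A) phi <-> sat f phi) ->
    exists sigma : M -> M,
      automorphism sigma /\ forall x : A, sigma (set_val x) = f x.

(* The cardinality of the complete theory [T] is that of the set of all
   sentences. *)
Definition monster (kappa : Type) (L : language) (T : set (sentence L))
    (M : structure L) : Prop :=
  [/\ strong_limit kappa, card_lt [set: sentence L] [set: kappa], model T M,
      saturated kappa M & strongly_homogeneous kappa M].

Record og_language := OgLanguage {
  og_lang :> language ;
  lt_sym : Rsym og_lang 2 ;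
  add_sym : Fsym og_lang 2 ;
  zero_sym : Fsym og_lang 0 }.

Definition olt (L : og_language) (M : structure L) (x y : M) : Prop :=
  rint (lt_sym L) (tnth [tuple x; y]).

Definition oadd (L : og_language) (M : structure L) (x y : M) : M :=
  fint (add_sym L) (tnth [tuple x; y]).

Definition ozero (L : og_language) (M : structure L) : M :=
  fint (zero_sym L) (tnth [tuple]).

Arguments ozero {L} M.

Definition ordered_abelian_group (L : og_language) (M : structure L) : Prop :=
  [/\ [/\ associative (@oadd L M), commutative (@oadd L M),
          left_id (ozero M) (@oadd L M) &
          forall x : M, exists y : M, oadd x y = ozero M],
      [/\ forall x : M, ~ olt x x,
          forall x y z : M, olt x y -> olt y z -> olt x z &
          forall x y : M, [\/ olt x y, x = y | olt y x]] &
      forall x y z : M, olt x y -> olt (oadd x z) (oadd y z)].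

Definition doag (L : og_language) (M : structure L) : Prop :=
  [/\ ordered_abelian_group M,
      (exists x : M, x <> ozero M) &
      forall (n : nat) (x : M), exists y : M, iter n.+1 (oadd y) (ozero M) = x].

(* [None] stands for the infinite endpoint on the relevant side. *)
Definition open_interval (L : og_language) (M : structure L) (l u : option M) :
    set M :=
  [set x | (if l is Some a then olt a x else True) /\
           (if u is Some b then olt x b else True)].

Definition o_minimal (L : og_language) (M : structure L) : Prop :=
  forall X : set M, definable [set a : 'I_1 -> M | X (a ord0)] ->
  exists (j k : nat) (pts : 'I_j -> M) (ivs : 'I_k -> option M * option M),
    X = [set x | (exists i, x = pts i) \/
                 (exists i, open_interval (ivs i).1 (ivs i).2 x)].

(* [G] is the graph of an additive map from [M] or from an interval (-a, a);
   [olt (ozero M) (oadd x a)] says that -a < x. *)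
Definition partial_endomorphism (L : og_language) (M : structure L)
    (G : M -> M -> Prop) : Prop :=
  exists D : set M,
  [/\ D = [set: M] \/
      (exists2 a : M, olt (ozero M) a &
         D = [set x | olt (ozero M) (oadd x a) /\ olt x a]),
      (forall x y, G x y -> D x),
      (forall x, D x -> exists! y, G x y) &
      (forall x y x' y' z, G x x' -> G y y' -> G (oadd x y) z ->
         z = oadd x' y')].

Definition zero_definable_graph (L : language) (M : structure L)
    (G : M -> M -> Prop) : Prop :=
  exists phi : formula L 'I_2,
    forall x y, G x y <-> sat (tnth [tuple x; y]) phi.

Definition Lambda (L : og_language) (M : structure L) : Type :=
  {G : M -> M -> Prop | partial_endomorphism G /\ zero_definable_graph G}.

Inductive lin_fsym : nat -> Type :=
| LinAdd : lin_fsym 2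
| LinZero : lin_fsym 0.

Inductive lin_rsym (I : Type) : nat -> Type :=
| LinLt : lin_rsym I 2
| LinMap (lam : I) : lin_rsym I 2.

(* The structure (M, <, +, 0, (lambda)_(lambda in Lambda)); the lambdas being
   partial maps, they are named by binary symbols for their graphs. *)
Definition lin_language (L : og_language) (M : structure L) : language :=
  Language lin_fsym (lin_rsym (Lambda M)).

Definition lin_fint (L : og_language) (M : structure L) (k : nat)
    (f : lin_fsym k) : ('I_k -> M) -> M :=
  match f in lin_fsym k return ('I_k -> M) -> M with
  | LinAdd => fint (add_sym L)
  | LinZero => fint (zero_sym L)
  end.

Definition lin_rint (L : og_language) (M : structure L) (k : nat)
    (R : lin_rsym (Lambda M) k) : ('I_k -> M) -> Prop :=
  match R in lin_rsym _ k return ('I_k -> M) -> Prop with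
  | LinLt => rint (lt_sym L)
  | LinMap lam => fun v => sval lam (v ord0) (v ord_max)
  end.

Definition lin_structure (L : og_language) (M : structure L) :
    structure (lin_language M) :=
  @Structure (lin_language M) M (@lin_fint L M) (@lin_rint L M).

Definition linear (L : og_language) (M : structure L) : Prop :=
  forall (n : nat) (X : set ('I_n -> M)),
    definable X -> definable (M := lin_structure M) X.

Definition linear_o_minimal_doag (L : og_language) (T : set (sentence L)) : Prop :=
  forall M : structure L, model T M -> [/\ doag M, o_minimal M & linear M].

Section Domination.

(* [U] is the monster model, [kappa] the bound for smallness in [U], and
   [e : U -> V] the elementary embedding of [U] in the larger monster model in
   which types over [U] are realised.  A type over [U] is a set of formulas
   with parameters named by [U]; in [V] these are interpreted through [e]. *)
Context (L : language) (kappa : Type) (U V : structure L) (e : U -> V).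

Local Notation utype n := (set (formula L ('I_n + carrier U))).

Definition larger_monster (kappa' : Type) (T : set (sentence L)) : Prop :=
  [/\ monster kappa' T V, card_lt [set: U] [set: kappa'] &
      elementary_embedding e].

Definition invariant_over (n : nat) (A : set U) (p : utype n) : Prop :=
  forall sigma : U -> U, automorphism sigma -> (forall x, A x -> sigma x = x) ->
  forall phi, p phi <-> p (rename (copair inl (inr \o sigma)) phi).

Definition Sinv (n : nat) (p : utype n) : Prop :=
  complete_type (@id U) p /\
  exists2 A : set U, small kappa A & invariant_over A p.

Definition realised (n : nat) (p : utype n) : Prop :=
  exists a : 'I_n -> U, realises (@id U) a p.

Definition param_incl (n : nat) (A : set U) :
    formula L ('I_n + A) -> formula L ('I_n + U) :=
  rename (copair inl (inr \o set_val)).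

Definition restr (n : nat) (A : set U) (p : utype n) :
    set (formula L ('I_n + A)) :=
  [set phi | p (param_incl phi)].

Definition emb_in (A : set U) : A -> V := e \o set_val.

(* [inv_ext p i] is p | B for the parameter set B enumerated by [i : P -> V].
   It does not depend on the small set [A] over which p is invariant. *)
Definition inv_ext (n : nat) (p : utype n) (P : Type) (i : P -> V) :
    set (formula L ('I_n + P)) :=
  [set chi | exists A : set U, [/\ small kappa A, invariant_over A p &
     exists (k : nat) (phi : formula L ('I_n + 'I_k))
            (b : 'I_k -> P) (d : 'I_k -> U),
       [/\ chi = rename (copair inl (inr \o b)) phi,
           tp (@emb_in A) (e \o d) = tp (@emb_in A) (i \o b) &
           p (rename (copair inl (inr \o d)) phi)]]].

(* The formula phi(x, b) obtained from phi(x, y), where the coordinates of b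
   are named by ['I_m]. *)
Definition subst_right (n m : nat) (phi : formula L ('I_(n + m) + U)) :
    formula L ('I_n + ('I_m + U)) :=
  rename (copair (fun i : 'I_(n + m) => copair inl (inr \o inl) (fintype.split i))
                 (inr \o inr)) phi.

Definition tensor (n m : nat) (p : utype n) (q : utype m) : utype (n + m) :=
  [set phi | exists2 b : 'I_m -> V, realises e b q &
                inv_ext p (copair b e) (subst_right phi)].

Definition empty_product : utype 0 :=
  [set phi | forall a : 'I_0 -> U, sat (copair a id) phi].

Fixpoint tensor_seq (ps : seq (utype 1)) : utype (size ps) :=
  match ps return utype (size ps) with
  | [::] => empty_product
  | p :: ps => @tensor 1 (size ps) p (@tensor_seq ps)
  end.

Definition weakly_orthogonal (n m : nat) (p : utype n) (q : utype m) : Prop :=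
  exists2 s : utype (n + m), complete_type (@id U) s &
    forall a b, realises e a p -> realises e b q -> realises e (tcat a b) s.

(* dcl of the parameter set enumerated by [i : P -> V]. *)
Definition dcl (P : Type) (i : P -> V) : set V :=
  [set c | exists phi : formula L ('I_1 + P),
     forall z : V, sat (copair (fun=> z) i) phi <-> z = c].

(* [(a, b)] realises p(x) together with r(x, y). *)
Definition realises_pair (n m : nat) (A : set U) (p : utype n)
    (r : set (formula L ('I_(n + m) + A))) (a : 'I_n -> V) (b : 'I_m -> V) : Prop :=
  realises e a p /\ realises (@emb_in A) (tcat a b) r.

Definition dom_witness (n m : nat) (p : utype n) (q : utype m) (A : set U)
    (r : set (formula L ('I_(n + m) + A))) : Prop :=
  [/\ small kappa A, complete_type (@set_val U A) r,
      (forall phi, restr p phi -> r (rename (copair (inl \o @lshift n m) inr) phi)),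
      (forall phi, restr q phi -> r (rename (copair (inl \o @rshift n m) inr) phi)) &
      forall a b, realises_pair p r a b -> realises e b q].

Definition dominates (n m : nat) (p : utype n) (q : utype m) : Prop :=
  exists (A : set U) (r : set (formula L ('I_(n + m) + A))), dom_witness p q r.

Definition dom_equiv (n m : nat) (p : utype n) (q : utype m) : Prop :=
  dominates p q /\ dominates q p.

(* [tau] defines over [U] the graph of a function from n-tuples to m-tuples. *)
Definition definable_function (n m : nat) (tau : formula L ('I_(n + m) + U)) : Prop :=
  forall x : 'I_n -> U, exists! y : 'I_m -> U, sat (copair (tcat x y) id) tau.

Definition extremal_witness (n m : nat) (p : utype n) (q : utype m) (A : set U)
    (r : set (formula L ('I_(n + m) + A))) : Prop :=
  [/\ dom_witness p q r,
      (exists2 tau : formula L ('I_(n + m) + U), definable_function tau &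
         forall (a : 'I_n -> V) (b : 'I_m -> V),
           realises (@emb_in A) (tcat a b) r -> sat (copair (tcat a b) e) tau) &
      forall a b, realises_pair p r a b ->
        ~ exists c : V, let c1 := (fun=> c) : 'I_1 -> V in
          [/\ dcl (copair a e) c, ~ range e c,
              (exists2 c' : V, dcl (copair b e) c' &
                 realises e (fun _ : 'I_1 => c') (tp e c1)) &
              tp e (tcat b c1) = tensor (tp e b) (tp e c1)]].

Definition extremal_equiv_witness (n m : nat) (p : utype n) (q : utype m)
    (A : set U) (r : set (formula L ('I_(n + m) + A))) : Prop :=
  extremal_witness p q r /\
  forall a b, realises e b q -> realises (@emb_in A) (tcat a b) r -> realises e a p.

Definition orthogonal_tuple (n : nat) (a : 'I_n -> V) (ps : seq (utype 1)) : Prop :=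
  (forall i : 'I_(size ps), let q := tnth (in_tuple ps) i in
     [/\ Sinv q, ~ realised q &
         exists2 c : V, dcl (copair a e) c & realises e (fun=> c) q]) /\
  (forall i j : 'I_(size ps), i != j ->
     weakly_orthogonal (tnth (in_tuple ps) i) (tnth (in_tuple ps) j)).

Definition maximal_orthogonal_tuple (n : nat) (a : 'I_n -> V)
    (ps : seq (utype 1)) : Prop :=
  orthogonal_tuple a ps /\ forall q : utype 1, ~ orthogonal_tuple a (rcons ps q).

End Domination.

Arguments tensor_seq {L} kappa {U V} e ps _ : rename.

(* Main.v *)
(* In a linear o-minimal group the closure of [U] under adjoining an element [c]
   consists of the [d + f (c - d')] with [f] a 0-definable partial endomorphism, and
   back and forth shows that a cut over a closed set determines a complete type.  An
   invariant cut has small cofinality on one side, and hence every element of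
   [dcl (Ua)] outside [U] is [u + g] or [u - g] with [g] isolated: for all positive
   [d] in [U], [2 d < g] or [2 g < d].  Two isolated elements have orthogonal types
   iff no partial endomorphism takes one into the cut of the other, and adjoining one
   element to a closed set creates at most one new class for this relation; so a
   maximal orthogonal tuple realised in [dcl (Ua)] represents all the classes.  In
   each class choose the realisation [g_i] farthest from the small side of its cut.
   An automorphism fixing [g_i] and a small set cofinal in that side keeps the images
   of the other members of the class in their cuts, so the type of [a] over [U] is
   recovered from the [g_i] and a small set; and any [c] in [dcl (Ua)] outside [U]
   yields an element on the near side of some [g_i], in the same cut, which saturation
   of [U] rules out when the type of [(b, c)] is the tensor product. *)
Require Import Defs.
From Stdlib Require List.
From mathcomp Require Import all_boot.
From mathcomp Require Import boolp classical_sets functions cardinality filter.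
From mathcomp Require Import zify.

Set Implicit Arguments.
Unset Strict Implicit.
Unset Printing Implicit Defensive.

Local Open Scope classical_set_scope.
Local Open Scope card_scope.

(** The obstacle is that endomorphisms are partial: a sum or difference of two points of the domain
    of [f] may leave it. Maps are therefore extended, by [dbl], to twice their domain, and a domain
    is only required to be convex and symmetric, so that inverses and composites stay in the class.
    The factors of two lost on the way do no harm: an element within a factor two of an isolated
    element has the same cut over [U].

    Equality of types over [U] is proved by producing automorphisms of [V] that fix [U]; they are
    built in [V] because sets containing [U] are small there. Two notions of smallness thus coexist:
    closed sets are small for [V], while all that enters the parameter set of a witness has to be
    small for [U]. The latter is reached because there are fewer than [kappa] endomorphisms: up to
    translation by [U], the closure of [U] and a finite tuple has a set of representatives of size
    less than [kappa], so fewer than [kappa] cuts over [U] describe the type of the tuple. *)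

Definition FAnd (L : language) (X : Type) (phi psi : formula L X) : formula L X :=
  Neg (Imp phi (Neg psi)).

Definition FEx (L : language) (X : Type) (phi : formula L (option X)) : formula L X :=
  Neg (All (Neg phi)).

(** * Renaming, automorphisms and finite support of formulas *)

Section Formulas.
Variable L : language.

Lemma eval_rename (M : structure L) X Y (f : X -> Y) (v : Y -> M) t :
  eval v (trename f t) = eval (v \o f) t.
Proof. by elim: t => //= k g ts IH; congr fint; apply/funext => i; rewrite IH. Qed.

Lemma oapp_omap (M X Y : Type) (f : X -> Y) (v : Y -> M) m :
  oapp v m \o omap f = oapp (v \o f) m.
Proof. by apply/funext => -[]. Qed.

Lemma sat_rename (M : structure L) X Y (f : X -> Y) (v : Y -> M) phi :
  sat v (rename f phi) = sat (v \o f) phi.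
Proof.
elim: phi Y f v => //=.
- by move=> {}X s t Y f v; rewrite !eval_rename.
- move=> {}X k R ts Y f v; congr rint; apply/funext => i; exact: eval_rename.
- by move=> {}X phi IH1 psi IH2 Y f v; rewrite IH1 IH2.
- move=> {}X phi IH Y f v; apply/propext; split=> H m; move: (H m);
    by rewrite IH oapp_omap.
Qed.

Lemma trename_comp X Y Z (f : X -> Y) (g : Y -> Z) (t : term L X) :
  trename g (trename f t) = trename (g \o f) t.
Proof. by elim: t => //= k h ts IH; congr App; apply/funext => i; rewrite IH. Qed.

Lemma rename_comp X Y Z (f : X -> Y) (g : Y -> Z) (phi : formula L X) :
  rename g (rename f phi) = rename (g \o f) phi.
Proof.
elim: phi Y Z f g => //=.
- by move=> {}X s t Y Z f g; rewrite !trename_comp.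
- move=> {}X k R ts Y Z f g; congr Rel; apply/funext => i; exact: trename_comp.
- by move=> {}X phi IH1 psi IH2 Y Z f g; rewrite IH1 IH2.
- move=> {}X phi IH Y Z f g; rewrite IH; congr (All (rename _ _)).
  by apply/funext => -[].
Qed.

Lemma trename_ext X Y (f g : X -> Y) : f =1 g -> trename (L := L) f =1 trename g.
Proof. by move=> /funext ->. Qed.

Lemma eq_rename X Y (f g : X -> Y) : f =1 g -> rename (L := L) f =1 rename g.
Proof. by move=> /funext ->. Qed.

Lemma trename_id X (t : term L X) : trename id t = t.
Proof. by elim: t => //= k h ts IH; congr App; apply/funext => i; rewrite IH. Qed.

Lemma rename_id X (phi : formula L X) : rename id phi = phi.
Proof.
elim: phi => //= {}X.
- by move=> s t; rewrite !trename_id.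
- move=> k R ts; congr Rel; apply/funext => i; exact: trename_id.
- by move=> phi -> psi ->.
- move=> phi IH; congr All; rewrite -[RHS]IH; congr rename.
  by apply/funext => -[].
Qed.

Lemma sat_And (M : structure L) X (v : X -> M) phi psi :
  sat v (FAnd phi psi) = (sat v phi /\ sat v psi).
Proof. by apply/propext => /=; split; [move=> H; split; apply: contrapT; tauto|tauto]. Qed.

Lemma sat_Neg (M : structure L) X (v : X -> M) phi :
  sat v (Neg phi) = ~ sat v phi.
Proof. by []. Qed.

Lemma sat_Ex (M : structure L) X (v : X -> M) phi :
  sat v (FEx phi) = exists m, sat (oapp v m) phi.
Proof.
apply/propext => /=; split=> [H|[m H] H']; last exact: (H' m).
by apply: contrapT => H'; apply: H => m Hm; apply: H'; exists m.
Qed.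

Lemma automorphism_eval (M : structure L) (sigma : M -> M) X (v : X -> M) t :
  automorphism sigma -> eval (sigma \o v) t = sigma (eval v t).
Proof.
case=> _ Hf _; elim: t => //= k f ts IH; rewrite Hf; congr fint.
by apply/funext => i; rewrite IH.
Qed.

Lemma automorphism_sat (M : structure L) (sigma : M -> M) X (v : X -> M) phi :
  automorphism sigma -> sat (sigma \o v) phi = sat v phi.
Proof.
move=> sA; have [sB _ sR] := sA.
elim: phi v => /=.
- move=> {}X s t v; rewrite !automorphism_eval //; apply/propext.
  by split=> [H|->]; [apply: (bij_inj sB)|].
- move=> {}X k R ts v.
  have -> : (fun i => eval (sigma \o v) (ts i)) = sigma \o (fun i => eval v (ts i)).
    by apply/funext => i; rewrite automorphism_eval.
  by apply/propext; exact: iff_sym (sR _ _ _).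
- by [].
- by move=> {}X phi IH1 psi IH2 v; rewrite IH1 IH2.
- move=> {}X phi IH v; have [tau sK tK] := sB; apply/propext; split=> H m.
    rewrite -IH; suff -> : sigma \o oapp v m = oapp (sigma \o v) (sigma m) by [].
    by apply/funext => -[].
  have := H (tau m); rewrite -IH.
  suff -> : sigma \o oapp v (tau m) = oapp (sigma \o v) m by [].
  by apply/funext => -[] //=.
Qed.

Lemma automorphism_id (M : structure L) : automorphism (@id M).
Proof. by split=> //; exact: inv_bij. Qed.

Lemma automorphism_comp (M : structure L) (s t : M -> M) :
  automorphism s -> automorphism t -> automorphism (s \o t).
Proof.
case=> s1 s2 s3 [t1 t2 t3]; split; first exact: bij_comp.
  by move=> k f v /=; rewrite t2 s2.
by move=> k R v; rewrite t3 s3.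
Qed.

Lemma automorphism_inv (M : structure L) (s : M -> M) : automorphism s ->
  exists t, [/\ automorphism t, cancel s t & cancel t s].
Proof.
case=> -[t sK tK] s2 s3; exists t; split=> //; split; first by exists s.
  move=> k f v; rewrite -[RHS]sK s2; congr (t (fint f _)).
  by apply/funext => i /=; rewrite tK.
move=> k R v; have {1}-> : v = s \o (t \o v) by apply/funext => i /=; rewrite tK.
exact: iff_sym (s3 _ _ _).
Qed.

(** Subterms have their own finite supports; the support of the whole is the disjoint union of
    these, enumerated as a finite type. No decidable equality on [X] is needed since a variable may
    be listed twice. *)
Lemma term_support X (t : term L X) :
  exists n (w : 'I_n -> X) (s : term L 'I_n), t = trename w s.
Proof.
elim: t => [x|k f ts IH].
  by exists 1, (fun=> x), (Var L ord0).
pose n i := projT1 (cid (IH i)).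
pose w i := projT1 (cid (projT2 (cid (IH i)))).
pose s i := projT1 (cid (projT2 (cid (projT2 (cid (IH i)))))).
have Hs i : ts i = trename (w i) (s i).
  exact: (projT2 (cid (projT2 (cid (projT2 (cid (IH i))))))).
pose N := #|{: {i : 'I_k & 'I_(n i)}}|.
pose W (j : 'I_N) := let p : {i : 'I_k & 'I_(n i)} := enum_val j in w (tag p) (tagged p).
exists N, W, (App f (fun i => trename (fun j => enum_rank (Tagged (fun i => 'I_(n i)) j)) (s i))).
rewrite /=; congr App; apply/funext => i; rewrite trename_comp Hs.
by apply: trename_ext => j /=; rewrite /W enum_rankK.
Qed.

Lemma formula_support X (phi : formula L X) :
  exists n (w : 'I_n -> X) (psi : formula L 'I_n), phi = rename w psi.
Proof.
elim: phi => {X} [X s t|X k R ts|X|X phi [n [w [p ->]]] psi [m [u [q ->]]]|X phi [n [w [p ->]]]].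
- have [n [w [p ->]]] := term_support s; have [m [u [q ->]]] := term_support t.
  exists (n + m), (tcat w u), (Eq (trename (@lshift n m) p) (trename (@rshift n m) q)).
  rewrite /= !trename_comp; congr Eq; apply: trename_ext => i;
    by rewrite /= /tcat -?[lshift m i]/(unsplit (inl i)) -?[rshift n i]/(unsplit (inr i)) unsplitK.
- have IH i := term_support (ts i).
  pose n i := projT1 (cid (IH i)).
  pose w i := projT1 (cid (projT2 (cid (IH i)))).
  pose s i := projT1 (cid (projT2 (cid (projT2 (cid (IH i)))))).
  have Hs i : ts i = trename (w i) (s i).
    exact: (projT2 (cid (projT2 (cid (projT2 (cid (IH i))))))).
  pose N := #|{: {i : 'I_k & 'I_(n i)}}|.
  pose W (j : 'I_N) := let p : {i : 'I_k & 'I_(n i)} := enum_val j in w (tag p) (tagged p).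
  exists N, W, (Rel R (fun i => trename (fun j => enum_rank (Tagged (fun i => 'I_(n i)) j)) (s i))).
  rewrite /=; congr Rel; apply/funext => i; rewrite trename_comp Hs.
  by apply: trename_ext => j /=; rewrite /W enum_rankK.
- by exists 0, (fun i : 'I_0 => match i with Ordinal _ H => match notF H with end end), Bot.
- exists (n + m), (tcat w u), (Imp (rename (@lshift n m) p) (rename (@rshift n m) q)).
  rewrite /= !rename_comp; congr Imp; apply: eq_rename => i;
    by rewrite /= /tcat -?[lshift m i]/(unsplit (inl i)) -?[rshift n i]/(unsplit (inr i)) unsplitK.
  (* Binding removes [None] from the list of variables. Places where [w] was [None] need a dummy
     variable [x0]; if [X] is empty there is none, but then [None] is the only variable. *)
  have [x0|noX] := pselect (inhabited X); last first.
    have wN i : w i = None by case: (w i) => // x; case: noX.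
    exists 0, (fun i : 'I_0 => match i with Ordinal _ H => match notF H with end end).
    exists (All (rename (fun=> None) p)).
    rewrite /= rename_comp; congr All; apply: eq_rename => i /=; exact: wN.
  have [{}x0] := x0.
  pose u i := odflt x0 (w i).
  exists n, u, (All (rename (fun i => if w i is Some _ then Some i else None) p)).
  rewrite /= rename_comp; congr All; apply: eq_rename => i /=.
  by case E : (w i) => [x|] //=; rewrite /u E.
Qed.

End Formulas.

(** * Small sets *)

Lemma card_leTP (S T : Type) :
  ([set: S] #<= [set: T]) <-> exists f : S -> T, injective f.
Proof.
split=> [/card_leP/injfunPex [f _ fI]|[f fI]].
  exists (fun x => set_val (f (exist _ x (mem_set I)))) => x y /val_inj Exy.
  by have [] : exist _ x (mem_set I) = exist _ y (mem_set I) :> [set: S] by apply: fI; rewrite ?inE.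
apply/card_leP/injfunPex; exists (fun x => exist _ (f (set_val x)) (mem_set I)) => // x y _ _ [].
by move=> /fI/val_inj.
Qed.

(** A maximal partial injection, given by Zorn, is total on one of the two sides. Comparability is
    what bounds a sum of two small types by a doubled one. *)
Lemma card_leT_total (S T : Type) :
  ([set: S] #<= [set: T]) \/ ([set: T] #<= [set: S]).
Proof.
pose P : set (set (S * T)) := [set G | (forall x y y', G (x, y) -> G (x, y') -> y = y') /\
  (forall x x' y, G (x, y) -> G (x', y) -> x = x')].
have [F FP Ftot|G [[G1 G2] Gmax]] := @Zorn_bigcup _ P.
  split=> [x y y'|x x' y] [A FA A1] [B FB B1].
    have [AB|BA] := Ftot A B FA FB.
      exact: (FP _ FB).1 (AB _ A1) B1.
    exact: (FP _ FA).1 A1 (BA _ B1).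
  have [AB|BA] := Ftot A B FA FB.
    exact: (FP _ FB).2 (AB _ A1) B1.
  exact: (FP _ FA).2 A1 (BA _ B1).
have [domG|] := pselect (forall x, exists y, G (x, y)).
  left; apply/card_leTP; exists (fun x => projT1 (cid (domG x))) => x x' Exx'.
  apply: (G2 _ _ (projT1 (cid (domG x)))); first exact: projT2 (cid (domG x)).
  by rewrite Exx'; exact: projT2 (cid (domG x')).
move=> /existsNP[x0 /forallNP Nx0].
have [ranG|] := pselect (forall y, exists x, G (x, y)).
  right; apply/card_leTP; exists (fun y => projT1 (cid (ranG y))) => y y' Eyy'.
  apply: (G1 (projT1 (cid (ranG y)))); first exact: projT2 (cid (ranG y)).
  by rewrite Eyy'; exact: projT2 (cid (ranG y')).
move=> /existsNP[y0 /forallNP Ny0].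
exfalso; apply: (Gmax (G `|` [set (x0, y0)])).
  split; first by move=> p; left.
  by move=> /(_ (x0, y0) (or_intror erefl)); exact: Nx0.
split=> [x y y'|x x' y] [A|[Ex Ey]] [B|[Ex' Ey']].
- exact: G1 A B.
- by move: A; rewrite Ex' => /Nx0.
- by move: B; rewrite Ex => /Nx0.
- by rewrite Ey Ey'.
- exact: G2 A B.
- by move: A; rewrite Ey' => /Ny0.
- by move: B; rewrite Ey => /Ny0.
- by rewrite Ex Ex'.
Qed.

Section Small.
Variables (kappa : Type).

Definition smallT (S : Type) : Prop := small kappa [set: S].

Lemma smallT_inj (S T : Type) (f : S -> T) : injective f -> smallT T -> smallT S.
Proof.
move=> fI [T1 T2]; have ST : [set: S] #<= [set: T] by apply/card_leTP; exists f.
split; first exact: card_le_trans ST T1.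
by move=> H; apply: T2; exact: card_le_trans H ST.
Qed.

Lemma smallT_surj (S T : Type) (f : S -> T) : (forall y, exists x, f x = y) -> smallT S -> smallT T.
Proof.
move=> fS; apply: (@smallT_inj _ _ (fun y => projT1 (cid (fS y)))) => y y' E.
by rewrite -(projT2 (cid (fS y))) E (projT2 (cid (fS y'))).
Qed.

Lemma smallE (S : Type) (A : set S) : small kappa A <-> smallT A.
Proof.
have E : [set: A] #= A by exact: card_setT.
by rewrite /smallT /small /card_lt; rewrite (card_le_eql E) (card_le_eqr E).
Qed.

Lemma smallT_image (S T : Type) (f : S -> T) : smallT S -> small kappa (range f).
Proof.
move=> Ss; apply/smallE.
apply: (@smallT_surj S (range f) (fun x => exist _ (f x) (mem_set (imageT f x)))) Ss.
by move=> [y yP]; have [x _ Exy] := set_mem yP; exists x; apply: val_inj.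
Qed.

Lemma small_sub (S : Type) (A B : set S) : A `<=` B -> small kappa B -> small kappa A.
Proof.
move=> AB [B1 B2]; have LE := subset_card_le AB.
split; first exact: card_le_trans LE B1.
by move=> H; apply: B2; exact: card_le_trans H LE.
Qed.

(** The relational form admits indices [t] without a value, such as a formula that defines no
    endomorphism. *)
Lemma small_rel (S T : Type) (A : set S) (R : T -> S -> Prop) :
  smallT T -> (forall t x y, R t x -> R t y -> x = y) ->
  (forall x, A x -> exists t, R t x) -> small kappa A.
Proof.
move=> Ts RF RA; apply/smallE.
pose g (x : A) := projT1 (cid (RA (set_val x) (set_mem (valP x)))).
have gP x : R (g x) (set_val x) := projT2 (cid (RA (set_val x) (set_mem (valP x)))).
apply: (@smallT_inj _ _ g) Ts => x y E; apply: val_inj.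
by apply: RF (gP x) _; rewrite E; exact: gP.
Qed.

Lemma small_sub_range (S T : Type) (A : set S) (f : T -> S) :
  smallT T -> (forall x, A x -> exists t, f t = x) -> small kappa A.
Proof. by move=> Ts; apply: (small_rel Ts) => t x y <-. Qed.

Hypothesis kappaS : strong_limit kappa.

(** The strong limit is applied to a copy of [S] inside [kappa]. Options, pairs and sequences are
    then small because they inject into power sets, without cardinal arithmetic. *)
Lemma smallT_set (S : Type) : smallT S -> smallT (set S).
Proof.
move=> Ss; have [/card_leTP[f fI] _] := Ss.
have := kappaS (A := range f) (smallT_image f Ss).
have imf (A : set S) : [set B | B `<=` range f] (f @` A).
  by move=> y [x _ <-]; exact: imageT.
move=> /smallE; apply: (@smallT_inj _ [set B | B `<=` range f] (fun A => exist _ (f @` A) (mem_set (imf A)))).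
move=> A B [] E; apply/seteqP; split=> x Ax.
  have : (f @` B) (f x) by rewrite -E; exact: imageP.
  by move=> [y By /fI <-].
have : (f @` A) (f x) by rewrite E; exact: imageP.
by move=> [y By /fI <-].
Qed.

Lemma smallT_option (S : Type) : smallT S -> smallT (option S).
Proof.
move=> /smallT_set; apply: (@smallT_inj _ _ (fun o => if o is Some x then [set x] else set0)).
move=> [x|] [y|] //.
- by move=> E; congr Some; have : [set y] x by rewrite -E.
- by move=> E; have : @set0 S x by rewrite -E.
- by move=> E; have : @set0 S y by rewrite E.
Qed.

Lemma smallT_bool (S : Type) : smallT S -> smallT (S * bool).
Proof.
move=> /smallT_option/smallT_set.
apply: (@smallT_inj _ _ (fun p : S * bool => if p.2 then [set Some p.1] else [set Some p.1; None])).
move=> [x [|]] [y [|]] //= E.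
- by have [->] : [set Some y] (Some x) by rewrite -E.
- by have : [set Some x] None by rewrite E; right.
- by have : [set Some y] None by rewrite -E; right.
- by have [[->]|] : [set Some y; None] (Some x) by rewrite -E; left.
Qed.

Lemma smallT_sum (S T : Type) : smallT S -> smallT T -> smallT (S + T).
Proof.
move=> Ss Ts; have [/card_leTP[f fI]|/card_leTP[f fI]] := card_leT_total S T.
  apply: (@smallT_inj _ _ (fun x => match x with inl s => (f s, true) | inr t => (t, false) end) _ (smallT_bool Ts)).
  by move=> [s|t] [s'|t'] // [] => [/fI|] ->.
apply: (@smallT_inj _ _ (fun x => match x with inl s => (s, true) | inr t => (f t, false) end) _ (smallT_bool Ss)).
by move=> [s|t] [s'|t'] // [] => [|/fI] ->.
Qed.

Lemma smallT_prod (S T : Type) : smallT S -> smallT T -> smallT (S * T).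
Proof.
move=> Ss Ts; have := smallT_set (smallT_sum Ss Ts).
apply: (@smallT_inj _ _ (fun p : S * T => [set inl p.1; inr p.2])).
move=> [x y] [x' y'] /= E; congr pair.
  by have [[->]|] : [set inl x'; inr y'] (inl x : S + T) by rewrite -E; left.
by have [|[->]] : [set inl x'; inr y'] (inr y : S + T) by rewrite -E; right.
Qed.

Lemma small_setU (S : Type) (A B : set S) : small kappa A -> small kappa B ->
  small kappa (A `|` B).
Proof.
move=> /smallE As /smallE Bs.
apply: (small_sub_range (f := copair set_val set_val) (smallT_sum As Bs)).
by move=> x [] Hx; [exists (inl (exist _ x (mem_set Hx)))|exists (inr (exist _ x (mem_set Hx)))].
Qed.

Hypothesis nat_small : smallT nat.

Lemma smallT_seq (S : Type) : smallT S -> smallT (seq S).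
Proof.
move=> Ss; have := smallT_set (smallT_prod nat_small Ss).
apply: (@smallT_inj _ _ (fun s => [set p | onth s p.1 = Some p.2])) => s t E.
have {}E i x : (onth s i = Some x) = (onth t i = Some x).
  by have /= := f_equal (fun A : set _ => A (i, x)) E.
elim: s t E => [|x s IH] [|y t] E //.
- by have := E 0 y; rewrite propeqE => -[_ /(_ erefl)].
- by have := E 0 x; rewrite propeqE => -[/(_ erefl)].
- have /= E0 := E 0 x; have [<-] : Some y = Some x by rewrite -E0.
  by congr cons; apply: IH => i z; exact: (E i.+1 z).
Qed.

Lemma InP_onth (S : Type) (x : S) (s : seq S) : List.In x s -> exists i, onth s i = Some x.
Proof. by elim: s => //= y s IH [->|/IH [i E]]; [exists 0|exists i.+1]. Qed.

Lemma small_bigseq (S T : Type) (f : T -> seq S) : smallT T ->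
  small kappa [set x | exists t, List.In x (f t)].
Proof.
move=> Ts; apply: (small_rel (R := fun p x => onth (f p.1) p.2 = Some x) (smallT_prod Ts nat_small)).
  by move=> p x y; move: (onth _ _) => o -> [].
by move=> x [t Ht]; have [i Ei] := InP_onth Ht; exists (t, i).
Qed.

Lemma small_seq (S : Type) (s : seq S) : small kappa [set x | List.In x s].
Proof.
apply: small_sub (small_bigseq (fun=> s) nat_small) => x; by exists 0.
Qed.

Lemma smallT_ord n : smallT 'I_n.
Proof. exact: smallT_inj val_inj nat_small. Qed.

End Small.

(** * Counting formulas *)

Section SmallFormulas.
Variables (L : language) (kappa : Type).
Hypothesis kappaS : strong_limit kappa.
Hypothesis sentence_small : card_lt [set: sentence L] [set: kappa].

(** [kappa] exceeds the number of sentences, and iterated implications already give infinitely many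
    of them. *)
Lemma smallT_nat : smallT kappa nat.
Proof.
apply: (@smallT_inj _ _ _ (fun n => iter n (Imp Bot) (Bot : sentence L)) _ sentence_small).
by elim=> [|n IH] [|m] //= [] /IH ->.
Qed.

Local Notation onat n := (iter n option void).

Fixpoint all_closure n : formula L (onat n) -> sentence L :=
  if n is n'.+1 return formula L (onat n) -> sentence L then fun phi => all_closure (All phi) else id.

Lemma all_closure_inj n : injective (@all_closure n).
Proof. by elim: n => //= n IH phi psi /IH []. Qed.

Fixpoint ord_onat n : 'I_n -> onat n :=
  if n is n'.+1 return 'I_n -> onat n then fun i => omap (@ord_onat n') (unlift ord0 i)
  else fun i => match i with Ordinal _ H => match notF H with end end.

Fixpoint onat_ord n : onat n -> 'I_n :=
  if n is n'.+1 return onat n -> 'I_n then fun o => oapp (fun x => lift ord0 (@onat_ord n' x)) ord0 o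
  else of_void _.

Lemma ord_onatK n : cancel (@ord_onat n) (@onat_ord n).
Proof. by elim: n => [[]//|n IH i] /=; case: unliftP => [j|] -> //=; rewrite IH. Qed.

(** Only the number of sentences is bounded. A formula is coded by the list of its variables and the
    universal closure of its pattern, a sentence; [ord_onat] turns the indices into the nested
    options that the closure binds. *)
Lemma smallT_formula X : smallT kappa X -> smallT kappa (formula L X).
Proof.
move=> Xs; have XS := smallT_prod kappaS (smallT_seq kappaS smallT_nat Xs) sentence_small.
have /choice[F FP] (phi : formula L X) : exists q : {n & (('I_n -> X) * formula L 'I_n)%type},
    phi = rename (projT2 q).1 (projT2 q).2.
  by have [n [w [psi ->]]] := formula_support phi; exists (existT _ n (w, psi)).
apply: (@smallT_inj _ _ _ (fun phi => (codom (projT2 (F phi)).1,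
  all_closure (rename (@ord_onat _) (projT2 (F phi)).2))) _ XS) => phi psi [].
move=> Ew Es; rewrite (FP phi) (FP psi) {FP}; move: Ew Es.
case: (F phi) (F psi) => k [w1 s1] [m [w2 s2]] /= Ew.
have E : k = m by have := congr1 size Ew; rewrite !size_codom !card_ord.
case: m / E w2 s2 Ew => w2 s2 Ew.
move=> /all_closure_inj/(congr1 (rename (@onat_ord k))); rewrite !rename_comp.
rewrite !(eq_rename (@ord_onatK k)) !rename_id => ->.
suff -> : w1 = w2 by [].
apply/funext => i; move: Ew; rewrite !codomE => /eq_in_map; apply.
by rewrite mem_enum.
Qed.
End SmallFormulas.

(** * Saturation, homogeneity and definable predicates *)

Definition ord0_elim (T : Type) (i : 'I_0) : T :=
  match i with Ordinal _ H => match notF H with end end.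

Lemma ord0_fun (T : Type) (f g : 'I_0 -> T) : f = g.
Proof. by apply/funext => -[]. Qed.

Section Uniform.
Variable L : language.

(** The formula is chosen before the structure, so that one formula serves in [U] and in [V] and
    elementarity applies to it. *)
Lemma conj_formula X k (phi : 'I_k -> formula L X) :
  exists chi : formula L X, forall (M : structure L) (v : X -> M),
    sat v chi <-> forall j, sat v (phi j).
Proof.
elim: k phi => [|k IH] phi.
  by exists (Neg Bot) => M v; split=> [_ []|_].
have [chi H] := IH (fun j => phi (lift ord0 j)).
exists (FAnd (phi ord0) chi) => M v; rewrite sat_And H; split=> [[H0 H1] j|Hj].
  by case: (unliftP ord0 j) => [i|] ->.
by split.
Qed.

Lemma ex_formula X k (psi : formula L ('I_k + X)) :
  exists chi : formula L X, forall (M : structure L) (w : X -> M),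
    sat w chi <-> exists y, sat (copair y w) psi.
Proof.
elim: k X psi => [|k IH] X psi.
  exists (rename (fun s : 'I_0 + X => match s with inl i => ord0_elim X i | inr x => x end) psi).
  move=> M w; rewrite sat_rename; split=> [H|[y]].
    exists (fun i => ord0_elim M i); move: H; congr sat.
    by apply/funext => -[[]|].
  by congr sat; apply/funext => -[[]|].
pose f (s : 'I_k.+1 + X) : 'I_k + option X :=
  match s with inl i => if unlift ord0 i is Some j then inl j else inr None
  | inr x => inr (Some x) end.
have [chi H] := IH _ (rename f psi).
exists (FEx chi) => M w; rewrite sat_Ex; split=> [[m]|[y Hy]].
  rewrite H => -[y']; rewrite sat_rename => Hy.
  exists (fun i => if unlift ord0 i is Some j then y' j else m).
  move: Hy; congr sat; apply/funext => -[i|x] //=.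
  by case: unliftP.
exists (y ord0); rewrite H; exists (fun j => y (lift ord0 j)); rewrite sat_rename.
move: Hy; congr sat; apply/funext => -[i|x] //=.
by case: unliftP => [j|] ->.
Qed.

End Uniform.

Section Families.
Variables (L : language) (kappa : Type) (M : structure L).

Lemma homogeneous_family (P : Type) (i j : P -> M) :
  strongly_homogeneous kappa M -> small kappa (range i) ->
  (forall phi : formula L P, sat i phi <-> sat j phi) ->
  exists sigma : M -> M, automorphism sigma /\ forall p, sigma (i p) = j p.
Proof.
move=> hom si ij.
have pre (x : range i) : exists p, i p = set_val x.
  by have [p _ Ep] := set_mem (valP x); exists p.
have [g gP] := choice pre.
(* The family may repeat elements; preservation of the formula [x = y] makes [j] repeat in the same
   places, so it factors through the range of [i]. *)
have jE p q : i p = i q -> j p = j q.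
  by move=> E; have /= := (ij (Eq (Var L p) (Var L q))).1 E.
have [|sigma [sA sE]] := hom _ si (j \o g).
  move=> phi; have := ij (rename g phi); rewrite !sat_rename.
  suff -> : i \o g = set_val by [].
  by apply/funext => x /=.
exists sigma; split=> // p.
have := sE (exist _ (i p) (mem_set (imageT i p))) => /= ->.
by apply: jE; rewrite gP.
Qed.

(** [saturated] speaks of complete types. The partial type [G] is completed by an ultrafilter on
    tuples that contains the solution sets of [G]: it decides every formula. *)
Lemma saturated_family (P : Type) (i : P -> M) n (G : set (formula L ('I_n + P))) :
  saturated kappa M -> small kappa (range i) ->
  (forall k (phi : 'I_k -> formula L ('I_n + P)), (forall j, G (phi j)) ->
    exists a, forall j, sat (copair a i) (phi j)) ->
  exists a, forall phi, G phi -> sat (copair a i) phi.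
Proof.
move=> satu si fin.
pose F : set_system ('I_n -> M) := [set S | exists k (phi : 'I_k -> formula L ('I_n + P)),
  (forall j, G (phi j)) /\ forall a, (forall j, sat (copair a i) (phi j)) -> S a].
have FF : ProperFilter F.
  split; first by move=> [k [phi [Gphi H]]]; have [a /H] := fin _ _ Gphi.
  split.
  - by exists 0, (fun j => ord0_elim _ j); split=> // -[].
  - move=> A B [k [phi [Gphi HA]]] [l [psi [Gpsi HB]]].
    exists (k + l), (tcat phi psi); split=> [j|a H].
      by rewrite /tcat; case: fintype.split.
    split; [apply: HA => j|apply: HB => j].
      by have := H (lshift l j); rewrite /tcat -[lshift l j]/(unsplit (inl j)) unsplitK.
    by have := H (rshift k j); rewrite /tcat -[rshift k j]/(unsplit (inr j)) unsplitK.
  - by move=> A B AB [k [phi [Gphi H]]]; exists k, phi; split=> // a /H/AB.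
have [W [WU FW]] := ultraFilterLemma FF.
have WF : ProperFilter W by exact: ultra_proper.
pose p : set (formula L ('I_n + range i)) :=
  [set phi | W [set a | sat (copair a set_val) phi]].
have [|a aP] := satu _ si n p.
  split=> [k phi Hphi|phi].
    have : W [set a | forall j, sat (copair a set_val) (phi j)].
      exact: (@filter_forall _ _ (fun j a => sat (copair a set_val) (phi j)) W _ Hphi).
    by move=> /filter_ex[a Ha]; exists a.
  have [|] := @in_ultra_setVsetC _ W [set a | sat (copair a set_val) phi] WU; first by left.
  by right.
pose g q : range i := exist _ (i q) (mem_set (imageT i q)).
have E b : copair b set_val \o copair inl (inr \o g) = copair b i :> ('I_n + P -> M).
  by apply/funext => -[].
exists a => phi Gphi.
have /aP : p (rename (copair inl (inr \o g)) phi).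
  apply: FW; exists 1, (fun=> phi); split=> // b /(_ ord0).
  by rewrite /= sat_rename E.
by rewrite /tp /= sat_rename E.
Qed.

End Families.

Section Elementary.
Variables (L : language) (U V : structure L) (e : U -> V).
Hypothesis eE : elementary_embedding e.

Lemma elementary_inj : injective e.
Proof.
move=> x y E; exact: (eE (Eq (Var L true) (Var L false)) (fun b : bool => if b then x else y)).2.
Qed.

Lemma elementary_witness X k (v : X -> U) (psi : formula L ('I_k + X)) (y : 'I_k -> V) :
  sat (copair y (e \o v)) psi -> exists x, sat (copair x v) psi.
Proof.
move=> H; have [chi chiE] := ex_formula psi.
by apply/chiE/eE/chiE; exists y.
Qed.

Lemma tp_complete P (i : P -> U) n (a : 'I_n -> V) :
  complete_type i (tp (e \o i) a).
Proof.
split=> [k phi H|phi]; last by exact: EM.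
have [chi chiE] := conj_formula phi.
have [|x Hx] := @elementary_witness _ _ i chi a; first by apply/chiE.
by exists x; apply/chiE.
Qed.

Lemma realise_down kappa P (i : P -> U) n (a : 'I_n -> V) :
  saturated kappa U -> small kappa (range i) ->
  exists x : 'I_n -> U, forall phi : formula L ('I_n + P),
    sat (copair a (e \o i)) phi <-> sat (copair x i) phi.
Proof.
move=> sU si; have [fin _] := tp_complete i a.
have [x xP] := saturated_family sU si fin.
exists x => phi; split=> [/xP//|H]; apply: contrapT => H'.
by have /= := xP (Neg phi) H'; apply.
Qed.

Lemma complete_realised n p (a : 'I_n -> V) :
  complete_type (@id U) p -> realises e a p -> p = tp e a.
Proof.
move=> [fin cp] ap; apply/seteqP; split=> // phi Hphi.
have [//|pN] := cp phi; have := ap _ pN; by rewrite /tp /= => /(_ Hphi).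
Qed.

End Elementary.

Section Definability.
Variables (L : language) (M : structure L).

(** Definability of a predicate on assignments: formulas are assembled through the closure lemmas
    below and never written out. *)
Definition Df (X : Type) (P : (X -> M) -> Prop) : Prop :=
  exists phi : formula L X, forall v, P v <-> sat v phi.

Lemma Df_iff X (P Q : (X -> M) -> Prop) : (forall v, P v <-> Q v) -> Df P -> Df Q.
Proof. by move=> PQ [phi H]; exists phi => v; rewrite -PQ. Qed.

Lemma Df_not X (P : (X -> M) -> Prop) : Df P -> Df (fun v => ~ P v).
Proof. by move=> [phi H]; exists (Neg phi) => v; rewrite sat_Neg H. Qed.

Lemma Df_imp X (P Q : (X -> M) -> Prop) : Df P -> Df Q -> Df (fun v => P v -> Q v).
Proof. by move=> [phi H] [psi H']; exists (Imp phi psi) => v /=; rewrite H H'. Qed.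

Lemma Df_and X (P Q : (X -> M) -> Prop) : Df P -> Df Q -> Df (fun v => P v /\ Q v).
Proof. by move=> [phi H] [psi H']; exists (FAnd phi psi) => v; rewrite sat_And H H'. Qed.

Lemma Df_all X (Q : M -> (X -> M) -> Prop) :
  Df (fun v : option X -> M => Q (v None) (v \o Some)) -> Df (fun v => forall m, Q m v).
Proof.
move=> [phi H]; exists (All phi) => v /=; split=> [Qv m|Qv m].
  by rewrite -H; exact: Qv.
by have := Qv m; rewrite -H.
Qed.

Lemma Df_ex X (Q : M -> (X -> M) -> Prop) :
  Df (fun v : option X -> M => Q (v None) (v \o Some)) -> Df (fun v => exists m, Q m v).
Proof.
move=> [phi H]; exists (FEx phi) => v; rewrite sat_Ex; split=> [[m Qm]|[m Qm]]; exists m.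
  by rewrite -H; exact: Qm.
by have := Qm; rewrite -H.
Qed.

Lemma Df_eq X (s t : term L X) : Df (fun v => eval v s = eval v t).
Proof. by exists (Eq s t). Qed.

Lemma Df_graph (G : M -> M -> Prop) X (x y : X) :
  zero_definable_graph G -> Df (fun v => G (v x) (v y)).
Proof.
move=> [phi H]; exists (rename (tnth [tuple x; y]) phi) => v.
rewrite sat_rename H; suff -> : v \o tnth [tuple x; y] = tnth [tuple v x; v y] by [].
by apply/funext => -[[|[|m]] Hm].
Qed.

Lemma Df_zero_graph (G : M -> M -> Prop) :
  Df (fun v : bool -> M => G (v true) (v false)) -> zero_definable_graph G.
Proof.
move=> [phi H]; exists (rename (fun b : bool => if b then ord0 else ord_max : 'I_2) phi).
move=> x y; rewrite sat_rename; set w := _ \o _.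
by rewrite (_ : G x y = G (w true) (w false)) //; exact: H.
Qed.

End Definability.

Lemma Df_witness (L : language) (U V : structure L) (e : U -> V) (X : Type)
    (Q : V -> (X -> V) -> Prop) (v : X -> U) :
  elementary_embedding e ->
  Df (fun w : option X -> V => Q (w None) (w \o Some)) ->
  (exists y, Q y (e \o v)) -> exists x, Q (e x) (e \o v).
Proof.
move=> eE [phi H] [y Qy].
have : sat (e \o v) (FEx phi) by rewrite sat_Ex; exists y; rewrite -H.
rewrite -eE sat_Ex => -[x]; rewrite (eE _ _ (oapp v x)) -H => Qx.
by exists x.
Qed.

(** * Linear arithmetic in ordered groups *)

(** The language names only order, sum and zero; opposites, halves and inverse maps are picked by
    this choice. *)
Definition choose_or (T : Type) (x0 : T) (P : T -> Prop) : T :=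
  match pselect (exists x, P x) with left H => projT1 (cid H) | right _ => x0 end.

Lemma choose_orP (T : Type) (x0 : T) (P : T -> Prop) : (exists x, P x) -> P (choose_or x0 P).
Proof. by rewrite /choose_or; case: pselect => // H _; exact: projT2 (cid H). Qed.

Definition oopp (L : og_language) (M : structure L) (x : M) : M :=
  choose_or (ozero M) (fun y => oadd x y = ozero M).

Definition ohalf (L : og_language) (M : structure L) (x : M) : M :=
  choose_or (ozero M) (fun y => oadd y y = x).

Definition ole (L : og_language) (M : structure L) (x y : M) : Prop := ~ olt y x.

Declare Scope og_scope.
Delimit Scope og_scope with og.
Notation "x + y" := (oadd x y) : og_scope.
Notation "x - y" := (oadd x (oopp y)) : og_scope.
Notation "- x" := (oopp x) : og_scope.
Notation "x < y" := (olt x y) : og_scope.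
Notation "x <= y" := (ole x y) : og_scope.
Notation "0" := (ozero _) : og_scope.

(* Fourier-Motzkin elimination.  A row [(s, l, r)] stands for the inequality
   [l.x < r.x] (strict when [s]); keeping both sides avoids subtraction. *)
Section FourierMotzkin.

Definition fm_row : Type := bool * seq nat * seq nat.

Fixpoint ladd (l r : seq nat) : seq nat :=
  match l, r with
  | a :: l', b :: r' => (a + b) :: ladd l' r'
  | [::], _ => r
  | _, [::] => l
  end.

Definition lscale (k : nat) : seq nat -> seq nat := map (muln k).

Fixpoint lcancel (l r : seq nat) : seq nat * seq nat :=
  match l, r with
  | a :: l', b :: r' =>
      let p := lcancel l' r' in ((a - b) :: p.1, (b - a) :: p.2)
  | _, _ => (l, r)
  end.

Definition fm_normal (c : fm_row) : fm_row :=
  let p := lcancel c.1.2 c.2 in (c.1.1, p.1, p.2).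

(** In [c] variable [i] is bounded above, in [d] below. Scaling each row by the coefficient in the
    other puts [i] on both sides with the same coefficient, which [fm_normal] cancels. *)
Definition fm_combine (i : nat) (c d : fm_row) : fm_row :=
  let n := nth 0 d.2 i in let m := nth 0 c.1.2 i in
  fm_normal (c.1.1 || d.1.1, ladd (lscale n c.1.2) (lscale m d.1.2),
             ladd (lscale n c.2) (lscale m d.2)).

Definition fm_upper i (c : fm_row) := nth 0 c.1.2 i > 0.
Definition fm_lower i (c : fm_row) := nth 0 c.2 i > 0.

Definition fm_eliminate (rows : seq fm_row) (i : nat) : seq fm_row :=
  undup ([seq c <- rows | ~~ fm_upper i c && ~~ fm_lower i c] ++
    [seq fm_combine i c d | c <- [seq c <- rows | fm_upper i c],
                            d <- [seq c <- rows | fm_lower i c]]).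

Definition fm_cost (rows : seq fm_row) (i : nat) :=
  count (fm_upper i) rows * count (fm_lower i) rows.

Fixpoint fm_best rows (i : nat) (s : seq nat) : nat :=
  if s is j :: s' then fm_best rows (if fm_cost rows j < fm_cost rows i then j else i) s' else i.

Fixpoint fm_run (n : nat) (vars : seq nat) (rows : seq fm_row) : seq fm_row :=
  if n is n'.+1 then
    let i := fm_best rows (head 0 vars) vars in
    fm_run n' (rem i vars) (fm_eliminate rows i)
  else rows.

Definition fm_contradiction (c : fm_row) :=
  [&& c.1.1, all (pred1 0) c.1.2 & all (pred1 0) c.2].

Inductive og_expr := OVar of nat | OZero | OAdd of og_expr & og_expr | OOpp of og_expr.

Inductive og_atom := OLt of og_expr & og_expr | OGe of og_expr & og_expr
  | OEq of og_expr & og_expr.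

Fixpoint og_linear (t : og_expr) : seq nat * seq nat :=
  match t with
  | OVar i => (ncons i 0 [:: 1], [::])
  | OZero => ([::], [::])
  | OAdd s t => let p := og_linear s in let q := og_linear t in
      (ladd p.1 q.1, ladd p.2 q.2)
  | OOpp t => let p := og_linear t in (p.2, p.1)
  end.

Definition fm_of (b : bool) (s t : og_expr) : fm_row :=
  let p := og_linear s in let q := og_linear t in
  fm_normal (b, ladd p.1 q.2, ladd q.1 p.2).

Definition fm_rows (a : og_atom) : seq fm_row :=
  match a with
  | OLt s t => [:: fm_of true s t]
  | OGe s t => [:: fm_of false t s]
  | OEq s t => [:: fm_of false s t; fm_of false t s]
  end.

Definition fm_check (n : nat) (atoms : seq og_atom) : bool :=
  has fm_contradiction (fm_run n (iota 0 n) (flatten (map fm_rows atoms))).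

End FourierMotzkin.

Section FMSound.
Variables (L : og_language) (M : structure L).
Hypothesis hM : ordered_abelian_group M.
Local Open Scope og_scope.
Implicit Types x y z : M.

Lemma oaddA : associative (@oadd L M). Proof. by case: hM => [[]]. Qed.
Lemma oaddC : commutative (@oadd L M). Proof. by case: hM => [[]]. Qed.
Lemma oadd0 : left_id (ozero M) (@oadd L M). Proof. by case: hM => [[]]. Qed.
Lemma oaddr0 : right_id (ozero M) (@oadd L M).
Proof. by move=> x; rewrite oaddC oadd0. Qed.
Lemma oaddN x : x + - x = 0.
Proof.
by apply: (@choose_orP _ _ (fun y => x + y = 0)); case: hM => [[_ _ _ H] _ _].
Qed.
Lemma oltxx x : ~ x < x. Proof. by case: hM => _ []. Qed.
Lemma olt_trans x y z : x < y -> y < z -> x < z.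
Proof. by case: hM => _ [_ H _] _; exact: H. Qed.
Lemma olt_total x y : [\/ x < y, x = y | y < x].
Proof. by case: hM => _ [_ _ H] _; exact: H. Qed.
Lemma olt_add2r x y z : x < y -> x + z < y + z.
Proof. by case: hM => _ _; exact. Qed.
Lemma ole_eqVlt x y : x <= y <-> x < y \/ x = y.
Proof.
split=> [H|[H H'|-> /oltxx//]]; last exact: oltxx (olt_trans H H').
by case: (olt_total x y); [left|right|].
Qed.

Fixpoint nm (n : nat) x : M := if n is n'.+1 then x + nm n' x else 0.

Fixpoint ev (env : seq M) (l : seq nat) : M :=
  match l, env with
  | n :: l', x :: env' => nm n x + ev env' l'
  | _, _ => 0
  end.

Lemma nmD m n x : nm (m + n)%N x = nm m x + nm n x.
Proof. by elim: m => [|m IH] /=; rewrite ?oadd0 // IH oaddA. Qed.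

Lemma oaddACA : interchange (@oadd L M) (@oadd L M).
Proof. by move=> x y z t; rewrite !oaddA; congr (_ + _); rewrite -!oaddA (oaddC y). Qed.

Lemma nm0 n : nm n (ozero M) = 0.
Proof. by elim: n => //= n ->; rewrite oadd0. Qed.

Lemma nmDr n x y : nm n (x + y) = nm n x + nm n y.
Proof. by elim: n => [|n IH] /=; rewrite ?oadd0 // IH oaddACA. Qed.

Lemma nmM m n x : nm (m * n)%N x = nm m (nm n x).
Proof. by elim: m => //= m IH; rewrite mulSn nmD IH. Qed.

Lemma ev_add env l r : ev env (ladd l r) = ev env l + ev env r.
Proof.
elim: l r env => [|a l IH] [|b r] [|x env] //=; rewrite ?oadd0 ?oaddr0 //.
by rewrite IH nmD oaddACA.
Qed.

Lemma ev_scale env k l : ev env (lscale k l) = nm k (ev env l).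
Proof.
elim: l env => [|a l IH] [|x env] //=; rewrite ?nm0 //.
by rewrite IH nmM nmDr.
Qed.

Lemma ev_cancel env l r : exists z, ev env l = ev env (lcancel l r).1 + z /\
  ev env r = ev env (lcancel l r).2 + z.
Proof.
elim: l r env => [|a l IH] r env.
  by exists 0; rewrite !oaddr0; case: r.
case: r => [|b r]; first by exists 0; rewrite !oaddr0.
case: env => [|x env]; first by exists 0; rewrite !oaddr0.
have [z [E1 E2]] := IH r env; exists (nm (minn a b) x + z) => /=.
by rewrite E1 E2; split; rewrite [RHS]oaddACA -nmD; congr (nm _ x + _); rewrite minnE; lia.
Qed.

Definition row_ok env (c : fm_row) : Prop :=
  if c.1.1 then ev env c.1.2 < ev env c.2 else ev env c.1.2 <= ev env c.2.

Lemma olt_add2rE x y z : x + z < y + z <-> x < y.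
Proof.
split=> [H|]; last exact: olt_add2r.
by have := olt_add2r (- z) H; rewrite -!oaddA oaddN !oaddr0.
Qed.

Lemma fm_normal_ok env c : row_ok env c -> row_ok env (fm_normal c).
Proof.
case: c => -[s l] r; rewrite /row_ok /=; have [z [-> ->]] := ev_cancel env l r.
by case: s; rewrite /ole olt_add2rE.
Qed.

Lemma olt_add x y z t : x < y -> z < t -> x + z < y + t.
Proof.
move=> H H'; apply: (@olt_trans _ (y + z)); first exact: olt_add2r.
by rewrite !(oaddC y); exact: olt_add2r.
Qed.

Lemma ole_refl x : x <= x. Proof. exact: oltxx. Qed.

Lemma ole_add x y z t : x <= y -> z <= t -> x + z <= y + t.
Proof.
rewrite !ole_eqVlt => -[H|->] [H'|->]; [left|left|left|by right].
- exact: olt_add.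
- exact: olt_add2r.
- by rewrite !(oaddC y); exact: olt_add2r.
Qed.

Lemma olt_le_add x y z t : x < y -> z <= t -> x + z < y + t.
Proof. by move=> H /ole_eqVlt[H'|->]; [exact: olt_add|exact: olt_add2r]. Qed.

Lemma nm_ole k x y : x <= y -> nm k x <= nm k y.
Proof. by move=> H; elim: k => [|k IH] /=; [exact: ole_refl|exact: ole_add]. Qed.

Lemma nm_olt k x y : (0 < k)%N -> x < y -> nm k x < nm k y.
Proof.
by case: k => // k _ H; apply: olt_le_add => //; apply: nm_ole => /(olt_trans H)/oltxx.
Qed.

Lemma fm_combine_ok env i c d : fm_upper i c -> fm_lower i d ->
  row_ok env c -> row_ok env d -> row_ok env (fm_combine i c d).
Proof.
rewrite /fm_upper /fm_lower /fm_combine => Hm Hn Hc Hd; apply: fm_normal_ok.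
move: Hm Hn Hc Hd; case: c d => -[s l] r [[s' l'] r']; rewrite /row_ok /=.
move: (nth 0%N r' i) (nth 0%N l i) => n m Hm Hn; rewrite !ev_add !ev_scale.
case: s s' => -[] /= Hc Hd.
- by apply: olt_add; apply: nm_olt.
- by apply: olt_le_add; [apply: nm_olt|apply: nm_ole].
- by rewrite !(oaddC (nm n _)); apply: olt_le_add; [apply: nm_olt|apply: nm_ole].
- by apply: ole_add; apply: nm_ole.
Qed.

Definition rows_ok env (rows : seq fm_row) := forall c, c \in rows -> row_ok env c.

Lemma fm_eliminate_ok env i rows : rows_ok env rows -> rows_ok env (fm_eliminate rows i).
Proof.
move=> H c; rewrite mem_undup mem_cat => /orP[|].
  by rewrite mem_filter => /andP[_ /H].
move=> /allpairsP[[d d'] /= [Hd Hd' ->]].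
move: Hd Hd'; rewrite !mem_filter => /andP[H1 /H H2] /andP[H3 /H H4].
exact: fm_combine_ok.
Qed.

Lemma fm_run_ok env n vars rows : rows_ok env rows -> rows_ok env (fm_run n vars rows).
Proof. by elim: n vars rows => //= n IH vars rows H; apply/IH/fm_eliminate_ok. Qed.

Lemma ev_all0 env l : all (pred1 0%N) l -> ev env l = 0.
Proof.
elim: l env => [|a l IH] [|x env] //= /andP[/eqP -> /IH ->].
by rewrite oadd0.
Qed.

Fixpoint og_eval (env : seq M) (t : og_expr) : M :=
  match t with
  | OVar i => nth 0 env i
  | OZero => 0
  | OAdd s t => og_eval env s + og_eval env t
  | OOpp t => - og_eval env t
  end.

Lemma ev_unit env i : ev env (ncons i 0%N [:: 1%N]) = nth 0 env i.
Proof.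
have ev_nil env' : ev env' [::] = 0 by case: env'.
rewrite /ncons; elim: i env => [|i IH] [|x env] //=;
  by rewrite ?oadd0 ?ev_nil ?oaddr0 ?nth_nil.
Qed.

Lemma og_linearP env t :
  og_eval env t + ev env (og_linear t).2 = ev env (og_linear t).1.
Proof.
elim: t => [i||s IHs t IHt|t IH] /=.
- by rewrite ev_unit; case: env => [|x env]; rewrite oaddr0.
- by case: env => [|x env]; rewrite oadd0.
- by rewrite !ev_add oaddACA IHs IHt.
- by rewrite -IH oaddA (oaddC (- _)) oaddN oadd0.
Qed.

Lemma fm_of_ok env (b : bool) s t :
  (if b then og_eval env s < og_eval env t else og_eval env s <= og_eval env t) ->
  row_ok env (fm_of b s t).
Proof.
move=> H; apply: fm_normal_ok; rewrite /row_ok /= !ev_add -!og_linearP.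
rewrite -!oaddA (oaddC (ev _ (og_linear t).2)).
by case: b H; rewrite /ole olt_add2rE.
Qed.

Definition atom_sem env (a : og_atom) : Prop :=
  match a with
  | OLt s t => og_eval env s < og_eval env t
  | OGe s t => ~ (og_eval env s < og_eval env t)
  | OEq s t => og_eval env s = og_eval env t
  end.

Lemma fm_rows_ok env a : atom_sem env a -> rows_ok env (fm_rows a).
Proof.
case: a => s t /= H c; rewrite !inE.
- by move=> /eqP ->; exact: fm_of_ok.
- by move=> /eqP ->; exact: fm_of_ok.
- by move=> /orP[] /eqP ->; apply: fm_of_ok; rewrite H; exact: ole_refl.
Qed.

(** The iterated implication is the shape of a goal [False] after its hypotheses have been reverted,
    so the tactic only has to reify and compute. *)
Theorem fm_sound env n atoms : fm_check n atoms = true ->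
  foldr (fun a P => atom_sem env a -> P) False atoms.
Proof.
move=> chk; have : rows_ok env (flatten (map fm_rows [::])) by [].
(* [done] collects the atoms already introduced, whose rows are known to hold. *)
rewrite -[atoms]cat0s in chk; move: [::] chk => done.
elim: atoms done => [|a atoms IH] done chk H /=.
  move/hasP: chk => [[[s l] r]]; rewrite cats0.
  move=> /(fm_run_ok H) /[swap] /and3P[/= -> /ev_all0 El /ev_all0 Er].
  by rewrite /row_ok /= El Er => /oltxx.
move=> Ha; apply: (IH (rcons done a)); first by rewrite cat_rcons.
move=> c; rewrite map_rcons flatten_rcons mem_cat => /orP[/H//|].
exact: fm_rows_ok.
Qed.

End FMSound.

(** Of divisibility only halving is kept; distances are compared up to a factor of two
    throughout. *)
Record ogroup (L : og_language) (M : structure L) : Prop := OGroup {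
  ogroup_og :> ordered_abelian_group M ;
  ogroup_div : forall x : M, exists y, oadd y y = x ;
  ogroup_pos : exists x : M, olt (ozero M) x ;
  ogroup_omin : o_minimal M }.

Ltac og_index x env :=
  lazymatch env with
  | x :: _ => constr:(0%N)
  | _ :: ?env' => let i := og_index x env' in constr:(S i)
  end.

Ltac og_insert x env :=
  lazymatch env with
  | context [x :: _] => env
  | _ => constr:(x :: env)
  end.

Ltac og_atoms t env :=
  lazymatch t with
  | oadd ?x ?y => let env := og_atoms x env in og_atoms y env
  | oopp ?x => og_atoms x env
  | ozero _ => env
  | ?x => og_insert x env
  end.

Ltac og_reify t env :=
  lazymatch t with
  | oadd ?x ?y => let a := og_reify x env in let b := og_reify y env in constr:(OAdd a b)
  | oopp ?x => let a := og_reify x env in constr:(OOpp a)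
  | ozero _ => constr:(OZero)
  | ?x => let i := og_index x env in constr:(OVar i)
  end.

Ltac og_goal_env g env :=
  lazymatch g with
  | (~ (olt ?x ?y)) -> ?h => let env := og_atoms x env in let env := og_atoms y env in og_goal_env h env
  | (olt ?x ?y) -> ?h => let env := og_atoms x env in let env := og_atoms y env in og_goal_env h env
  | (?x = ?y) -> ?h => let env := og_atoms x env in let env := og_atoms y env in og_goal_env h env
  | _ => env
  end.

Ltac og_goal_reify g env :=
  lazymatch g with
  | (~ (olt ?x ?y)) -> ?h => let a := og_reify x env in let b := og_reify y env in
      let r := og_goal_reify h env in constr:(OGe a b :: r)
  | (olt ?x ?y) -> ?h => let a := og_reify x env in let b := og_reify y env in
      let r := og_goal_reify h env in constr:(OLt a b :: r)
  | (?x = ?y) -> ?h => let a := og_reify x env in let b := og_reify y env in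
      let r := og_goal_reify h env in constr:(OEq a b :: r)
  | _ => constr:(@nil og_atom)
  end.

Ltac og_group := match goal with h : @ogroup _ _ |- _ => constr:(h) end.

Ltac og_false :=
  let hM := og_group in
  let T := type of hM in
  lazymatch T with
  | @ogroup ?L ?M =>
    repeat match goal with
    | H : @ole L M _ _ |- _ => unfold ole in H; revert H
    | H : @olt L M _ _ |- _ => revert H
    | H : ~ (@olt L M _ _) |- _ => revert H
    | H : @eq (carrier M) _ _ |- _ => revert H
    end;
    let g := lazymatch goal with |- ?g => g end in
    let env := og_goal_env g (@nil (carrier M)) in
    let atoms := og_goal_reify g env in
    let n := eval compute in (size env) in
    exact (fm_sound (ogroup_og hM) env (n := n) (atoms := atoms) (@eq_refl bool true <: fm_check n atoms = true))
  end.

Ltac oag :=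
  intros;
  lazymatch goal with
  | |- False => og_false
  | |- ~ _ => let H := fresh in intro H; og_false
  | |- ole _ _ => let H := fresh in intro H; og_false
  | |- olt _ _ => apply: contrapT; let H := fresh in intro H; og_false
  | |- @eq (carrier ?M) ?x ?y =>
      let H := fresh in
      let hM := og_group in
      destruct (olt_total hM x y) as [H|H|H]; [exfalso; og_false|exact H|exfalso; og_false]
  end.

(** * Partial endomorphisms *)

Lemma seq_extremum (T : Type) (P : T -> Prop) (R : T -> T -> Prop) (s : seq T) :
  (forall x, P x -> R x x) ->
  (forall x y z, P x -> P y -> P z -> R x y -> R y z -> R x z) ->
  (forall x y, P x -> P y -> R x y \/ R y x) ->
  (exists x, List.In x s /\ P x) ->
  exists m, [/\ List.In m s, P m & forall x, List.In x s -> P x -> R x m].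
Proof.
move=> Rxx Rtr Rtot; elim: s => [[x []//]|y s IH [x [xs Px]]].
have [[z [zs Pz]]|N] := pselect (exists z, List.In z s /\ P z).
  have [m [ms Pm mM]] := IH (ex_intro _ z (conj zs Pz)).
  have [Py|nPy] := pselect (P y); last first.
    by exists m; split=> //; [right|move=> t [<- //|/mM H /H]].
  have [ym|my] := Rtot y m Py Pm.
    by exists m; split=> //; [right|move=> t [<- //|/mM H /H]].
  exists y; split=> //; first by left.
  by move=> t [<-|/mM H Pt]; [exact: Rxx|exact: (Rtr _ _ _ Pt Pm Py (H Pt) my)].
have Exy : x = y by case: xs => // xs; case: N; exists x.
rewrite -Exy; exists x; split=> //; first by left.
by move=> t [<-|ts] Pt; [exact: Rxx|case: N; exists t].
Qed.

(** * One-variable consequences of o-minimality *)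

Section OMinimal.
Variables (L : og_language) (V : structure L).
Hypothesis gV : ogroup V.
Local Open Scope og_scope.
Implicit Types x y z : V.

Lemma ohalfD x : ohalf x + ohalf x = x.
Proof. exact: (@choose_orP V (ozero V) (fun y => y + y = x) (ogroup_div gV x)). Qed.

Definition uset (S : V -> Prop) : Prop := definable [set a : 'I_1 -> V | S (a ord0)].

Lemma uset_Df Y (Q : V -> (Y -> V) -> Prop) (w : Y -> V) :
  Df (fun v : option Y -> V => Q (v None) (v \o Some)) -> uset (Q^~ w).
Proof.
move=> [phi H]; exists (rename (fun o => if o is Some y then inr (w y) else inl ord0) phi).
move=> a; rewrite sat_rename /=.
by rewrite (H (fun o => if o is Some y then w y else a ord0)) /=;
  suff -> : copair a id \o (fun o => if o is Some y then inr (w y) else inl ord0) =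
     (fun o => if o is Some y then w y else a ord0) by []; apply/funext => -[].
Qed.

(** [E] lists the isolated points and the ends of the intervals of a decomposition of [S]; a change
    of membership has to meet one of them. All later uses of o-minimality go through this form. *)
Lemma endpoints (S : V -> Prop) : uset S ->
  exists E : seq V, forall x y, x < y -> ~ (S x <-> S y) ->
    exists z, [/\ List.In z E, x <= z & z <= y].
Proof.
move=> /(ogroup_omin gV (X := S))[j [k [pts [ivs ES]]]].
pose ends (o : option V) := if o is Some x then [:: x] else [::].
exists (map pts (enum 'I_j) ++ flatten [seq ends (ivs i).1 ++ ends (ivs i).2 | i <- enum 'I_k]).
have InE (T : finType) (g : T -> seq V) i z : List.In z (g i) -> List.In z (flatten (map g (enum T))).
  move=> Hz; have : i \in enum T by rewrite mem_enum.
  elim: (enum T) => //= t s IH; rewrite inE => /orP[/eqP <-|/IH H]; apply/List.in_or_app; tauto.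
have In1 i : List.In (pts i) (map pts (enum 'I_j)).
  have : i \in enum 'I_j by rewrite mem_enum.
  by elim: (enum _) => //= t s IH; rewrite inE => /orP[/eqP <-|/IH H]; tauto.
have In2 i z : (ivs i).1 = Some z \/ (ivs i).2 = Some z ->
    List.In z (flatten [seq ends (ivs i).1 ++ ends (ivs i).2 | i <- enum 'I_k]).
  by move=> Hz; apply: (InE _ _ i); apply/List.in_or_app; case: Hz => ->; [left|right]; left.
have SE x : S x <-> (exists i, x = pts i) \/ (exists i, open_interval (ivs i).1 (ivs i).2 x).
  by rewrite [in X in X <-> _]ES.
have aux (P Q : Prop) : ~ (P <-> Q) -> (P /\ ~ Q) \/ (~ P /\ Q).
  by have [] := pselect P; have [] := pselect Q; tauto.
move=> x y xy /aux[[Sx nSy]|[nSx Sy]].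
  move/SE: Sx => [[i Ei]|[i [Hl Hu]]].
    by exists x; split; [apply/List.in_or_app; left; rewrite Ei|oag|oag].
  case Eu : (ivs i).2 Hu => [b|] Hu.
    exists b; split; [apply/List.in_or_app; right; apply: In2; by right; exact: Eu|oag|].
    move=> yb; apply: nSy; apply/SE; right; exists i; rewrite /open_interval /= Eu; split=> //.
    by case: (ivs i).1 Hl => // a ?; oag.
  exfalso; apply: nSy; apply/SE; right; exists i; rewrite /open_interval /= Eu; split=> //.
  by case: (ivs i).1 Hl => // a ?; oag.
move/SE: Sy => [[i Ei]|[i [Hl Hu]]].
  by exists y; split; [apply/List.in_or_app; left; rewrite Ei|oag|oag].
case Eu : (ivs i).1 Hl => [b|] Hl.
  exists b; split; [apply/List.in_or_app; right; apply: In2; by left; exact: Eu| |oag].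
  move=> yb; apply: nSx; apply/SE; right; exists i; rewrite /open_interval /= Eu; split=> //.
  by case: (ivs i).2 Hu => // a ?; oag.
exfalso; apply: nSx; apply/SE; right; exists i; rewrite /open_interval /= Eu; split=> //.
by case: (ivs i).2 Hu => // a ?; oag.
Qed.

Lemma olt_le x y : x < y -> x <= y. Proof. oag. Qed.

(** Without an infimum, every lower bound has a larger one. Each lower bound then lies below some
    endpoint of [B] that is again a lower bound; the largest of these finitely many endpoints gives
    a contradiction. *)
Lemma definable_inf (B : V -> Prop) l b0 : uset B -> B b0 -> (forall b, B b -> l <= b) ->
  exists m, (forall b, B b -> m <= b) /\
    forall z, m < z -> exists b, B b /\ b < z.
Proof.
move=> uB Bb0 lB; apply: contrapT => noinf.
pose LB z := forall b, B b -> z <= b.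
have up z : LB z -> exists2 z', LB z' & z < z'.
  move=> zB; apply: contrapT => Hz; apply: noinf; exists z; split=> // z' zz'.
  apply: contrapT => /forallNP H; apply: Hz; exists z' => // b Bb bz'.
  exact: H (conj Bb bz').
have [E HE] := endpoints uB.
(* [b1] lies below all endpoints that are not lower bounds, so an endpoint found at or below [b1] is
   a lower bound. *)
have [b1 [Bb1 b1E]] : exists b1, B b1 /\ forall z, List.In z E -> ~ LB z -> b1 < z.
  elim: E {HE} => [|z E [b [Bb bE]]]; first by exists b0.
  have [zB|] := pselect (LB z).
    by exists b; split=> // t [<- /(_ zB)|/bE].
  move=> /existsNP[c /not_implyP[Bc zc]].
  move: zc => /contrapT zc.
  case: (olt_total gV b c) => bc.
  - by exists b; split=> // t [<- _|/bE//]; oag.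
  - by exists b; split=> // t [<- _|/bE//]; rewrite bc.
  - by exists c; split=> // t [<- //|/bE H /H ?]; oag.
have HL z : LB z -> exists e, [/\ List.In e E, LB e & z <= e].
  move=> /[dup] zB /up[z' z'B zz'].
  have z'b1 := z'B _ Bb1.
  have zb1 : z < b1 by oag.
  have [|e [eE ze eb1]] := HE _ _ zb1.
    by move=> [_ /(_ Bb1) /z'B ?]; oag.
  exists e; split=> //; apply: contrapT => eN.
  by have ? := b1E _ eE eN; oag.
have [e0 [e0E e0B le0]] := HL l lB.
have [||||m [mE mB mM]] := @seq_extremum _ LB (@ole L V) E.
- by move=> x _; oag.
- by move=> x y z _ _ _ xy yz; oag.
- by move=> x y _ _; case: (olt_total gV x y) => ?; [left|left|right]; oag.
- by exists e0.
have [z zB mz] := up m mB.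
have [e [eE eB ze]] := HL z zB.
by have ? := mM e eE eB; oag.
Qed.

(** Membership in [X] and non-membership both pass to halves. If both occurred in [S] they would
    occur arbitrarily close to 0, whereas below the first positive endpoint [X] is constant. It
    yields the sign of an endomorphism and the convexity of its image. *)
Lemma doubling (S X : V -> Prop) : uset S -> uset X ->
  (forall x, S x -> 0 < x) -> (forall x y, S y -> 0 < x -> x < y -> S x) ->
  (forall x, S (x + x) -> (X x <-> X (x + x))) ->
  (forall x, S x -> X x) \/ (forall x, S x -> ~ X x).
Proof.
move=> uS uX Spos Sini SX; apply: contrapT => /not_orP[].
move=> /existsNP[b2 /not_implyP[Sb2 Xb2]] /existsNP[b1 /not_implyP[Sb1 /contrapT Xb1]].
have uand (P Q : V -> Prop) : uset P -> uset Q -> uset (fun x => P x /\ Q x).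
  by move=> [phi HP] [psi HQ]; exists (FAnd phi psi) => a; rewrite sat_And -HP -HQ.
have unot (P : V -> Prop) : uset P -> uset (fun x => ~ P x).
  by move=> [phi HP]; exists (Neg phi) => a; rewrite sat_Neg -HP.
(* A positive infimum [m] is impossible: an element of [B] below [m + m] has its half in [B] and
   below [m]. *)
have small (B : V -> Prop) b : uset B -> B b -> (forall x, B x -> S x) ->
    (forall x, B x -> B (ohalf x)) -> forall d, 0 < d -> exists c, B c /\ c < d.
  move=> uB Bb BS Bhalf d dpos.
  have [m [mB mM]] : exists m, (forall b, B b -> m <= b) /\ forall z, m < z -> exists b, B b /\ b < z.
    by apply: (@definable_inf B 0 b) => // c /BS/Spos; exact: olt_le.
  case: (olt_total gV m 0) => m0.
  - apply: mM; oag.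
  - by apply: mM; rewrite m0.
  - have [|c [Bc cm]] := mM (m + m); first oag.
    have ? := ohalfD c; have ? := mB _ (Bhalf c Bc); exfalso; oag.
have Shalf x : S x -> S (ohalf x).
  by move=> Sx; have ? := ohalfD x; have ? := Spos x Sx; apply: Sini Sx _ _; oag.
have [E HE] := endpoints uX.
have [d [dpos dE]] : exists d, 0 < d /\ forall z, List.In z E -> 0 < z -> d <= z.
  elim: E {HE} => [|z E [d [dpos dE]]]; first by exists b1; split=> //; exact: Spos.
  case: (olt_total gV 0 z) => z0; last 2 first.
  - by exists d; split=> // t [<-|/dE//]; oag.
  - by exists d; split=> // t [<-|/dE//]; oag.
  case: (olt_total gV d z) => dz.
  - by exists d; split=> // t [<-|/dE//]; oag.
  - by exists d; split=> // t [<-|/dE//]; oag.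
  - by exists z; split=> // t [<-|tE t0]; [oag|have ? := dE t tE t0; oag].
have [c1 [[Sc1 Xc1] c1d]] : exists c, (S c /\ X c) /\ c < d.
  apply: (small (fun x => S x /\ X x) b1) => //; first exact: uand.
    by move=> x [].
  move=> x [Sx Xx]; split; first exact: Shalf.
  by apply/SX; rewrite ohalfD.
have [c2 [[Sc2 Xc2] c2d]] : exists c, (S c /\ ~ X c) /\ c < d.
  apply: (small (fun x => S x /\ ~ X x) b2) => //; first by apply: uand => //; exact: unot.
    by move=> x [].
  move=> x [Sx Xx]; split; first exact: Shalf.
  by rewrite SX ohalfD.
have := Spos _ Sc1; have := Spos _ Sc2 => ? ?.
case: (olt_total gV c1 c2) => c12.
- have [|z [zE ? ?]] := HE _ _ c12; first by tauto.
  have z0 : 0 < z by oag.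
  by have ? := dE z zE z0; oag.
- by apply: Xc2; rewrite -c12.
- have [|z [zE ? ?]] := HE _ _ c12; first by tauto.
  have z0 : 0 < z by oag.
  by have ? := dE z zE z0; oag.
Qed.

End OMinimal.

(** Laxer than [partial_endomorphism]: the domain is any convex symmetric set, with or without its
    endpoints, and [f] is a total function of arbitrary value outside [D]. Images, preimages and
    doubled domains qualify. *)
Record pend (L : og_language) (V : structure L) (D : V -> Prop) (f : V -> V) : Prop := Pend {
  pend_dom0 : D (ozero V) ;
  pend_conv : forall x y, D y -> ole (oopp y) x -> ole x y -> D x ;
  pend_domN : forall x, D x -> D (oopp x) ;
  pend_add : forall x y, D x -> D y -> D (oadd x y) -> f (oadd x y) = oadd (f x) (f y) ;
  pend_graph : zero_definable_graph (fun x y => D x /\ y = f x) }.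

(** With [dbl], the extension of an additive map to twice its domain by [2 f (x / 2)]. Sums and
    differences of two points of [D] land in it. *)
Definition dbl_dom (L : og_language) (V : structure L) (D : V -> Prop) : V -> Prop :=
  fun x => D (ohalf x).

Definition dbl (L : og_language) (V : structure L) (f : V -> V) : V -> V :=
  fun x => oadd (f (ohalf x)) (f (ohalf x)).

Definition increasing (L : og_language) (V : structure L) (D : V -> Prop) (f : V -> V) : Prop :=
  forall x, D x -> olt (ozero V) x -> olt (ozero V) (f x).

Section Pend.
Variables (L : og_language) (V : structure L).
Hypothesis gV : ogroup V.
Local Open Scope og_scope.
Implicit Types x y z : V.
Implicit Types (D : V -> Prop) (f : V -> V).

Lemma Df_add X (a b c : X) : Df (fun v : X -> V => v a + v b = v c).
Proof.
exists (Eq (App (add_sym L) (tnth [tuple Var L a; Var L b])) (Var L c)) => v /=.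
suff -> : (fun i => eval v (tnth [tuple Var L a; Var L b] i)) = tnth [tuple v a; v b] by [].
by apply/funext => -[[|[|m]] Hm].
Qed.

Lemma Df_zero X (a : X) : Df (fun v : X -> V => v a = 0).
Proof.
exists (Eq (Var L a) (App (zero_sym L) (fun i => ord0_elim _ i))) => v /=.
by rewrite /ozero; suff -> : (fun i : 'I_0 => eval v (ord0_elim _ i)) = tnth [tuple] by []; exact: ord0_fun.
Qed.

Lemma Df_lt X (a b : X) : Df (fun v : X -> V => v a < v b).
Proof.
exists (Rel (lt_sym L) (tnth [tuple Var L a; Var L b])) => v /=.
suff -> : (fun i => eval v (tnth [tuple Var L a; Var L b] i)) = tnth [tuple v a; v b] by [].
by apply/funext => -[[|[|m]] Hm].
Qed.

Lemma Df_eqv X (a b : X) : Df (fun v : X -> V => v a = v b).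
Proof. exact: Df_eq (Var L a) (Var L b). Qed.

Section One.
Variables (D : V -> Prop) (f : V -> V).
Hypothesis pf : pend D f.

Lemma pend0 : f 0 = 0.
Proof.
have := pend_add pf (pend_dom0 pf) (pend_dom0 pf).
have -> : (0 : V) + 0 = 0 by oag.
by move=> /(_ (pend_dom0 pf)) E; oag.
Qed.

Lemma pendN x : D x -> f (- x) = - f x.
Proof.
move=> Dx; have := pend_add pf Dx (pend_domN pf Dx).
have -> : x + - x = 0 by oag.
by move=> /(_ (pend_dom0 pf)); rewrite pend0 => E; oag.
Qed.

Lemma pend_half x : D x -> D (ohalf x).
Proof.
move=> Dx; have E := ohalfD gV x.
case: (olt_total gV 0 x) => x0; [|apply: (pend_conv pf Dx); oag|].
- by apply: (pend_conv pf Dx); oag.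
- by apply: (pend_conv pf (pend_domN pf Dx)); oag.
Qed.

Lemma dbl_domD x y : D x -> D y -> dbl_dom D (x + y).
Proof.
move=> Dx Dy; rewrite /dbl_dom; have E := ohalfD gV (x + y).
wlog xy : x y Dx Dy E / x <= y.
  move=> H; case: (olt_total gV x y) => xy.
  - by apply: (H x y) => //; oag.
  - by apply: (H x y) => //; oag.
  - have -> : x + y = y + x by oag.
    by apply: (H y x) => //; [exact: ohalfD|oag].
case: (olt_total gV (- y) x) => yx.
- by apply: (pend_conv pf Dy); oag.
- by apply: (pend_conv pf Dy); oag.
- by apply: (pend_conv pf (pend_domN pf Dx)); oag.
Qed.

Lemma dblE x : D x -> dbl f x = f x.
Proof.
move=> Dx; have Dh := pend_half Dx; have E := ohalfD gV x.
by rewrite /dbl -(pend_add pf Dh Dh) E.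
Qed.

Lemma dbl_sub x : D x -> dbl_dom D x.
Proof. exact: pend_half. Qed.

Lemma dbl_domB x y : D x -> D y -> dbl_dom D (x - y).
Proof. by move=> Dx /(pend_domN pf); exact: dbl_domD. Qed.

Lemma ohalf_add x y : ohalf (x + y) = ohalf x + ohalf y.
Proof.
by have := ohalfD gV x; have := ohalfD gV y; have := ohalfD gV (x + y); oag.
Qed.

Lemma ohalf_opp x : ohalf (- x) = - ohalf x.
Proof. by have := ohalfD gV x; have := ohalfD gV (- x); oag. Qed.

Lemma pend_dbl : pend (dbl_dom D) (dbl f).
Proof.
split.
- rewrite /dbl_dom; have -> : ohalf (ozero V) = 0 by have := ohalfD gV 0; oag.
  exact: pend_dom0 pf.
- rewrite /dbl_dom => x y Dy yx xy; have Ex := ohalfD gV x; have Ey := ohalfD gV y.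
  by apply: (pend_conv pf Dy); oag.
- by rewrite /dbl_dom => x; rewrite ohalf_opp; exact: (pend_domN pf).
- rewrite /dbl_dom /dbl => x y Dx Dy; rewrite ohalf_add => Dxy.
  by rewrite (pend_add pf Dx Dy Dxy); oag.
- apply: Df_zero_graph.
  apply: (@Df_iff _ _ _ (fun v : bool -> V => exists h, exists z, h + h = v true /\
    (D h /\ z = f h) /\ z + z = v false)).
    move=> v; split=> [[h [z [Eh [[Dh ->] Ez]]]]|[Dh Ev]].
      have Ehh : ohalf (v true) = h by have := ohalfD gV (v true); oag.
      by rewrite /dbl_dom /dbl Ehh.
    exists (ohalf (v true)), (f (ohalf (v true))); split; first exact: ohalfD.
    by split.
  apply: Df_ex; apply: Df_ex => /=; apply: Df_and; first exact: (Df_add (Some None) (Some None) (Some (Some true))).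
  apply: Df_and; last exact: (Df_add None None (Some (Some false))).
  exact: (Df_graph (Some None) None (pend_graph pf)).
Qed.

Lemma dbl_fD x y : D x -> D y -> dbl f (x + y) = f x + f y.
Proof.
move=> Dx Dy; rewrite (pend_add pend_dbl) ?dblE //; first exact: dbl_sub.
  exact: dbl_sub.
exact: dbl_domD.
Qed.

Lemma dbl_fB x y : D x -> D y -> dbl f (x - y) = f x - f y.
Proof. by move=> Dx Dy; rewrite dbl_fD ?pendN //; exact: (pend_domN pf). Qed.

Lemma pend_fB x y : D x -> D y -> D (x - y) -> f (x - y) = f x - f y.
Proof. by move=> Dx Dy; move=> Dxy; rewrite (pend_add pf) ?pendN //; exact: (pend_domN pf). Qed.

(** Since [f (x + x) = f x + f x], the sign of [f] is stable under doubling, hence constant on the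
    positive part of the domain by [doubling]. *)
Lemma pend_trichotomy : [\/ increasing D f, increasing D (fun x => - f x) |
  forall x, D x -> f x = 0].
Proof.
pose S x := D x /\ 0 < x.
have uS : uset S.
  apply: (uset_Df (Y := void) (Q := fun x _ => D x /\ 0 < x) (of_void _)).
  apply: (@Df_iff _ _ _ (fun v : option void -> V => exists z o, (D (v None) /\ z = f (v None)) /\ o = 0 /\ o < v None)).
    move=> v; split=> [[z [o [[H _] [-> H']]]]//|[H H']].
    by exists (f (v None)), 0.
  apply: Df_ex; apply: Df_ex => /=; apply: Df_and.
    exact: (Df_graph (Some (Some None)) (Some None) (pend_graph pf)).
  by apply: Df_and; [exact: (Df_zero None)|exact: (Df_lt None (Some (Some None)))].
have uX (b : bool) : uset (fun x => D x /\ if b then 0 < f x else f x < 0).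
  apply: (uset_Df (Y := void) (Q := fun x _ => D x /\ if b then 0 < f x else f x < 0) (of_void _)).
  apply: (@Df_iff _ _ _ (fun v : option void -> V => exists z o, (D (v None) /\ z = f (v None)) /\
    o = 0 /\ if b then o < z else z < o)).
    move=> v; split=> [[z [o [[H ->] [-> H']]]]//|[H H']].
    by exists (f (v None)), 0.
  apply: Df_ex; apply: Df_ex => /=; apply: Df_and.
    exact: (Df_graph (Some (Some None)) (Some None) (pend_graph pf)).
  by apply: Df_and; [exact: (Df_zero None)|case: b; [exact: (Df_lt None (Some None))|exact: (Df_lt (Some None) None)]].
have alt (b : bool) : (forall x, S x -> if b then 0 < f x else f x < 0) \/
    (forall x, S x -> ~ if b then 0 < f x else f x < 0).
  have [|||H|H] := doubling gV uS (uX b).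
  - by move=> x [].
  - move=> x y [Dy y0] x0 xy; split=> //; apply: (pend_conv pf Dy); oag.
  - move=> x [Dxx x0]; have xx : 0 < x by oag.
    have Dx : D x by apply: (pend_conv pf Dxx); oag.
    rewrite (pend_add pf Dx Dx Dxx); case: b; split=> -[_ H]; split=> //; oag.
  - by left=> x /H[].
  - by right=> x Sx Hx; apply: (H x Sx); split=> //; case: Sx.
have [H1|H1] := alt true; first by apply: Or31 => x Dx x0; exact: H1.
have [H2|H2] := alt false.
  by apply: Or32 => x Dx x0; have := H2 x (conj Dx x0); oag.
have pos0 x : D x -> 0 < x -> f x = 0.
  by move=> Dx x0; have := H1 x (conj Dx x0); have := H2 x (conj Dx x0); oag.
apply: Or33 => x Dx; case: (olt_total gV 0 x) => x0; first exact: pos0.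
  by rewrite -x0 pend0.
have := pos0 (- x) (pend_domN pf Dx); rewrite pendN // => H.
have /H E : 0 < - x by oag.
by oag.
Qed.

Lemma dbl_increasing : increasing D f -> increasing (dbl_dom D) (dbl f).
Proof.
move=> fI x Dx x0; have E := ohalfD gV x; have h0 : 0 < ohalf x by oag.
by rewrite /dbl; have := fI _ Dx h0; oag.
Qed.

Lemma increasing_lt x y : increasing D f -> D x -> D y -> x < y -> f x < f y.
Proof.
move=> /dbl_increasing fI Dx Dy xy; have := fI (y - x) (dbl_domB Dy Dx).
rewrite dbl_fB // => H.
have xy' : 0 < y - x by oag.
by have := H xy'; oag.
Qed.

Lemma increasing_le x y : increasing D f -> D x -> D y -> x <= y -> f x <= f y.
Proof.
move=> fI Dx Dy xy; case: (olt_total gV x y) => [H|->|H]; last by oag.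
  by have := increasing_lt fI Dx Dy H; oag.
oag.
Qed.

Lemma pend_opp : pend D (fun x => - f x).
Proof.
split; [exact: pend_dom0 pf|exact: pend_conv pf|exact: pend_domN pf| |].
  by move=> x y Dx Dy Dxy; rewrite (pend_add pf Dx Dy Dxy); oag.
apply: Df_zero_graph.
apply: (@Df_iff _ _ _ (fun v : bool -> V => exists z o, (D (v true) /\ z = f (v true)) /\
    o = 0 /\ z + v false = o)).
  move=> v; split=> [[z [o [[H ->] [-> H']]]]|[H ->]]; first by split=> //; oag.
  by exists (f (v true)), 0; split=> //; split=> //; oag.
apply: Df_ex; apply: Df_ex => /=; apply: Df_and.
  exact: (Df_graph (Some (Some true)) (Some None) (pend_graph pf)).
by apply: Df_and; [exact: (Df_zero None)|exact: (Df_add (Some None) (Some (Some false)) None)].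
Qed.

End One.

Lemma increasing_ltE D f x y : pend D f -> increasing D f -> D x -> D y -> f x < f y -> x < y.
Proof.
move=> pf fI Dx Dy fxy; case: (olt_total gV x y) => [//|xy|xy]; exfalso.
  by move: fxy; rewrite xy; exact: (oltxx gV).
by have := increasing_lt pf fI Dy Dx xy; oag.
Qed.

Lemma increasing_inj D f x y : pend D f -> increasing D f -> D x -> D y -> f x = f y -> x = y.
Proof.
move=> pf fI Dx Dy fxy; case: (olt_total gV x y) => [xy|//|xy]; exfalso.
  by have := increasing_lt pf fI Dx Dy xy; oag.
by have := increasing_lt pf fI Dy Dx xy; oag.
Qed.

Lemma pend_sign D f : pend D f -> (forall x, D x -> f x = 0) \/
  exists (b : bool) g, [/\ pend D g, increasing D g & forall x, f x = if b then g x else - g x].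
Proof.
move=> pf; have [fI|fI|f0] := pend_trichotomy pf; last by left.
  by right; exists true, f.
right; exists false, (fun x => - f x); split=> //; first exact: pend_opp.
by move=> x; oag.
Qed.

Lemma pend_nested D f D' f' : pend D f -> pend D' f' ->
  (forall x, D x -> D' x) \/ (forall x, D' x -> D x).
Proof.
move=> pf pf'; apply: contrapT => /not_orP[/existsNP[x /not_implyP[Dx D'x]]].
move=> /existsNP[y /not_implyP[D'y Dy]].
wlog x0 : x Dx D'x / 0 <= x.
  move=> H; case: (olt_total gV 0 x) => x0; [apply: (H x) => //; oag|apply: (H x) => //; oag|].
  apply: (H (- x)); [exact: (pend_domN pf Dx)| |oag].
  by move=> /(pend_domN pf'); have -> : - - x = x by oag.
wlog y0 : y Dy D'y / 0 <= y.
  move=> H; case: (olt_total gV 0 y) => y0; [apply: (H y) => //; oag|apply: (H y) => //; oag|].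
  apply: (H (- y)); [|exact: (pend_domN pf' D'y)|oag].
  by move=> /(pend_domN pf); have -> : - - y = y by oag.
case: (olt_total gV x y) => xy.
- by apply: D'x; apply: (pend_conv pf' D'y); oag.
- by apply: D'x; rewrite xy.
- by apply: Dy; apply: (pend_conv pf Dx); oag.
Qed.

Lemma pend_sum D f D' f' : pend D f -> pend D' f' ->
  pend (fun x => D x /\ D' x) (fun x => f x + f' x).
Proof.
move=> pf pf'; split.
- by split; [exact: pend_dom0 pf|exact: pend_dom0 pf'].
- by move=> x y [Dy D'y] H1 H2; split; [exact: (pend_conv pf Dy)|exact: (pend_conv pf' D'y)].
- by move=> x [Dx D'x]; split; [exact: (pend_domN pf Dx)|exact: (pend_domN pf' D'x)].
- move=> x y [Dx D'x] [Dy D'y] [Dxy D'xy].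
  by rewrite (pend_add pf Dx Dy Dxy) (pend_add pf' D'x D'y D'xy); oag.
apply: Df_zero_graph.
apply: (@Df_iff _ _ _ (fun v : bool -> V => exists z t, (D (v true) /\ z = f (v true)) /\
    (D' (v true) /\ t = f' (v true)) /\ z + t = v false)).
  move=> v; split=> [[z [t [[H ->] [[H' ->] <-]]]]//|[[H H'] ->]].
  by exists (f (v true)), (f' (v true)).
apply: Df_ex; apply: Df_ex => /=; apply: Df_and.
  exact: (Df_graph (Some (Some true)) (Some None) (pend_graph pf)).
apply: Df_and; last exact: (Df_add (Some None) None (Some (Some false))).
exact: (Df_graph (Some (Some true)) None (pend_graph pf')).
Qed.

Lemma pend_comp D f D' f' : pend D f -> pend D' f' ->
  pend (fun x => D x /\ D' (f x)) (f' \o f).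
Proof.
move=> pf pf'; split.
- by split; [exact: pend_dom0 pf|rewrite (pend0 pf); exact: pend_dom0 pf'].
- move=> x y [Dy D'y] H1 H2; have Dx := pend_conv pf Dy H1 H2; split=> //.
  have DN := pend_domN pf Dy; have EN := pendN pf Dy.
  (* Convexity of the preimage of [D'] rests on [f] being zero or monotone. *)
  have [f0|[b [g [pg gI Efg]]]] := pend_sign pf; first by rewrite f0 //; exact: pend_dom0 pf'.
  have := increasing_le pg gI DN Dx H1; have := increasing_le pg gI Dx Dy H2.
  rewrite (pendN pg Dy) => G1 G2; move: D'y; rewrite !Efg; case: b {Efg} => D'y.
    exact: (pend_conv pf' D'y).
  by apply: (pend_conv pf' (pend_domN pf' D'y)); oag.
- move=> x [Dx D'x]; split; first exact: (pend_domN pf Dx).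
  by rewrite (pendN pf) //; exact: (pend_domN pf' D'x).
- move=> x y [Dx D'x] [Dy D'y] [Dxy D'xy] /=; move: D'xy.
  by rewrite (pend_add pf Dx Dy Dxy) => D'xy; rewrite (pend_add pf').
apply: Df_zero_graph.
apply: (@Df_iff _ _ _ (fun v : bool -> V => exists z, (D (v true) /\ z = f (v true)) /\
    (D' z /\ v false = f' z))).
  move=> v; split=> [[z [[H ->] [H' H'']]]//|[[H H'] ->]].
  by exists (f (v true)).
apply: Df_ex => /=; apply: Df_and.
  exact: (Df_graph (Some true) None (pend_graph pf)).
exact: (Df_graph None (Some false) (pend_graph pf')).
Qed.

Lemma pend_id : pend (fun=> True) (@id V).
Proof.
split=> //; apply: Df_zero_graph.
by apply: (@Df_iff _ _ _ (fun v : bool -> V => v false = v true)) => [v|]; [tauto|exact: Df_eqv].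
Qed.

Definition image_dom D f : V -> Prop := fun y => exists2 x, D x & f x = y.
Definition inverse D f : V -> V := fun y => choose_or 0 (fun x => D x /\ f x = y).

Lemma inverseP D f y : image_dom D f y -> D (inverse D f y) /\ f (inverse D f y) = y.
Proof.
move=> [x Dx fx]; apply: (@choose_orP V (ozero V) (fun x => D x /\ f x = y)).
by exists x.
Qed.

Lemma inverseK D f x : pend D f -> increasing D f -> D x -> inverse D f (f x) = x.
Proof.
move=> pf fI Dx; have [H1 H2] := @inverseP D f (f x) (ex_intro2 _ _ x Dx erefl).
exact: (increasing_inj pf fI H1 Dx H2).
Qed.

(** The point is that the image is convex, an intermediate value property obtained without
    continuity: between 0 and [f x] the image is stable under doubling and contains [f (ohalf x)],
    so by [doubling] it is everything there. *)
Lemma pend_inverse D f : pend D f -> increasing D f -> pend (image_dom D f) (inverse D f).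
Proof.
move=> pf fI.
have imN y : image_dom D f y -> image_dom D f (- y).
  by move=> [x Dx <-]; exists (- x); [exact: (pend_domN pf Dx)|rewrite (pendN pf)].
have impos x z : D x -> 0 < z -> z < f x -> image_dom D f z.
  move=> Dx z0 zx.
  have x0 : 0 < x.
    apply: (increasing_ltE pf fI (pend_dom0 pf) Dx); rewrite (pend0 pf); oag.
  have [|||||H|H] := @doubling L V gV (fun z => 0 < z /\ z < f x) (image_dom D f).
  - apply: (uset_Df (Y := unit) (Q := fun z w => 0 < z /\ z < w tt) (fun=> f x)).
    apply: (@Df_iff _ _ _ (fun v : option unit -> V => exists o, o = 0 /\ o < v None /\ v None < v (Some tt))).
      by move=> v; split=> [[o [-> []]]//|[H H']]; exists 0.
    apply: Df_ex => /=; apply: Df_and; first exact: (Df_zero None).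
    by apply: Df_and; [exact: (Df_lt None (Some None))|exact: (Df_lt (Some None) (Some (Some tt)))].
  - apply: (uset_Df (Y := void) (Q := fun z _ => image_dom D f z) (of_void _)).
    apply: (@Df_iff _ _ _ (fun v : option void -> V => exists t, D t /\ v None = f t)).
      by move=> v; split=> [[t [H ->]]|[t H <-]]; exists t.
    apply: Df_ex => /=; exact: (Df_graph None (Some None) (pend_graph pf)).
  - by move=> t [].
  - by move=> s t [H1 H2] H3 H4; split=> //; oag.
  - move=> t [t0 tx]; split=> [[s Ds Es]|[s Ds Es]].
      have sh : s < ohalf x.
        apply: (increasing_ltE pf fI Ds (pend_half pf Dx)).
        have := pend_add pf (pend_half pf Dx) (pend_half pf Dx).
        by rewrite (ohalfD gV) => /(_ Dx) Eh; oag.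
      have s0 : 0 < s.
        by apply: (increasing_ltE pf fI (pend_dom0 pf) Ds); rewrite (pend0 pf); oag.
      have Eh := ohalfD gV x.
      have Dss : D (s + s) by apply: (pend_conv pf Dx); oag.
      by exists (s + s) => //; rewrite (pend_add pf) // Es.
    exists (ohalf s); first exact: (pend_half pf Ds).
    have := pend_add pf (pend_half pf Ds) (pend_half pf Ds).
    by rewrite (ohalfD gV) => /(_ Ds); oag.
  - exact: H.
  - exfalso; have h0 := ohalfD gV x; apply: (H (f (ohalf x))); last by exists (ohalf x) => //; exact: (pend_half pf Dx).
    have := pend_add pf (pend_half pf Dx) (pend_half pf Dx).
    rewrite (ohalfD gV) => /(_ Dx) Eh; have ? : 0 < f x by exact: fI.
    by split; oag.
have im0 : image_dom D f 0 by exists 0; [exact: pend_dom0 pf|exact: (pend0 pf)].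
split=> //.
- move=> y _ [x Dx <-] H1 H2; case: (olt_total gV 0 y) => y0; last 2 first.
  + by rewrite -y0.
  + case: (olt_total gV (- y) (f x)) => yx.
    * have : image_dom D f (- y) by apply: (impos x) => //; oag.
      by move=> /imN; have -> : - - y = y by oag.
    * by exists (- x); [exact: (pend_domN pf Dx)|rewrite (pendN pf) // -yx; oag].
    * by exfalso; oag.
  + case: (olt_total gV y (f x)) => yx; [exact: (impos x)|by exists x|by exfalso; oag].
- move=> _ _ [x Dx <-] [y Dy <-] [z Dz Ez]; rewrite -Ez !inverseK //.
  (* [x + y] is not known to lie in [D], so injectivity is used for the doubled map. *)
  apply: (increasing_inj (pend_dbl pf) (dbl_increasing fI)).
  + exact: (dbl_sub pf Dz).
  + exact: (dbl_domD pf Dx Dy).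
  + by rewrite (dbl_fD pf) // (dblE pf).
apply: Df_zero_graph.
apply: (@Df_iff _ _ _ (fun v : bool -> V => D (v false) /\ v true = f (v false))).
  move=> v; split=> [[H ->]|[/inverseP[H1 H2] ->]]; last by split.
  by rewrite inverseK //; split=> //; exists (v false).
exact: (Df_graph false true (pend_graph pf)).
Qed.

Lemma inverse_increasing D f : pend D f -> increasing D f ->
  increasing (image_dom D f) (inverse D f).
Proof.
move=> pf fI _ [x Dx <-] fx0; rewrite inverseK //.
by apply: (increasing_ltE pf fI (pend_dom0 pf) Dx); rewrite (pend0 pf).
Qed.

Lemma pend_of_endomorphism (G : V -> V -> Prop) :
  partial_endomorphism G -> zero_definable_graph G ->
  exists D f, pend D f /\ forall x y, G x y <-> D x /\ y = f x.
Proof.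
move=> [D [HD GD DG GA]] zG.
have GE x : D x -> G x (choose_or 0 (G x)).
  by move=> /DG[y [Gy _]]; apply: choose_orP; exists y.
have GU x y : G x y -> y = choose_or 0 (G x).
  move=> Gy; have Dx := GD _ _ Gy; have [z [Gz zU]] := DG x Dx.
  by rewrite -(zU _ Gy) -(zU _ (GE _ Dx)).
have HG x y : G x y <-> D x /\ y = choose_or 0 (G x).
  by split=> [Gxy|[Dx ->]]; [split; [exact: GD Gxy|exact: GU]|exact: GE].
exists D, (fun x => choose_or 0 (G x)); split=> //; split.
- by case: HD => [->//|[a a0 ->]] /=; split; oag.
- by case: HD => [->//|[a a0 ->]] /= x y [H1 H2] H3 H4; split; oag.
- by case: HD => [->//|[a a0 ->]] /= x [H1 H2]; split; oag.
- by move=> x y Dx Dy Dxy; apply: GA (GE _ Dx) (GE _ Dy) (GE _ Dxy).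
- by move: zG => [phi H]; exists phi => x y; rewrite -HG; exact: H.
Qed.

Lemma pend_bound D f : pend D f -> (forall x, D x) \/
  exists a, 0 <= a /\ forall x, 0 < x -> (x < a -> D x) /\ (D x -> x <= a).
Proof.
move=> pf; have [|/existsNP[x0 Dx0]] := pselect (forall x, D x); first by left.
right; have [x1 [x1pos Dx1]] : exists x, 0 < x /\ ~ D x.
  case: (olt_total gV 0 x0) => x00; first by exists x0.
    by case: Dx0; rewrite -x00; exact: pend_dom0 pf.
  exists (- x0); split; first oag.
  by move=> /(pend_domN pf); have -> : - - x0 = x0 by oag.
have uB : uset (fun x => 0 < x /\ ~ D x).
  apply: (uset_Df (Y := void) (Q := fun x _ => 0 < x /\ ~ D x) (of_void _)).
  apply: (@Df_iff _ _ _ (fun v : option void -> V => exists o, (o = 0 /\ o < v None) /\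
     ~ exists z, D (v None) /\ z = f (v None))).
    move=> v; split=> [[o [[-> H] H']]|[H H']].
      by split=> // Dv; apply: H'; exists (f (v None)).
    by exists 0; split=> // -[z []].
  apply: Df_ex => /=; apply: Df_and.
    by apply: Df_and; [exact: (Df_zero None)|exact: (Df_lt None (Some None))].
  apply: Df_not; apply: Df_ex => /=.
  exact: (Df_graph (Some (Some None)) None (pend_graph pf)).
have [m [mB mM]] : exists m, (forall b, 0 < b /\ ~ D b -> m <= b) /\
    forall z, m < z -> exists b, (0 < b /\ ~ D b) /\ b < z.
  by apply: (definable_inf gV uB (conj x1pos Dx1) (l := 0)) => b [H _]; oag.
exists m; split.
  by move=> m0; have [b [[b0 _] H]] := mM 0 m0; oag.
move=> x x0'; split=> [xm|Dx].
  by apply: contrapT => Dx; have := mB x (conj x0' Dx); oag.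
move=> mx; have [b [[b0 Db] bx]] := mM x mx.
by apply: Db; apply: (pend_conv pf Dx); oag.
Qed.

End Pend.

(** * Back and forth between closed sets *)

Section LinearFormulas.
Variables (L : og_language) (V : structure L).

Lemma lin_term_translate X (t : term (lin_language V) X) :
  exists s : term L X, forall v : X -> V, eval (M := lin_structure V) v t = eval v s.
Proof.
elim: t => [x|k f ts /choice[ss IH]]; first by exists (Var L x).
case: f ts ss IH => ts ss IH.
  exists (App (add_sym L) ss) => v /=; congr fint; apply/funext => i; exact: IH.
exists (App (zero_sym L) ss) => v /=; congr fint; apply/funext => i; exact: IH.
Qed.

Lemma lin_formula_translate X (phi : formula (lin_language V) X) :
  Df (fun v : X -> V => sat (M := lin_structure V) v phi).
Proof.
elim: phi => {X} [X s t|X k R ts|X|X phi IH1 psi IH2|X phi IH].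
- have [s' Es] := lin_term_translate s; have [t' Et] := lin_term_translate t.
  by exists (Eq s' t') => v /=; rewrite Es Et.
- have [ss Ess] := choice (fun i => lin_term_translate (ts i)).
  case: R ts ss Ess => [|lam] ts ss Ess.
    exists (Rel (lt_sym L) ss) => v /=.
    by suff -> : (fun i => eval (M := lin_structure V) v (ts i)) = fun i => eval v (ss i);
      [|apply/funext => i; exact: Ess].
  apply: (@Df_iff _ _ _ (fun v : X -> V => exists x y, x = eval v (ss ord0) /\
      (y = eval v (ss ord_max) /\ sval lam x y))).
    move=> v /=; rewrite !Ess; split=> [[x [y [-> [->]]]]//|H].
    by exists (eval v (ss ord0)), (eval v (ss ord_max)).
  apply: Df_ex; apply: Df_ex => /=; apply: Df_and; last apply: Df_and.
  + exists (Eq (Var L (Some None)) (trename (Some \o Some) (ss ord0))) => v.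
    by rewrite /= eval_rename.
  + exists (Eq (Var L None) (trename (Some \o Some) (ss ord_max))) => v.
    by rewrite /= eval_rename.
  + by apply: Df_graph; case: (svalP lam).
- by exists Bot.
- exact: Df_imp.
- apply: Df_all; apply: (Df_iff _ IH) => v.
  by have -> : oapp (v \o Some) (v None) = v by apply/funext => -[].
Qed.

End LinearFormulas.

Section BackAndForth.
Variables (L : og_language) (kappa : Type) (U V : structure L) (e : U -> V).
Hypothesis eE : elementary_embedding e.
Hypothesis gV : ogroup V.
Local Open Scope og_scope.
Implicit Types x y z c d : V.
Implicit Types (D : V -> Prop) (f : V -> V).

Lemma embD (u w : U) : e (u + w) = e u + e w.
Proof.
have := (eE (Eq (App (add_sym L) (tnth [tuple Var L true; Var L false])) (Var L true))).
pose t := App (add_sym L) (tnth [tuple Var L (Some true); Var L (Some false)]) : term L (option bool).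
move=> _; have := (eE (Eq t (Var L None)) (oapp (fun b : bool => if b then u else w) (u + w))).1.
have E (M : structure L) (v : option bool -> M) : eval v t = v (Some true) + v (Some false).
  rewrite /= /oadd; congr fint; apply/funext => i.
  by case: i => -[|[|m]] Hm.
rewrite /sat !E /= => H; exact/esym/H.
Qed.

Record closed (C : V -> Prop) : Prop := Closed {
  closed_emb : forall u, C (e u) ;
  closed_add : forall x y, C x -> C y -> C (x + y) ;
  closed_pend : forall D f x, pend D f -> C x -> D x -> C (f x) }.

(** A relation instead of a function, so that passing to the inverse is swapping the arguments;
    [partial_iso_fun] recovers functionality from the order. *)
Record partial_iso (R : V -> V -> Prop) : Prop := PartialIso {
  pi_emb : forall u, R (e u) (e u) ;
  pi_add : forall x x' y y', R x x' -> R y y' -> R (x + y) (x' + y') ;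
  pi_dom : forall D f x x', pend D f -> R x x' -> D x <-> D x' ;
  pi_pend : forall D f x x', pend D f -> R x x' -> D x -> R (f x) (f x') ;
  pi_lt : forall x x' y y', R x x' -> R y y' -> x < y <-> x' < y' }.

Definition same_cut (R : V -> V -> Prop) c c' : Prop :=
  forall d d', R d d' -> (d < c <-> d' < c') /\ (c < d <-> c' < d').

(** The relation generated by [R] and the pair [(c, c')]. The inner shift [d1] is there because [f]
    may be defined only near 0, so [c] must first be brought into its domain. *)
Definition extension (R : V -> V -> Prop) c c' y y' : Prop :=
  exists d d' d1 d1' D f, [/\ R d d', R d1 d1' & pend D f] /\
    [/\ D (c - d1), D (c' - d1'), y = d + f (c - d1) & y' = d' + f (c' - d1')].

Lemma partial_iso_sym R : partial_iso R -> partial_iso (fun x y => R y x).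
Proof.
move=> [H1 H2 H3 H4 H5]; split=> //.
- by move=> *; exact: H2.
- by move=> D f x x' pf /(H3 _ _ _ _ pf); tauto.
- by move=> D f x x' pf Rx Dx; apply: (H4 D) => //; apply/(H3 _ _ _ _ pf Rx).
- by move=> x x' y y' Rx Ry; have := H5 _ _ _ _ Rx Ry; tauto.
Qed.

Lemma same_cut_sym R c c' : same_cut R c c' -> same_cut (fun x y => R y x) c' c.
Proof. by move=> H d d' /H; tauto. Qed.

Lemma extension_sym R c c' y y' :
  extension R c c' y y' -> extension (fun x y => R y x) c' c y' y.
Proof.
move=> [d [d' [d1 [d1' [D [f [[H1 H2 H3] [H4 H5 H6 H7]]]]]]]].
by exists d', d, d1', d1, D, f.
Qed.

Lemma pend_zero : pend (fun=> True) (fun=> 0 : V).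
Proof.
split=> //; first by move=> *; oag.
apply: Df_zero_graph.
by apply: (@Df_iff _ _ _ (fun v : bool -> V => v false = 0)) => [v|]; [tauto|exact: (Df_zero V false)].
Qed.

Lemma partial_iso_opp R x x' : partial_iso R -> R x x' -> R (- x) (- x').
Proof. by move=> pR Rx; apply: (pi_pend pR (pend_opp gV (pend_id V)) Rx). Qed.

Lemma emb_witness (Q : V -> Prop) :
  Df (fun v : option void -> V => Q (v None)) -> (exists y, Q y) -> exists u, Q (e u).
Proof.
by move=> HQ; exact: (@Df_witness _ _ _ e void (fun y _ => Q y) (of_void _) eE HQ).
Qed.

Lemma emb_zero : exists u, e u = 0.
Proof. by apply: (emb_witness (Q := fun y => y = 0)); [exact: (Df_zero V None)|exists 0]. Qed.

Lemma partial_iso0 R : partial_iso R -> R 0 0.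
Proof. by move=> pR; have [u <-] := emb_zero; exact: pi_emb. Qed.

Lemma partial_iso_fun R x x' y' : partial_iso R -> R x x' -> R x y' -> x' = y'.
Proof.
move=> pR H H'; have := pi_lt pR H H'; have := pi_lt pR H' H.
by case: (olt_total gV x' y') => // xy [_ A] [_ B]; exfalso;
  [have := B xy|have := A xy]; exact: (oltxx gV).
Qed.

(** The endpoint from [pend_bound] satisfies a formula without parameters, so elementarity finds one
    in [U]. Whether it belongs to [D] is left open, hence the strict inequality on one side. *)
Lemma pend_bound_emb D f : pend D f -> (forall x, D x) \/
  exists u, 0 <= e u /\ forall x, 0 < x -> (x < e u -> D x) /\ (D x -> x <= e u).
Proof.
move=> pf; have [|[a Ha]] := pend_bound gV pf; first by left.
right; apply: (@emb_witness (fun y => 0 <= y /\ forall x, 0 < x -> (x < y -> D x) /\ (D x -> x <= y))); last by exists a.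
apply: (@Df_iff _ _ _ (fun v : option void -> V => exists o, o = 0 /\ (~ v None < o /\
   forall x, o < x -> (x < v None -> exists z, D x /\ z = f x) /\ ((exists z, D x /\ z = f x) -> ~ v None < x)))).
  move=> v; split=> [[o [-> [H H']]]|[H H']].
    split=> // x /H'[H1 H2]; split=> [/H1[z []]//|Dx]; apply: H2; by exists (f x).
  exists 0; split=> //; split=> // x /H'[H1 H2]; split=> [/H1 Dx|[z [Dx _]]]; last exact: H2.
  by exists (f x).
apply: Df_ex => /=; apply: Df_and; first exact: (Df_zero V None).
apply: Df_and; first by apply: Df_not; exact: (Df_lt V (Some None) None).
apply: Df_all => /=; apply: Df_imp; first exact: (Df_lt V (Some None) None).
have DfD : Df (fun v : option (option (option void)) -> V => exists z, D (v None) /\ z = f (v None)).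
  by apply: Df_ex => /=; exact: (Df_graph (Some None) None (pend_graph pf)).
apply: Df_and; apply: Df_imp => //; first exact: (Df_lt V None (Some (Some None))).
by apply: Df_not; exact: (Df_lt V (Some (Some None)) None).
Qed.

(* Domains have their endpoints in [U], so order-preserving relations respect them. *)
Lemma dom_transfer (R : V -> V -> Prop) D f y y' :
  (forall u, R (e u) (e u)) -> (forall x x' z z', R x x' -> R z z' -> x < z <-> x' < z') ->
  (forall x x', R x x' -> R (- x) (- x')) ->
  pend D f -> R y y' -> D y -> D y'.
Proof.
move=> Re Rlt Ropp pf Ryy Dy; have [//|[u [u0 Hu]]] := pend_bound_emb pf.
have [o Eo] := emb_zero.
have Ro : R 0 0 by rewrite -Eo.
wlog y0 : y y' Ryy Dy / 0 <= y.
  move=> H; case: (olt_total gV 0 y) => y0; [apply: (H y) => //; oag|apply: (H y) => //; oag|].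
  have := H (- y) (- y') (Ropp _ _ Ryy) (pend_domN pf Dy).
  move=> H'; have /H' : 0 <= - y by oag.
  by move=> /(pend_domN pf); have -> : - - y' = y' by oag.
have y'0 : 0 <= y' by move=> /(Rlt _ _ _ _ Ryy Ro).
case: (olt_total gV 0 y') => y'pos; last by [].
  have ypos : 0 < y by apply/(Rlt _ _ _ _ Ro Ryy).
  case: (olt_total gV y (e u)) => yu.
  - by apply: (Hu _ y'pos).1; apply/(Rlt _ _ _ _ Ryy (Re u)).
  - suff -> : y' = y by [].
    have A := Rlt _ _ _ _ Ryy (Re u); have B := Rlt _ _ _ _ (Re u) Ryy.
    case: (olt_total gV y' (e u)) => y'u.
    + by have /A := y'u; rewrite yu => /(oltxx gV).
    + by rewrite y'u yu.
    + by have /B := y'u; rewrite yu => /(oltxx gV).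
  - by have := (Hu _ ypos).2 Dy.
by rewrite -y'pos; exact: pend_dom0 pf.
Qed.

Section Extension.
Variables (R : V -> V -> Prop) (c c' : V).
Hypothesis pR : partial_iso R.
Hypothesis cut : same_cut R c c'.

(** If [d = g t], comparing it with [g (c - d1)] amounts to comparing [c] with [d1 + t], which the
    cut decides. Otherwise [d] lies outside the convex symmetric image of [g] and its sign alone
    decides. *)
Lemma increasing_cut D g d d' d1 d1' : pend D g -> increasing D g ->
  R d d' -> R d1 d1' -> D (c - d1) -> D (c' - d1') ->
  (g (c - d1) < d -> g (c' - d1') < d') /\ (d < g (c - d1) -> d' < g (c' - d1')).
Proof.
move=> pg gI Rd Rd1 Dc Dc'; have pi := pend_inverse gV pg gI.
have domE := pi_dom pR pi Rd.
have [im|nim] := pselect (image_dom D g d).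
  have Rt := pi_pend pR pi Rd im; have im' : image_dom D g d' by apply/domE.
  have [Dt Et] := inverseP im; have [Dt' Et'] := inverseP im'.
  have [c1 c2] := cut (pi_add pR Rd1 Rt).
  rewrite -{1 2}Et -{1 2}Et'; move: Rt Dt Dt' c1 c2.
  move: (inverse D g d) (inverse D g d') => t t' Rt Dt Dt' c1 c2; split=> H.
    have ct := increasing_ltE gV pg gI Dc Dt H.
    apply: (increasing_lt gV pg gI) => //.
    have /c2 : c < d1 + t by oag.
    by move=> ?; oag.
  have ct := increasing_ltE gV pg gI Dt Dc H.
  apply: (increasing_lt gV pg gI) => //.
  have /c1 : d1 + t < c by oag.
  by move=> ?; oag.
have nim' : ~ image_dom D g d' by move/domE.
have out (t t' w : V) : image_dom D g w -> ~ image_dom D g t -> (0 < t -> 0 < t') -> (t < 0 -> t' < 0) ->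
   (w < t -> 0 < t') /\ (t < w -> t' < 0).
  move=> imw nimt p1 p2; split=> H.
    apply: p1; apply: contrapT => t0; apply: nimt.
    by apply: (pend_conv pi (pend_domN pi imw)); oag.
  apply: p2; apply: contrapT => t0; apply: nimt.
  by apply: (pend_conv pi imw); oag.
have big (t w : V) : image_dom D g w -> ~ image_dom D g t -> (0 < t -> w < t) /\ (t < 0 -> t < w).
  move=> imw nimt; split=> t0; apply: contrapT => H; apply: nimt.
    by apply: (pend_conv pi imw); oag.
  by apply: (pend_conv pi (pend_domN pi imw)); oag.
have R0 := partial_iso0 pR.
have l1 := pi_lt pR R0 Rd; have l2 := pi_lt pR Rd R0.
have [A B] := out d d' _ (ex_intro2 _ _ _ Dc erefl) nim l1.1 l2.1.
have [A' B'] := big d' _ (ex_intro2 _ _ _ Dc' erefl) nim'.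
by split=> [/A/A'|/B/B'].
Qed.

Lemma extension_pos y y' : extension R c c' y y' -> 0 < y -> 0 < y'.
Proof.
move=> [d [d' [d1 [d1' [D [f [[H1 H2 pf] [Dc Dc' -> ->]]]]]]]].
have [f0|[b [g [pg gI Ef]]]] := pend_sign gV pf.
  rewrite !f0 // => H; have d0 : 0 < d by oag.
  by have /(pi_lt pR (partial_iso0 pR) H1) := d0; oag.
rewrite !Ef; case: b {Ef} => H.
  have [_ K] := increasing_cut pg gI (partial_iso_opp pR H1) H2 Dc Dc'.
  have /K K' : - d < g (c - d1) by move: H; clear -gV; oag.
  by move: K'; clear -gV; oag.
have [K _] := increasing_cut pg gI H1 H2 Dc Dc'.
have /K K' : g (c - d1) < d by move: H; clear -gV; oag.
by move: K'; clear -gV; oag.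
Qed.

Lemma extension_incl x x' : R x x' -> extension R c c' x x'.
Proof.
move=> Rx; exists x, x', 0, 0, (fun=> True), (fun=> 0).
split; first by split=> //; [exact: partial_iso0|exact: pend_zero].
split=> //; clear -gV; oag.
Qed.

Lemma extension_new : extension R c c' c c'.
Proof.
exists 0, 0, 0, 0, (fun=> True), id.
split; first by split; [exact: partial_iso0|exact: partial_iso0|exact: pend_id].
by split=> //; oag.
Qed.

Lemma extension_opp y y' : extension R c c' y y' -> extension R c c' (- y) (- y').
Proof.
move=> [d [d' [d1 [d1' [D [f [[H1 H2 pf] [Dc Dc' -> ->]]]]]]]].
exists (- d), (- d'), d1, d1', D, (fun x => - f x); split.
  by split=> //; [exact: partial_iso_opp|exact: pend_opp].
by split=> //; oag.
Qed.

(** With [f] the map of smaller domain, [h (c - d2)] splits as [dbl h (c - d1) + dbl h (d1 - d2)]: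
    both summands then use the shift [d1], and the second part is absorbed in the constant. *)
Lemma extension_add y y' z z' : extension R c c' y y' -> extension R c c' z z' ->
  extension R c c' (y + z) (y' + z').
Proof.
move=> [d [d' [d1 [d1' [D [f [[H1 H2 pf] [Dc Dc' -> ->]]]]]]]].
move=> [g [g' [d2 [d2' [E [h [[G1 G2 ph] [Ec Ec' -> ->]]]]]]]].
wlog DE : d d' d1 d1' D f H1 H2 pf Dc Dc' g g' d2 d2' E h G1 G2 ph Ec Ec' /
    forall x, D x -> E x.
  move=> H; have [DE|ED] := pend_nested gV pf ph.
    exact: (H d d' d1 d1' D f H1 H2 pf Dc Dc' g g' d2 d2' E h G1 G2 ph Ec Ec' DE).
  have := H g g' d2 d2' E h G1 G2 ph Ec Ec' d d' d1 d1' D f H1 H2 pf Dc Dc' ED.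
  by rewrite !(oaddC gV (g + _)) !(oaddC gV (g' + _)).
have shift (c0 t1 t2 : V) : D (c0 - t1) -> E (c0 - t2) ->
    dbl_dom E (t1 - t2) /\ h (c0 - t2) = dbl h (c0 - t1) + dbl h (t1 - t2).
  move=> /DE Ht1 Ht2.
  have Eq : c0 - t2 - (c0 - t1) = t1 - t2 by clear -gV; oag.
  have Dt : dbl_dom E (t1 - t2) by rewrite -Eq; exact: (dbl_domB gV ph Ht2 Ht1).
  split=> //; rewrite -(dblE gV ph Ht2) -[in LHS](_ : (c0 - t1) + (t1 - t2) = c0 - t2); last by clear -gV; oag.
  apply: (pend_add (pend_dbl gV ph)) => //; first exact: (dbl_sub gV ph Ht1).
  have -> : (c0 - t1) + (t1 - t2) = c0 - t2 by clear -gV; oag.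
  exact: (dbl_sub gV ph Ht2).
have [S1 S2] := shift _ _ _ Dc Ec; have [S1' S2'] := shift _ _ _ Dc' Ec'.
have R12 : R (d1 - d2) (d1' - d2') by apply: pi_add => //; exact: partial_iso_opp.
have pd := pend_dbl gV ph.
exists (d + g + dbl h (d1 - d2)), (d' + g' + dbl h (d1' - d2')), d1, d1'.
exists (fun x => D x /\ dbl_dom E x), (fun x => f x + dbl h x); split.
  split=> //; last exact: pend_sum.
  by apply: pi_add => //; [exact: pi_add|exact: (pi_pend pR pd)].
split; [split=> //|split=> //|rewrite S2; clear -gV; oag|rewrite S2'; clear -gV; oag].
  by apply: (dbl_sub gV ph); exact: DE.
by apply: (dbl_sub gV ph); exact: DE.
Qed.

Lemma extension_lt_imp y y' z z' : extension R c c' y y' -> extension R c c' z z' ->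
  y < z -> y' < z'.
Proof.
move=> Hy Hz yz; have H := extension_add Hz (extension_opp Hy).
have /(extension_pos H) : 0 < z - y by oag.
by oag.
Qed.

End Extension.

Lemma extension_lt R c c' y y' z z' : partial_iso R -> same_cut R c c' ->
  extension R c c' y y' -> extension R c c' z z' -> y < z <-> y' < z'.
Proof.
move=> pR cut Hy Hz; split; first exact: (extension_lt_imp pR cut Hy Hz).
exact: (extension_lt_imp (partial_iso_sym pR) (same_cut_sym cut) (extension_sym Hy) (extension_sym Hz)).
Qed.

Lemma extension_dom R c c' D f y y' : partial_iso R -> same_cut R c c' ->
  pend D f -> extension R c c' y y' -> D y -> D y'.
Proof.
move=> pR cut pf; apply: (dom_transfer _ _ _ pf).
- by move=> u; apply: extension_incl => //; exact: pi_emb.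
- by move=> x x' z z'; exact: extension_lt.
- exact: extension_opp.
Qed.

(** For [y = d + f (c - d1)] in [D] there are two cases. If [d] is in twice the domain, [m] splits
    over the sum. If not, [d] is large against [y], hence comparable with [f (c - d1)] and in the
    doubled image of [f]; then [d] is absorbed in the shift and [y] becomes a pure value
    [G (c - (d1 + t))]. *)
Lemma extension_pend R c c' D m y y' : partial_iso R -> same_cut R c c' ->
  pend D m -> extension R c c' y y' -> D y -> extension R c c' (m y) (m y').
Proof.
move=> pR cut pm Ry Dy; have Dy' := extension_dom pR cut pm Ry Dy.
move: Ry => [d [d' [d1 [d1' [E [f [[H1 H2 pf] [Ec Ec' Ey Ey']]]]]]]].
have p2 := pend_dbl gV pm; have p4 := pend_dbl gV p2.
have [Dd|nDd] := pselect (dbl_dom D d).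
  have Dd' : dbl_dom D d' by apply/(pi_dom pR p2 H1).
  have aux (t w s : V) : D t -> dbl_dom D s -> t = s + w ->
      dbl_dom (dbl_dom D) w /\ m t = dbl m s + dbl (dbl m) w.
    move=> Dt Ds Et; have Dt2 := dbl_sub gV pm Dt.
    have Ew : t - s = w by rewrite Et; clear -gV; oag.
    have Dw : dbl_dom (dbl_dom D) w by rewrite -Ew; exact: (dbl_domB gV p2 Dt2 Ds).
    split=> //; rewrite -(dblE gV pm Dt) -(dblE gV p2 Dt2) -(dblE gV p2 Ds) Et.
    apply: (pend_add p4) => //; first exact: (dbl_sub gV p2 Ds).
    by rewrite -Et; exact: (dbl_sub gV p2 Dt2).
  have [K1 K2] := aux _ _ _ Dy Dd Ey; have [K1' K2'] := aux _ _ _ Dy' Dd' Ey'.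
  exists (dbl m d), (dbl m d'), d1, d1'.
  exists (fun x => E x /\ dbl_dom (dbl_dom D) (f x)), (dbl (dbl m) \o f).
  by split; split=> //; [exact: (pi_pend pR p2)|exact: pend_comp].
have [f0|[b [g [pg gI Ef]]]] := pend_sign gV pf.
  by case: nDd; apply: (dbl_sub gV pm); move: Dy; rewrite Ey f0 //;
    have -> : d + 0 = d by clear -gV; oag.
have pg2 := pend_dbl gV pg; have gI2 := dbl_increasing gV gI.
have pi := pend_inverse gV pg2 gI2; have pg4 := pend_dbl gV pg2.
(* The sign is chosen so that [dbl g t = sg d] makes shifting by [t] add exactly [d]. *)
pose sg (t : V) := if b then - t else t.
have Rs : R (sg d) (sg d') by rewrite /sg; case: (b) => //; exact: partial_iso_opp.
have im : image_dom (dbl_dom E) (dbl g) (sg d).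
  have im2 : image_dom (dbl_dom E) (dbl g) (g (c - d1) + g (c - d1)).
    by exists ((c - d1) + (c - d1)); [exact: (dbl_domD gV pg Ec Ec)|exact: (dbl_fD gV pg Ec Ec)].
  have Ehf := ohalfD gV d; pose h := ohalf d.
  have far1 : ~ (- y <= h /\ h <= y) by move=> [? ?]; apply: nDd; exact: (pend_conv pm Dy).
  have far2 : ~ (- (- y) <= h /\ h <= - y).
    by move=> [? ?]; apply: nDd; exact: (pend_conv pm (pend_domN pm Dy)).
  have im2N := pend_domN pi im2; pose p := f (c - d1).
  (* Half of [d] lies outside [D] while [y] is inside, so [y] is smaller in size than half of [d],
     and [p = y - d] has at least half the size of [d]. *)
  have [K|K] : (p + p <= - d /\ - d <= - (p + p)) \/ (- (p + p) <= - d /\ - d <= p + p).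
    rewrite -/p in Ey; rewrite -/h in Ehf.
    move: far1 far2 Ey Ehf; clearbody p h; clear -gV => far1 far2 Ey Ehf.
    have [h0|h0] : 0 <= h \/ h <= 0 by case: (olt_total gV 0 h) => ?; [left|left|right]; oag.
      left; case: (olt_total gV 0 y) => y0.
      - have hy : y < h by apply: contrapT => hy; apply: far1; split; oag.
        by split; oag.
      - have hy : y <= h by oag.
        by split; oag.
      - have hy : - y < h by apply: contrapT => hy; apply: far2; split; oag.
        by split; oag.
    right; case: (olt_total gV 0 y) => y0.
    - have hy : h < - y by apply: contrapT => hy; apply: far1; split; oag.
      by split; oag.
    - by split; oag.
    - have hy : h < y by apply: contrapT => hy; apply: far2; split; oag.
      by split; oag.
  - move: K; rewrite /p Ef /sg; case: (b) => /= -[K1 K2].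
      by apply: (pend_conv pi im2N); move: K1 K2; clear -gV; oag.
    by apply: (pend_conv pi im2); move: K1 K2; clear -gV; oag.
  - move: K; rewrite /p Ef /sg; case: (b) => /= -[K1 K2].
      by apply: (pend_conv pi im2); move: K1 K2; clear -gV; oag.
    by apply: (pend_conv pi im2N); move: K1 K2; clear -gV; oag.
have im' : image_dom (dbl_dom E) (dbl g) (sg d') by apply/(pi_dom pR pi Rs).
have Rt := pi_pend pR pi Rs im.
have [Dt Et] := inverseP im; have [Dt' Et'] := inverseP im'.
move: Rt Dt Et Dt' Et'.
move: (inverse _ _ (sg d)) (inverse _ _ (sg d')) => t t' Rt Dt Et Dt' Et'.
pose G x := if b then dbl (dbl g) x else - dbl (dbl g) x.
have pG : pend (dbl_dom (dbl_dom E)) G.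
  by rewrite /G; case: (b) => //; exact: pend_opp.
have aux (c0 t1 t0 d0 y0 : V) : E (c0 - t1) -> dbl_dom E t0 -> dbl g t0 = sg d0 ->
    y0 = d0 + f (c0 - t1) -> dbl_dom (dbl_dom E) (c0 - (t1 + t0)) /\ G (c0 - (t1 + t0)) = y0.
  move=> Ec0 Et0 Eg Ey0; have -> : c0 - (t1 + t0) = (c0 - t1) - t0 by clear -gV; oag.
  have Ec2 := dbl_sub gV pg Ec0.
  split; first exact: (dbl_domB gV pg2 Ec2 Et0).
  rewrite /G (dbl_fB gV pg2) //.
  rewrite Eg (dblE gV pg) // Ey0 Ef /sg.
  by case: (b) => /=; clear -gV; oag.
have [K1 K2] := aux _ _ _ _ _ Ec Dt Et Ey; have [K1' K2'] := aux _ _ _ _ _ Ec' Dt' Et' Ey'.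
exists 0, 0, (d1 + t), (d1' + t').
exists (fun x => dbl_dom (dbl_dom E) x /\ D (G x)), (m \o G); split.
  by split; [exact: partial_iso0|exact: pi_add|exact: pend_comp].
by split; rewrite /= ?K2 ?K2' //; clear -gV; oag.
Qed.

Lemma extension_iso R c c' : partial_iso R -> same_cut R c c' ->
  partial_iso (extension R c c').
Proof.
move=> pR cut; split.
- by move=> u; apply: extension_incl => //; exact: pi_emb.
- by move=> *; exact: extension_add.
- move=> D f x x' pf Rx; split; first exact: (extension_dom pR cut pf Rx).
  exact: (extension_dom (partial_iso_sym pR) (same_cut_sym cut) pf (extension_sym Rx)).
- by move=> D f x x' pf Rx; exact: extension_pend.
- by move=> x x' y y'; exact: extension_lt.
Qed.

End BackAndForth.

(** * Filling small cuts by saturation *)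

Section Fill.
Variables (L : og_language) (kappa : Type) (M : structure L).
Hypothesis kappaS : strong_limit kappa.
Hypothesis gM : ogroup M.
Hypothesis satM : saturated kappa M.
Local Open Scope og_scope.

Lemma ord_forall_seq k (T : Type) (g : 'I_k -> T) (P : T -> Prop) :
  (forall x, List.In x (map g (enum 'I_k)) -> P x) <-> forall j, P (g j).
Proof.
split=> [H j|H x].
  apply: H; have : j \in enum 'I_k by rewrite mem_enum.
  by elim: (enum _) => //= i s IH; rewrite inE => /orP[/eqP ->|/IH]; [left|right].
by elim: (enum _) => //= i s IH [<-|/IH].
Qed.

Lemma finite_fill (A B : set M) (s : seq M) : (forall a b, A a -> B b -> a < b) ->
  exists x, forall y, List.In y s -> (A y -> y < x) /\ (B y -> x < y).
Proof.
move=> AB; have [p p0] := ogroup_pos gM.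
have extr (P : M -> Prop) (R : M -> M -> Prop) : (R = @ole L M \/ R = (fun x y => @ole L M y x)) ->
    (exists x, List.In x s /\ P x) ->
    exists m, [/\ List.In m s, P m & forall x, List.In x s -> P x -> R x m].
  move=> HR; apply: seq_extremum.
  - by move=> x _; case: HR => ->; oag.
  - by move=> x y z _ _ _; case: HR => ->; oag.
  - move=> x y _ _; case: HR => ->; case: (olt_total gM x y) => xy;
      by [left; oag|right; oag].
have [hA|nA] := pselect (exists x, List.In x s /\ A x);
have [hB|nB] := pselect (exists x, List.In x s /\ B x).
- have [m [_ Am mM]] := extr A _ (or_introl erefl) hA.
  have [m' [_ Bm' mM']] := extr B _ (or_intror erefl) hB.
  have mm := AB _ _ Am Bm'; have E := ohalfD gM (m + m').
  exists (ohalf (m + m')) => y ys; split=> [/(mM _ ys)|/(mM' _ ys)] H; oag.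
- have [m [_ Am mM]] := extr A _ (or_introl erefl) hA.
  exists (m + p) => y ys; split=> [/(mM _ ys)|] H; first oag.
  by case: nB; exists y.
- have [m [_ Bm mM]] := extr B _ (or_intror erefl) hB.
  exists (m - p) => y ys; split=> [|/(mM _ ys)] H; last oag.
  by case: nA; exists y.
- exists 0 => y ys; split=> H; first by case: nA; exists y.
  by case: nB; exists y.
Qed.

(** Midpoints, and translation by a positive element when one side is empty, give finite
    satisfiability; saturation does the rest. In particular no cut is small on both sides. *)
Lemma fill (A B : set M) : small kappa A -> small kappa B ->
  (forall a b, A a -> B b -> a < b) ->
  exists x, (forall a, A a -> a < x) /\ (forall b, B b -> x < b).
Proof.
move=> As Bs AB; pose W := A `|` B.
pose i (w : W) : M := set_val w.
pose lo (w : W) : formula L ('I_1 + W) :=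
  Rel (lt_sym L) (tnth [tuple Var L (inr w); Var L (inl ord0)]).
pose up (w : W) : formula L ('I_1 + W) :=
  Rel (lt_sym L) (tnth [tuple Var L (inl ord0); Var L (inr w)]).
have loE a w : sat (copair a i) (lo w) <-> i w < a ord0.
  rewrite /olt /=; set g := (X in rint _ X); suff -> : g = tnth [tuple i w; a ord0] by [].
  by apply/funext => -[[|[|m]] Hm].
have upE a w : sat (copair a i) (up w) <-> a ord0 < i w.
  rewrite /olt /=; set g := (X in rint _ X); suff -> : g = tnth [tuple a ord0; i w] by [].
  by apply/funext => -[[|[|m]] Hm].
pose G : set (formula L ('I_1 + W)) := [set phi | exists w,
  (A (i w) /\ phi = lo w) \/ (B (i w) /\ phi = up w)].
have rs : small kappa (range i).
  by apply: small_sub (small_setU kappaS As Bs) => _ [w _ <-]; exact: set_valP.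
have [|a aP] := saturated_family (G := G) satM rs.
  move=> k phi /choice[w Hw].
  have [x Hx] := finite_fill [seq i (w j) | j <- enum 'I_k] AB.
  exists (fun=> x) => j.
  have {Hx} [H1 H2] := (ord_forall_seq (fun j => i (w j)) (fun y => (A y -> y < x) /\ (B y -> x < y))).1 Hx j.
  by case: (Hw j) => -[Hi ->]; [apply/loE; exact: H1|apply/upE; exact: H2].
exists (a ord0); split=> y Hy.
  have Wy : W y by left.
  have /loE : sat (copair a i) (lo (exist _ y (mem_set Wy))) by apply: aP; exists (exist _ y (mem_set Wy)); left.
  by [].
have Wy : W y by right.
have /upE : sat (copair a i) (up (exist _ y (mem_set Wy))) by apply: aP; exists (exist _ y (mem_set Wy)); right.
by [].
Qed.

End Fill.

(** * Closed sets and elementarity of small partial isomorphisms *)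

Section Closure.
Variables (L : og_language) (kappa : Type) (U V : structure L) (e : U -> V).
Hypothesis eE : elementary_embedding e.
Hypothesis gV : ogroup V.
Hypothesis kappaS : strong_limit kappa.
Hypothesis sentence_small : card_lt [set: sentence L] [set: kappa].
Hypothesis U_small : smallT kappa U.
Hypothesis satV : saturated kappa V.
Hypothesis homV : strongly_homogeneous kappa V.
Hypothesis linV : linear V.
Local Open Scope og_scope.
Implicit Types x y z c d : V.

Let nat_small : smallT kappa nat := smallT_nat sentence_small.

Record small_iso (R : V -> V -> Prop) : Prop := SmallIso {
  si_iso :> partial_iso e R ;
  si_dom : small kappa [set x | exists y, R x y] ;
  si_ran : small kappa [set y | exists x, R x y] }.

Lemma small_iso_sym R : small_iso R -> small_iso (fun x y => R y x).
Proof. by move=> [H1 H2 H3]; split=> //; exact: partial_iso_sym. Qed.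

Lemma smallT_pend_formula : smallT kappa (formula L 'I_2).
Proof. exact: (smallT_formula kappaS sentence_small (smallT_ord nat_small 2)). Qed.

(** A formula determines the endomorphism it defines, so triples of two constants and a formula
    count these elements. *)
Lemma small_affine (A : set V) c : small kappa A ->
  small kappa [set y | exists d d1 D f, [/\ A d, A d1, pend D f, D (c - d1) & y = d + f (c - d1)]].
Proof.
move=> /smallE As.
apply: (@small_rel _ _ (A * A * formula L 'I_2) _ (fun t y => exists D f, [/\
  forall x z, D x /\ z = f x <-> sat (tnth [tuple x; z]) t.2,
  D (c - set_val t.1.2) & y = set_val t.1.1 + f (c - set_val t.1.2)])).
- exact: (smallT_prod kappaS (smallT_prod kappaS As As) smallT_pend_formula).
- move=> t x y [D [f [H1 H2 ->]]] [D' [f' [H1' H2' ->]]].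
  have /H1/H1'[_ ->] : D (c - set_val t.1.2) /\ f (c - set_val t.1.2) = f (c - set_val t.1.2) by [].
  by [].
- move=> y [d [d1 [D [f [Ad Ad1 pf Dc Ey]]]]]; have [phi Hphi] := pend_graph pf.
  exists (exist _ d (mem_set Ad), exist _ d1 (mem_set Ad1), phi).
  by exists D, f.
Qed.

Lemma extension_small R c c' : small_iso R -> same_cut R c c' -> small_iso (extension R c c').
Proof.
move=> sR cut; split; first exact: (extension_iso eE gV sR cut).
  apply: small_sub (small_affine c (si_dom sR)) => y [y'].
  move=> [d [d' [d1 [d1' [D [f [[H1 H2 H3] [H4 H5 H6 H7]]]]]]]].
  by exists d, d1, D, f; split=> //; [exists d'|exists d1'].
apply: small_sub (small_affine c' (si_ran sR)) => y' [y].
move=> [d [d' [d1 [d1' [D [f [[H1 H2 H3] [H4 H5 H6 H7]]]]]]]].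
by exists d', d1', D, f; split=> //; [exists d|exists d1].
Qed.

Lemma forth R c : small_iso R -> exists c', same_cut R c c'.
Proof.
move=> sR; have [[c' Rc]|nc] := pselect (exists c', R c c').
  by exists c' => d d' Rd; split; exact: (pi_lt sR).
have [|||x [xA xB]] := @fill L kappa V kappaS gV satV
    [set d' | exists d, R d d' /\ d < c] [set d' | exists d, R d d' /\ c < d].
- by apply: small_sub (si_ran sR) => y [x [Rx _]]; exists x.
- by apply: small_sub (si_ran sR) => y [x [Rx _]]; exists x.
- move=> a b [d [Rd dc]] [d1 [Rd1 cd1]].
  by apply/(pi_lt sR Rd Rd1); oag.
exists x => d d' Rd; have H1 : d < c -> d' < x by move=> dc; apply: xA; exists d.
have H2 : c < d -> x < d' by move=> cd; apply: xB; exists d.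
case: (olt_total gV d c) => dc.
- by have := H1 dc; split; split; oag.
- by case: nc; exists d'; rewrite -dc.
- by have := H2 dc; split; split; oag.
Qed.

Lemma tnth2 (T : Type) (g : 'I_2 -> T) : tnth [tuple g ord0; g ord_max] = g.
Proof.
by apply/funext => -[[|[|m]] Hm] //; congr g; apply: val_inj.
Qed.

Lemma partial_iso_eq R x x' y y' : partial_iso e R -> R x x' -> R y y' -> x = y <-> x' = y'.
Proof.
move=> pR Rx Ry; split=> E.
  by move: Rx; rewrite E => Rx; exact: (partial_iso_fun gV pR Rx Ry).
move: Rx; rewrite E => Rx.
exact: (partial_iso_fun gV (partial_iso_sym pR) Rx Ry).
Qed.

Lemma small_iso_eval X R (v v' : X -> V) (t : term (lin_language V) X) :
  small_iso R -> (forall i, R (v i) (v' i)) ->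
  R (eval (M := lin_structure V) v t) (eval (M := lin_structure V) v' t).
Proof.
move=> sR vv'; elim: t => [x|k f ts IH]; first exact: vv'.
case: f ts IH => ts IH /=.
  have := pi_add sR (IH ord0) (IH ord_max).
  by rewrite /oadd (tnth2 (fun i => eval (M := lin_structure V) v (ts i)))
    (tnth2 (fun i => eval (M := lin_structure V) v' (ts i))).
have := partial_iso0 eE sR; rewrite /ozero.
rewrite {1}(ord0_fun (tnth [tuple]) (fun i => eval (M := lin_structure V) v (ts i))).
by rewrite (ord0_fun (tnth [tuple]) (fun i => eval (M := lin_structure V) v' (ts i))).
Qed.

(** The atomic relations of the linear language are order, sum and graphs of endomorphisms, all
    preserved by definition; [forth] and its mirror image handle the quantifiers, so no quantifier
    elimination is required. *)
Lemma back_and_forth X (psi : formula (lin_language V) X) R (v v' : X -> V) :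
  small_iso R -> (forall i, R (v i) (v' i)) ->
  sat (M := lin_structure V) v psi <-> sat (M := lin_structure V) v' psi.
Proof.
elim: psi R v v' => {X} [X s t|X k Q ts|X|X phi IH1 psi IH2|X phi IH] R v v' sR vv'.
- by apply: (partial_iso_eq sR); exact: small_iso_eval.
- have ev i := small_iso_eval (ts i) sR vv'.
  case: Q ts ev => [|lam] ts ev /=.
    have := pi_lt sR (ev ord0) (ev ord_max).
    by rewrite /olt (tnth2 (fun i => eval (M := lin_structure V) v (ts i)))
      (tnth2 (fun i => eval (M := lin_structure V) v' (ts i))).
  have [pe ze] := svalP lam; have [D [f [pf HG]]] := pend_of_endomorphism gV pe ze.
  have domE := pi_dom sR pf (ev ord0).
  rewrite !HG; split=> -[D0 E].
    have D0' := domE.1 D0; split=> //.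
    by apply/(partial_iso_eq sR (ev ord_max) (pi_pend sR pf (ev ord0) D0)).
  have D0' := domE.2 D0; split=> //.
  by apply/(partial_iso_eq sR (ev ord_max) (pi_pend sR pf (ev ord0) D0')).
- by [].
- by rewrite /= (IH1 _ _ _ sR vv') (IH2 _ _ _ sR vv').
- split=> H m /=.
    have [m' cut] := forth m (small_iso_sym sR).
    have sR' := extension_small sR (same_cut_sym cut).
    apply/(IH _ (oapp v m') _ sR'); last exact: (H m').
    by move=> [x|] /=; [exact: (extension_incl eE gV _ _ sR)|exact: (extension_new eE gV _ _ sR)].
  have [m' cut] := forth m sR.
  have sR' := extension_small sR cut.
  apply/(IH _ _ (oapp v' m') sR'); last exact: (H m').
  by move=> [x|] /=; [exact: (extension_incl eE gV _ _ sR)|exact: (extension_new eE gV _ _ sR)].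
Qed.

(* The formula given by linearity has parameters in [V]; by elementarity they
   can be found in [U], where partial isomorphisms are the identity. *)
Lemma linear_over_U n (psi : formula L 'I_n) :
  exists m (chi : formula (lin_language V) ('I_n + 'I_m)) (u : 'I_m -> U),
    forall a : 'I_n -> V, sat a psi <-> sat (M := lin_structure V) (copair a (e \o u)) chi.
Proof.
have dX : definable [set a : 'I_n -> V | sat a psi].
  exists (rename inl psi) => a; rewrite sat_rename.
  by have -> : copair a id \o inl = a by [].
have [chi0 Hchi0] := linV dX.
have [m [w [chi1 Echi]]] := formula_support chi0.
pose chi := rename (fun i => match w i with inl j => inl j | inr _ => inr i end) chi1 :
  formula (lin_language V) ('I_n + 'I_m).
pose q i := match w i with inr v => v | inl _ => 0 end.
have Hq a : sat a psi <-> sat (M := lin_structure V) (copair a q) chi.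
  apply: (iff_trans (Hchi0 a)); rewrite Echi /chi !sat_rename.
  suff -> : copair a id \o w = copair a q \o (fun i => match w i with inl j => inl j | inr _ => inr i end) by [].
  by apply/funext => i /=; case Ei : (w i) => [k|k] //=; rewrite /q Ei.
have [chis Hchis] := lin_formula_translate chi.
have [theta Htheta] := ex_formula (Neg (FAnd (Imp (rename inl psi) chis) (Imp chis (rename inl psi)))).
have HthetaV b : sat b (Neg theta) <-> forall a : 'I_n -> V, sat a psi <-> sat (M := lin_structure V) (copair a b) chi.
  have Ep a : sat (copair a b) (rename inl psi) = sat a psi by rewrite sat_rename.
  have Ec a := Hchis (copair a b).
  rewrite sat_Neg Htheta; split=> [H a|H [a]].
    have : ~ ~ sat (copair a b) (FAnd (Imp (rename inl psi) chis) (Imp chis (rename inl psi))).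
      by move=> K; apply: H; exists a; exact: K.
    by move=> /contrapT; rewrite sat_And /= Ep; have := Ec a; tauto.
  by rewrite sat_Neg; apply; rewrite sat_And /= Ep; have := Ec a; have := H a; tauto.
have [|u Hu] := @elementary_witness _ _ _ _ eE void m (of_void _) (rename inl (Neg theta)) q.
  by rewrite sat_rename; apply/HthetaV.
exists m, chi, u; apply/HthetaV/eE; move: Hu; rewrite sat_rename.
by [].
Qed.

Theorem small_iso_elementary X (phi : formula L X) R (v v' : X -> V) :
  small_iso R -> (forall i, R (v i) (v' i)) -> sat v phi <-> sat v' phi.
Proof.
move=> sR vv'; have [n [w [psi ->]]] := formula_support phi.
have [m [chi [u H]]] := linear_over_U psi.
rewrite !sat_rename !H; apply: (back_and_forth _ sR) => -[i|j] /=; first exact: vv'.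
exact: (pi_emb sR).
Qed.

Definition diagonal (C : V -> Prop) x y := C x /\ x = y.

Lemma closed_diagonal C : closed e C -> partial_iso e (diagonal C).
Proof.
move=> [CU Cadd Cp]; split.
- by move=> u; split.
- by move=> x x' y y' [Cx <-] [Cy <-]; split=> //; exact: Cadd.
- by move=> D f x x' pf [Cx <-].
- by move=> D f x x' pf [Cx <-] Dx; split=> //; exact: Cp pf _ _.
- by move=> x x' y y' [Cx <-] [Cy <-].
Qed.

Lemma small_diagonal C : closed e C -> small kappa C -> small_iso (diagonal C).
Proof.
move=> clC sC; split; first exact: closed_diagonal.
  by apply: small_sub sC => x [y []].
by apply: small_sub sC => y [x [Cx <-]].
Qed.

(** The form in which a cut over a closed set determines a type: elements in the same cut are
    conjugate over the set. *)
Lemma closed_automorphism C c c' : closed e C -> small kappa C -> same_cut (diagonal C) c c' ->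
  exists sigma : V -> V, [/\ automorphism sigma, forall x, C x -> sigma x = x & sigma c = c'].
Proof.
move=> clC sC cut.
have sD := small_diagonal clC sC; have sR := extension_small sD cut.
pose W : Type := (C : set V).
pose i (p : option W) := oapp set_val c p; pose j (p : option W) := oapp set_val c' p.
have sri : small kappa (range i).
  by apply: (smallT_image i); apply: (smallT_option kappaS); exact: (smallE _ _).1 sC.
have [|sigma [sA sE]] := homogeneous_family (i := i) (j := j) homV sri.
  move=> phi; apply: (small_iso_elementary _ sR) => -[x|] /=; last exact: (extension_new eE gV _ _ sD).
  by apply: (extension_incl eE gV _ _ sD); split=> //; exact: set_valP.
exists sigma; split=> //; last exact: (sE None).
by move=> x Cx; exact: (sE (Some (exist _ x (mem_set Cx)))).
Qed.

Definition adjoin (C : V -> Prop) c : V -> Prop := fun y => extension (diagonal C) c c y y.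

Lemma same_cut_refl C c : same_cut (diagonal C) c c.
Proof. by move=> d d' [_ <-]. Qed.

Lemma adjoinP C c y : closed e C -> adjoin C c y <->
  exists d d1 D f, [/\ C d, C d1, pend D f, D (c - d1) & y = d + f (c - d1)].
Proof.
move=> clC; split.
  move=> [d [d' [d1 [d1' [D [f [[[Cd _] [Cd1 _] pf] [Dc _ Ey _]]]]]]]].
  by exists d, d1, D, f.
move=> [d [d1 [D [f [Cd Cd1 pf Dc Ey]]]]].
by exists d, d, d1, d1, D, f.
Qed.

Lemma adjoin_closed C c : closed e C -> closed e (adjoin C c).
Proof.
move=> /closed_diagonal pD; have pE := extension_iso eE gV pD (@same_cut_refl C c).
split.
- by move=> u; exact: (pi_emb pE).
- by move=> x y; exact: (pi_add pE).
- by move=> D f x pf Nx Dx; exact: (pi_pend pE pf).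
Qed.

Lemma adjoin_small C c : closed e C -> small kappa C -> small kappa (adjoin C c).
Proof.
move=> clC sC; apply: small_sub (small_affine c sC) => y /(adjoinP _ _ clC).
by [].
Qed.

Lemma adjoin_incl C c x : closed e C -> C x -> adjoin C c x.
Proof. by move=> /closed_diagonal pD Cx; exact: (extension_incl eE gV _ _ pD). Qed.

Lemma adjoin_new C c : closed e C -> adjoin C c c.
Proof. by move=> /closed_diagonal pD; exact: (extension_new eE gV _ _ pD). Qed.

Lemma closed_opp C x : closed e C -> C x -> C (- x).
Proof.
by move=> clC Cx; apply: (closed_pend clC (pend_opp gV (pend_id V)) Cx).
Qed.

Lemma closed0 C : closed e C -> C 0.
Proof. by move=> clC; have [u <-] := emb_zero eE; exact: (closed_emb clC). Qed.

Lemma adjoin_sub C C' c : closed e C' -> (forall x, C x -> C' x) -> C' c -> closed e C ->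
  forall y, adjoin C c y -> C' y.
Proof.
move=> clC' CC' C'c clC y /(adjoinP _ _ clC)[d [d1 [D [f [Cd Cd1 pf Dc ->]]]]].
apply: (closed_add clC'); first exact: CC'.
apply: (closed_pend clC' pf) => //; apply: (closed_add clC') => //.
by apply: closed_opp => //; exact: CC'.
Qed.

(** Adding [c] itself to the left side of its cut still leaves a gap for saturation to fill. *)
Lemma same_cut_above C c : closed e C -> small kappa C -> ~ C c ->
  exists x, c < x /\ same_cut (diagonal C) c x.
Proof.
move=> clC sC nCc.
have sc1 : small kappa [set c].
  by apply: (small_sub_range (f := fun=> c) nat_small) => x ->; exists 0%N.
have [|||x [xA xB]] := @fill L kappa V kappaS gV satV
    ([set d | C d /\ d < c] `|` [set c]) [set d | C d /\ c < d].
- by apply: small_setU => //; apply: small_sub sC => y [].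
- by apply: small_sub sC => y [].
- move=> a b [[_ ac]|->] [_ cb] //; exact: (olt_trans gV ac cb).
have cx : c < x by apply: xA; right.
exists x; split=> // d _ [Cd <-]; split; split=> H.
- by apply: xA; left.
- case: (olt_total gV d c) => // dc; first by case: nCc; rewrite -dc.
  by have := xB d (conj Cd dc); oag.
- exact: xB.
- by oag.
Qed.

(** An element outside [C] is moved by an automorphism fixing [C], hence is not definable over
    it. *)
Lemma closed_dcl P (i : P -> V) C c : closed e C -> small kappa C -> (forall p, C (i p)) ->
  dcl i c -> C c.
Proof.
move=> clC sC iC [phi Hphi]; apply: contrapT => nCc.
have [x [cx cut]] := same_cut_above clC sC nCc.
have [sigma [sA sC' sc]] := closed_automorphism clC sC cut.
have : sat (copair (fun=> x) i) phi.
  have := (Hphi c).2 erefl; rewrite -(automorphism_sat _ _ sA).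
  suff -> : sigma \o copair (fun _ : 'I_1 => c) i = copair (fun _ : 'I_1 => x) i by [].
  by apply/funext => -[j|p] /=; [exact: sc|exact: sC'].
by move=> /Hphi xc; move: cx; rewrite xc; exact: (oltxx gV).
Qed.

End Closure.

(** * Isolated elements and links *)

Record setting (L : og_language) (kappa kappa' : Type) (U V : structure L) (e : U -> V) : Prop :=
  Setting {
  st_emb : elementary_embedding e ;
  st_gU : ogroup U ;
  st_gV : ogroup V ;
  st_limU : strong_limit kappa ;
  st_limV : strong_limit kappa' ;
  st_senU : card_lt [set: sentence L] [set: kappa] ;
  st_senV : card_lt [set: sentence L] [set: kappa'] ;
  st_satU : saturated kappa U ;
  st_satV : saturated kappa' V ;
  st_homU : strongly_homogeneous kappa U ;
  st_homV : strongly_homogeneous kappa' V ;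
  st_small : smallT kappa' U ;
  st_lin : linear V }.

(** From here on the arithmetic tactic also finds the group structure of [V] inside a [setting]. *)
Ltac og_group ::= match goal with
  | h : @ogroup _ _ |- _ => constr:(h)
  | h : @setting _ _ _ _ _ _ |- _ => constr:(st_gV h)
  end.

Section Isolated.
Variables (L : og_language) (kappa kappa' : Type) (U V : structure L) (e : U -> V).
Hypothesis S : setting kappa kappa' e.
Local Open Scope og_scope.
Implicit Types x y z c d g h : V.
Local Notation gV := (st_gV S).
Local Notation eE := (st_emb S).

Definition base (y : V) : Prop := exists u, e u = y.

Lemma base_closed : closed e base.
Proof.
split.
- by move=> u; exists u.
- by move=> _ _ [u <-] [w <-]; exists (u + w); exact: embD eE _ _.
- move=> D f _ pf [u <-] Du.
  have [|x [_ Hx]] := @Df_witness _ _ _ e unit (fun y w => D (w tt) /\ y = f (w tt)) (fun=> u) eE _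
      (ex_intro _ (f (e u)) (conj Du erefl)).
    exact: (Df_graph (Some tt) None (pend_graph pf)).
  by exists x; exact: Hx.
Qed.

Lemma base_small : small kappa' base.
Proof. by apply: (small_sub_range (f := e) (st_small S)) => y [u <-]; exists u. Qed.

Definition isolated (C : V -> Prop) g : Prop :=
  0 < g /\ forall d, C d -> 0 < d -> d + d < g \/ g + g < d.

Lemma isolated_notin C g : isolated C g -> ~ C g.
Proof. by move=> [g0 H] /H /(_ g0)[]; oag. Qed.

Lemma increasing_comp D f D' f' : pend D f -> pend D' f' -> increasing D f -> increasing D' f' ->
  increasing (fun x => D x /\ D' (f x)) (f' \o f).
Proof. by move=> pf pf' fI f'I x [Dx D'x] x0 /=; apply: f'I => //; exact: fI. Qed.

(** An exchange argument. Solving for [x] gives [h] in the closure of [C] and [g], so [h = d4 + F g]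
    or [d4 - F g] with [d4] in [C]. If [d4] is small against [h], then [F g] is within a factor two
    of [h]. Otherwise [d4] would be within a factor two of [F g], and its preimage under [F], in
    [C], would violate the isolation of [g]. *)
Lemma one_step C x g h : closed e C -> isolated C g -> isolated C h ->
  adjoin C x g -> adjoin C x h ->
  exists D f, [/\ pend D f, increasing D f, D g, h <= f g + f g & f g <= h + h].
Proof.
move=> clC ig ih Ng Nh; have [g0 gI] := ig; have [h0 hI] := ih.
have clNg := adjoin_closed eE gV g clC.
have inNg t := @adjoin_incl _ _ _ _ eE gV C g t clC.
have gNg := adjoin_new eE gV g clC.
(* The map expressing [g] through [x] is not zero, as [g] is not in [C], so it is invertible up to
   sign. *)
have xNg : adjoin C g x.
  move/(adjoinP _ _ clC): (Ng) => [d [d1 [D [f [Cd Cd1 pf Dx Eg]]]]].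
  have [f0|[b [f1 [pf1 f1I Ef]]]] := pend_sign gV pf.
    by case: (isolated_notin ig); rewrite Eg f0 //; have -> : d + 0 = d by oag.
  have pi := pend_inverse gV pf1 f1I.
  have Ex : x = d1 + inverse D f1 (if b then g - d else d - g).
    have -> : (if b then g - d else d - g) = f1 (x - d1).
      by move: Eg; rewrite Ef; case: (b) => /= ?; oag.
    by rewrite (inverseK gV pf1 f1I Dx); oag.
  rewrite Ex; apply: (closed_add clNg); first exact: inNg.
  apply: (closed_pend clNg pi).
    have clN : forall y, adjoin C g y -> adjoin C g (- y) by move=> y; exact: (closed_opp gV clNg).
    have dN := inNg _ Cd.
    by case: (b); apply: (closed_add clNg) => //; exact: clN.
  exists (x - d1) => //.
  by move: Eg; rewrite Ef; case: (b) => /= ?; oag.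
have hNg := adjoin_sub gV clNg inNg xNg clC Nh.
move/(adjoinP _ _ clC): hNg => [d3 [d3' [D [f [Cd3 Cd3' pf Dw Eh]]]]].
have [f0|[b [f1 [pf1 f1I Ef]]]] := pend_sign gV pf.
  by case: (isolated_notin ih); rewrite Eh f0 //; have -> : d3 + 0 = d3 by oag.
have CN := closed_opp gV clC.
have p2 := pend_dbl gV pf1; have p4 := pend_dbl gV p2; have p8 := pend_dbl gV p4.
have I2 := dbl_increasing gV f1I; have I4 := dbl_increasing gV I2; have I8 := dbl_increasing gV I4.
have D2w := dbl_sub gV pf1 Dw; have D4w := dbl_sub gV p2 D2w.
(* [g - d3'] is in [D] and, by isolation of [g], [d3'] is too far from [g] for cancellation below
   half of [g]. *)
have D2g : dbl_dom D g.
  rewrite /dbl_dom; have Eg := ohalfD gV g; have Dn := pend_domN pf1 Dw.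
  case: (olt_total gV 0 d3') => d30.
  - have [?|?] := gI _ Cd3' d30; first by apply: (pend_conv pf1 Dw); oag.
    by apply: (pend_conv pf1 Dn); oag.
  - by apply: (pend_conv pf1 Dw); oag.
  - by apply: (pend_conv pf1 Dw); oag.
have D4g := dbl_sub gV p2 D2g.
have D4d : dbl_dom (dbl_dom D) d3'.
  have -> : d3' = g - (g - d3') by oag.
  exact: (dbl_domB gV p2 D2g D2w).
(* Two doublings: the first accommodates [g], the second the difference [d3'] of two points of the
   first domain. *)
pose F := dbl (dbl f1); have EF : f1 (g - d3') = F g - F d3'.
  by rewrite /F -(pend_fB gV p4 D4g D4d D4w) (dblE gV p2 D2w) (dblE gV pf1 Dw).
have Fg0 : 0 < F g by exact: I4.
pose d4 := if b then d3 - F d3' else d3 + F d3'.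
have CF : C (F d3') by exact: (closed_pend clC p4).
have Cd4 : C d4 by rewrite /d4; case: (b); apply: (closed_add clC) => //; exact: CN.
have {}Eh : h = if b then d4 + F g else d4 - F g.
  by rewrite /d4 Eh Ef EF; case: (b); oag.
have fin : F g = h - d4 -> d4 + d4 < h -> - (d4 + d4) < h ->
    exists D f, [/\ pend D f, increasing D f, D g, h <= f g + f g & f g <= h + h].
  by move=> EFg H1 H2; exists (dbl_dom (dbl_dom D)), F; split=> //; rewrite EFg; oag.
have D8g := dbl_sub gV p4 D4g.
(* The isolation of [g] over [C] is transported by [F] to values of [F] on [C]. *)
have key q : C q -> 0 < q -> dbl_dom (dbl_dom (dbl_dom D)) q ->
    dbl F q + dbl F q < F g \/ F g + F g < dbl F q.
  move=> Cq q0 Dq; have E8g : dbl F g = F g by exact: (dblE gV p4 D4g).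
  have hv t : dbl_dom (dbl_dom (dbl_dom D)) t -> dbl F (ohalf t) + dbl F (ohalf t) = dbl F t /\
      dbl_dom (dbl_dom (dbl_dom D)) (ohalf t).
    move=> Dt; have Dh := pend_half gV p8 Dt; split=> //.
    have Et := ohalfD gV t; have := pend_add p8 Dh Dh; rewrite Et => /(_ Dt) ->; by [].
  have Eg := ohalfD gV g; have Eq := ohalfD gV q.
  have [H|H] := gI q Cq q0.
    have qg : q < ohalf g by oag.
    have [E1 D1] := hv g D8g; have lt1 : dbl F q < dbl F (ohalf g) := increasing_lt gV p8 I8 Dq D1 qg.
    by left; rewrite -E8g -E1; oag.
  have gq : g < ohalf q by oag.
  have [E1 D1] := hv q Dq; have lt1 : dbl F g < dbl F (ohalf q) := increasing_lt gV p8 I8 D8g D1 gq.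
  by right; rewrite -E8g -E1; oag.
have im q : C q -> 0 < q -> q < F g + F g -> exists t, [/\ C t, 0 < t, dbl_dom (dbl_dom (dbl_dom D)) t & dbl F t = q].
  move=> Cq q0 qF; have pi := pend_inverse gV p8 I8.
  have im2 : image_dom (dbl_dom (dbl_dom (dbl_dom D))) (dbl F) (F g + F g).
    by exists (g + g); [exact: (dbl_domD gV p4)|exact: (dbl_fD gV p4)].
  have imq : image_dom (dbl_dom (dbl_dom (dbl_dom D))) (dbl F) q.
    by apply: (pend_conv pi im2); oag.
  have [Dt Et] := inverseP imq.
  exists (inverse (dbl_dom (dbl_dom (dbl_dom D))) (dbl F) q); split=> //.
    exact: (closed_pend clC pi).
  exact: (inverse_increasing gV p8 I8).
case: (olt_total gV 0 d4) => d40.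
- have [H|H] := hI _ Cd4 d40.
    by move: Eh; case: (b) => Eh; [apply: fin; oag|exfalso; oag].
  have Eh' : h = d4 - F g by move: Eh; case: (b) => ?; oag.
  have [|t [Ct t0 Dt Et]] := im d4 Cd4 d40; first oag.
  have := key t Ct t0 Dt; rewrite Et => -[?|?]; exfalso; oag.
- have Eh' : h = d4 + F g by move: Eh; case: (b) => ?; oag.
  by apply: fin; oag.
- have n0 : 0 < - d4 by oag.
  have Eh' : h = d4 + F g by move: Eh; case: (b) => ?; oag.
  have [H|H] := hI _ (CN _ Cd4) n0; first by apply: fin; oag.
  have [|t [Ct t0 Dt Et]] := im (- d4) (CN _ Cd4) n0; first oag.
  have := key t Ct t0 Dt; rewrite Et => -[?|?]; exfalso; oag.
Qed.

End Isolated.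

Lemma automorphism_lt (L : og_language) (V : structure L) (s : V -> V) x y :
  automorphism s -> olt (s x) (s y) <-> olt x y.
Proof.
move=> sA; have [phi Hphi] := @Df_lt L V bool true false.
pose v (b : bool) := if b then x else y.
have := automorphism_sat v phi sA; have := Hphi v; have /= := Hphi (s \o v).
by move=> H1 H2 H3; apply: (iff_trans H1); rewrite H3; exact: iff_sym.
Qed.

Lemma automorphism_add (L : og_language) (V : structure L) (s : V -> V) x y :
  automorphism s -> s (oadd x y) = oadd (s x) (s y).
Proof.
case=> _ H _; rewrite /oadd H; congr fint; apply/funext => -[[|[|m]] Hm] //.
Qed.

Lemma automorphism_opp (L : og_language) (V : structure L) (s : V -> V) x :
  ogroup V -> automorphism s -> s (oopp x) = oopp (s x).
Proof.
move=> gV sA; have E0 : s (ozero V) = ozero V.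
  have := automorphism_add (ozero V) (ozero V) sA.
  have -> : oadd (ozero V) (ozero V) = ozero V by oag.
  by move=> ?; oag.
have := automorphism_add x (oopp x) sA.
have -> : oadd x (oopp x) = ozero V by oag.
by rewrite E0 => ?; oag.
Qed.

Lemma automorphism_pend (L : og_language) (V : structure L) (s : V -> V) D f x :
  automorphism s -> pend D f -> D x -> D (s x) /\ f (s x) = s (f x).
Proof.
move=> sA pf Dx; have [phi H] := pend_graph pf.
have /H : D x /\ f x = f x by [].
rewrite -(automorphism_sat _ _ sA).
have -> : s \o tnth [tuple x; f x] = tnth [tuple s x; s (f x)].
  by apply/funext => -[[|[|m]] Hm].
by move=> /H[].
Qed.

Section Chains.
Variables (L : og_language) (kappa kappa' : Type) (U V : structure L) (e : U -> V).
Hypothesis S : setting kappa kappa' e.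
Local Open Scope og_scope.
Implicit Types x y z c d g h : V.
Local Notation gV := (st_gV S).
Local Notation eE := (st_emb S).
Local Notation base := (base e).

(** Having the same cut over [U]; by [ceq_auto] and [tp_ceq] it is the same as having the same type
    over [U]. *)
Definition ceq x y : Prop :=
  forall u, (e u < x <-> e u < y) /\ (x < e u <-> y < e u).

Lemma ceq_refl x : ceq x x. Proof. by []. Qed.
Lemma ceq_sym x y : ceq x y -> ceq y x. Proof. by move=> H u; have := H u; tauto. Qed.
Lemma ceq_trans x y z : ceq x y -> ceq y z -> ceq x z.
Proof. by move=> H H' u; have := H u; have := H' u; tauto. Qed.

Lemma small_closed_automorphism C c c' : closed e C -> small kappa' C ->
  same_cut (diagonal C) c c' ->
  exists sigma : V -> V, [/\ automorphism sigma, forall x, C x -> sigma x = x & sigma c = c'].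
Proof.
exact: (closed_automorphism eE gV (st_limV S) (st_senV S) (st_satV S) (st_homV S) (st_lin S)).
Qed.

Definition auto_U (s : V -> V) : Prop := automorphism s /\ forall u, s (e u) = e u.

Lemma auto_U_ceq s x : auto_U s -> ceq x (s x).
Proof. by move=> [sA sU] u; rewrite -{2 4}(sU u) !(automorphism_lt _ _ sA). Qed.

Lemma auto_U_inv s : auto_U s -> exists t, [/\ auto_U t, cancel s t & cancel t s].
Proof.
move=> [sA sU]; have [t [tA sK tK]] := automorphism_inv sA.
by exists t; split=> //; split=> // u; rewrite -{1}(sU u) sK.
Qed.

Lemma auto_U_comp s t : auto_U s -> auto_U t -> auto_U (s \o t).
Proof.
move=> [sA sU] [tA tU]; split; first exact: automorphism_comp.
by move=> u /=; rewrite tU sU.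
Qed.

Lemma auto_U_id : auto_U id.
Proof. by split=> //; exact: automorphism_id. Qed.

Lemma ceq_auto x y : ceq x y -> exists s, auto_U s /\ s x = y.
Proof.
move=> xy; have [|s [sA sU sx]] := small_closed_automorphism (c := x) (c' := y) (base_closed S) (base_small S).
  by move=> d _ [[u <-] <-]; exact: xy.
by exists s; split=> //; split=> // u; apply: sU; exists u.
Qed.

(** A point of [U] separating [y] from [g] would lie within a factor two of [g], against
    isolation. *)
Lemma isolated_scale g y : isolated base g -> g <= y + y -> y <= g + g -> ceq y g.
Proof.
move=> [g0 H] gy yg u; have y0 : 0 < y by oag.
have Bu : base (e u) by exists u.
case: (olt_total gV 0 (e u)) => u0.
- by have [?|?] := H _ Bu u0; split; split; oag.
- by split; split; oag.
- by split; split; oag.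
Qed.

Lemma isolated_ceq g h : isolated base g -> ceq g h -> isolated base h.
Proof.
move=> [g0 H] gh; have [o Eo] := emb_zero eE.
split; first by move: g0; rewrite -Eo; move/(gh o).1.
move=> _ [u <-] u0; have Bu : base (e u) by exists u.
have [w Ew] : base (e u + e u) by apply: (closed_add (base_closed S)).
have [w' Ew'] : base (ohalf (e u)).
  apply: (closed_pend (base_closed S) (D := fun=> True)) => //; split=> //.
  - by move=> x y _ _ _; exact: (ohalf_add gV).
  - apply: Df_zero_graph; apply: (@Df_iff _ _ _ (fun v : bool -> V => v false + v false = v true)).
      by move=> v; have := ohalfD gV (v true); split=> [?|[_ ->]//]; split=> //; oag.
    exact: (Df_add V false false true).
have [H1|H1] := H _ Bu u0.
  by left; move: H1; rewrite -Ew => /(gh w).1.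
right; have Eh := ohalfD gV (e u).
have : g < ohalf (e u) by oag.
by rewrite -Ew' => /(gh w').2; rewrite Ew' => ?; oag.
Qed.

(** Some point of [U] separates [d] from [g]. Being in [U] it is at a factor more than two from [g],
    and [d] is still farther. *)
Lemma isolated_sep g d : isolated base g -> ~ ceq d g -> 0 < d -> d + d < g \/ g + g < d.
Proof.
move=> [g0 H] /existsNP[u Hu] d0; have Bu : base (e u) by exists u.
have Hu0 := H _ Bu.
have [|[|[|]]] : (e u < d /\ ~ e u < g) \/ (~ e u < d /\ e u < g) \/
   (d < e u /\ ~ g < e u) \/ (~ d < e u /\ g < e u).
  by have := EM (e u < d); have := EM (e u < g); have := EM (d < e u); have := EM (g < e u); move: Hu; tauto.
- move=> [? ?]; have u0 : 0 < e u by oag.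
  by have [?|?] := Hu0 u0; [exfalso|right]; oag.
- move=> [? ?]; have u0 : 0 < e u by oag.
  by have [?|?] := Hu0 u0; [left|exfalso]; oag.
- move=> [? ?]; have u0 : 0 < e u by oag.
  by have [?|?] := Hu0 u0; [left|exfalso]; oag.
- move=> [? ?]; have u0 : 0 < e u by oag.
  by have [?|?] := Hu0 u0; [exfalso|right]; oag.
Qed.

Lemma isolated_extend C g : closed e C -> isolated base g ->
  (forall d, C d -> ~ ceq d g) -> isolated C g.
Proof. by move=> clC ig N; split=> [|d Cd]; [case: ig|apply: isolated_sep => //; exact: N]. Qed.

Definition linked g h : Prop := exists D f, [/\ pend D f, increasing D f, D g & ceq (f g) h].

Lemma linked_ceq g h : ceq g h -> linked g h.
Proof. by move=> gh; exists (fun=> True), id; split=> //; exact: pend_id. Qed.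

(** An automorphism over [U] taking [f g] to [h] turns [h] into an exact value [f (s g)], to which
    the inverse of [f] applies. *)
Lemma linked_sym g h : linked g h -> linked h g.
Proof.
move=> [D [f [pf fI Dg fgh]]]; have [s [sU sh]] := ceq_auto fgh.
have [Dsg Esg] := automorphism_pend sU.1 pf Dg.
exists (image_dom D f), (inverse D f); split.
- exact: (pend_inverse gV pf fI).
- exact: (inverse_increasing gV pf fI).
- by exists (s g) => //; rewrite Esg.
- rewrite -sh -Esg (inverseK gV pf fI Dsg); apply: ceq_sym; exact: auto_U_ceq.
Qed.

Lemma linked_trans g h k : linked g h -> linked h k -> linked g k.
Proof.
move=> [D [f [pf fI Dg fgh]]] [D' [f' [pf' f'I Dh fhk]]].
have [s [sU sh]] := ceq_auto fgh.
have [Dsg Esg] := automorphism_pend sU.1 pf Dg.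
have [t [tU sK tK]] := auto_U_inv sU.
have pc := pend_comp gV pf pf'.
have Dc : D (s g) /\ D' (f (s g)) by rewrite Esg sh.
have := automorphism_pend tU.1 pc Dc; rewrite sK => -[Dg' E'].
exists (fun x => D x /\ D' (f x)), (f' \o f); split=> //.
  exact: increasing_comp.
apply: ceq_trans fhk; rewrite E' /= Esg sh; apply: ceq_sym; exact: auto_U_ceq.
Qed.

(** For a finite tuple this is its definable closure together with [U], by [dcl_tower] and
    [tower_in_dcl], in a form that allows induction on the tuple. *)
Fixpoint tower (s : seq V) : V -> Prop :=
  if s is x :: s' then adjoin (tower s') x else base.

Lemma tower_closed s : closed e (tower s).
Proof. by elim: s => [|x s IH] /=; [exact: (base_closed S)|exact: (adjoin_closed eE gV _ IH)]. Qed.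

Lemma tower_small s : small kappa' (tower s).
Proof.
elim: s => [|x s IH] /=; first exact: (base_small S).
exact: (adjoin_small (st_limV S) (st_senV S) _ (tower_closed s) IH).
Qed.

Lemma tower_in s x : List.In x s -> tower s x.
Proof.
elim: s => //= y s IH [->|/IH H]; first exact: (adjoin_new eE gV _ (tower_closed s)).
exact: (adjoin_incl eE gV _ (tower_closed s) H).
Qed.

Lemma tower_cons x s y : tower s y -> tower (x :: s) y.
Proof. exact: (adjoin_incl eE gV _ (tower_closed s)). Qed.

(** The bound is by [kappa], although [U] itself is not small for it. There are few maps but many
    shifts; for each formula one shift [d2] is fixed, and replacing another shift [d1] by it costs
    only an element of the previous tower, to which induction applies. *)
Lemma tower_split s : exists A : set V, [/\ small kappa A, forall x, A x -> tower s x &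
  forall y, tower s y -> exists u x, A x /\ y = e u + x].
Proof.
have natU := smallT_nat (st_senU S).
elim: s => [|a s [A [As At AE]]].
  have [o Eo] := emb_zero eE.
  exists [set 0 : V]; split.
  - by apply: (small_sub_range (f := fun=> 0 : V) natU) => x ->; exists 0%N.
  - by move=> x ->; exact: (closed0 eE (base_closed S)).
  - by move=> _ [u <-]; exists u, 0; split=> //; oag.
have clT := tower_closed s.
pose good (phi : formula L 'I_2) (d1 : V) (D : V -> Prop) (f : V -> V) :=
  [/\ tower s d1, pend D f, D (a - d1) &
    forall x z, D x /\ z = f x <-> sat (tnth [tuple x; z]) phi].
have /choice[F HF] (phi : formula L 'I_2) : exists p : V * (V -> Prop) * (V -> V),
    (exists d1 D f, good phi d1 D f) -> good phi p.1.1 p.1.2 p.2.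
  have [[d1 [D [f H]]]|N] := pselect (exists d1 D f, good phi d1 D f).
    by exists (d1, D, f).
  by exists (0, (fun=> True), id).
pose B := [set y | exists x phi, [/\ A x, (exists d1 D f, good phi d1 D f) &
   y = x + (F phi).2 (a - (F phi).1.1)]].
exists B; split.
- apply: (@small_rel _ _ ((A : set V) * formula L 'I_2) _
    (fun t y => y = set_val t.1 + (F t.2).2 (a - (F t.2).1.1))).
  + apply: (smallT_prod (st_limU S)); first exact: (smallE _ _).1 As.
    exact: (smallT_formula (st_limU S) (st_senU S) (smallT_ord natU 2)).
  + by move=> t x y -> ->.
  + by move=> y [x [phi [Ax Hg ->]]]; exists (exist _ x (mem_set Ax), phi).
- move=> y [x [phi [Ax /HF[T1 p1 D1 _] ->]]].
  apply: (closed_add (tower_closed (a :: s))); first exact/tower_cons/At.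
  apply: (closed_pend (tower_closed (a :: s)) p1) => //.
  apply: (closed_add (tower_closed (a :: s))); first by apply: tower_in; left.
  by apply: (closed_opp gV (tower_closed (a :: s))); exact: tower_cons.
move=> y /(adjoinP _ _ clT)[d [d1 [D [f [Td Td1 pf Da ->]]]]].
have [phi Hphi] := pend_graph pf.
have Hg : exists d1 D f, good phi d1 D f by exists d1, D, f; split.
have [T2 p2 D2 H2] := HF _ Hg.
move: T2 p2 D2 H2; case EF : (F phi) => [[d2 D'] f'] /= T2 p2 D2 H2.
have same x : D x -> D' x /\ f' x = f x.
  move=> Dx; have /Hphi/H2[D'x ->] : D x /\ f x = f x by [].
  by [].
have [D'a E'a] := same _ Da.
have pd := pend_dbl gV p2.
have Td12 : tower s (d2 - d1) by apply: (closed_add clT) => //; exact: (closed_opp gV clT).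
have D12 : dbl_dom D' (d2 - d1).
  have -> : d2 - d1 = (a - d1) - (a - d2) by oag.
  exact: (dbl_domB gV p2).
(* The chosen map [f'] agrees with [f] on the domain of [f], having the same defining formula. *)
have Ef : f (a - d1) = dbl f' (d2 - d1) + f' (a - d2).
  rewrite -E'a -(dblE gV p2 D'a) -(dblE gV p2 D2).
  rewrite -(pend_add pd) //; last 1 first.
  - have -> : (d2 - d1) + (a - d2) = a - d1 by oag.
    exact: (dbl_sub gV p2 D'a).
  - by congr dbl; oag.
  - exact: (dbl_sub gV p2 D2).
have [u [x [Ax Ex]]] := AE (d + dbl f' (d2 - d1))
  (closed_add clT Td (closed_pend clT pd Td12 D12)).
exists u, (x + f' (a - d2)); split.
  by exists x, phi; rewrite EF.
by rewrite Ef; oag.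
Qed.

(** Finitely many points of [U] suffice; collecting them keeps the parameter set of the witness
    small. *)
Lemma tower_support s y : tower s y -> exists us : seq U, forall sigma : V -> V,
  automorphism sigma -> (forall u, List.In u us -> sigma (e u) = e u) ->
  (forall x, List.In x s -> sigma x = x) -> sigma y = y.
Proof.
elim: s y => [|a s IH] y.
  by move=> [u <-]; exists [:: u] => sigma _ H _; apply: H; left.
move=> /(adjoinP _ _ (tower_closed s))[d [d1 [D [f [Td Td1 pf Da ->]]]]].
have [us Hus] := IH _ Td; have [ws Hws] := IH _ Td1.
exists (us ++ ws) => sigma sA H1 H2.
have Ed : sigma d = d.
  by apply: Hus => // [u Hu|x Hx]; [apply: H1; apply/List.in_or_app; left|apply: H2; right].
have Ed1 : sigma d1 = d1.
  by apply: Hws => // [u Hu|x Hx]; [apply: H1; apply/List.in_or_app; right|apply: H2; right].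
rewrite (automorphism_add _ _ sA) Ed; congr (_ + _).
have [_ <-] := automorphism_pend sA pf Da; congr f.
rewrite (automorphism_add _ _ sA) (automorphism_opp _ gV sA) Ed1.
by congr (_ + _); apply: H2; left.
Qed.

End Chains.

(** * Invariant cuts *)

Section Dcl.
Variables (L : og_language) (V : structure L) (P : Type) (i : P -> V).
Local Open Scope og_scope.

Lemma dcl_Df (Q : V -> (P -> V) -> Prop) c :
  Df (fun v : option P -> V => Q (v None) (v \o Some)) -> (forall z, Q z i <-> z = c) ->
  dcl i c.
Proof.
move=> [phi H] Qc; exists (rename (oapp inr (inl ord0)) phi) => z.
by rewrite sat_rename -H /= -Qc.
Qed.

Lemma Df_subst X (a : X) (f : P -> X) (phi : formula L ('I_1 + P)) :
  Df (fun v : X -> V => sat (copair (fun=> v a) (v \o f)) phi).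
Proof.
exists (rename (copair (fun=> a) f) phi) => v; rewrite sat_rename.
by have -> : copair (fun=> v a) (v \o f) = v \o copair (fun=> a) f :> ('I_1 + P -> V)
  by apply/funext => -[].
Qed.

Lemma dcl_self p : dcl i (i p).
Proof. by exists (Eq (Var L (inl ord0)) (Var L (inr p))). Qed.

Lemma dcl_add c d : dcl i c -> dcl i d -> dcl i (c + d).
Proof.
move=> [phi Hphi] [psi Hpsi].
apply: (@dcl_Df (fun z w => exists x y, sat (copair (fun=> x) w) phi /\
   (sat (copair (fun=> y) w) psi /\ x + y = z))).
  apply: Df_ex; apply: Df_ex => /=; apply: Df_and.
    exact: (Df_subst (Some None) (fun p => Some (Some (Some p))) phi).
  apply: Df_and; first exact: (Df_subst None (fun p => Some (Some (Some p))) psi).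
  exact: (Df_add V (Some None) None (Some (Some None))).
move=> z; split=> [[x [y [/Hphi -> [/Hpsi -> <-]]]]//|->].
by exists c, d; split; [apply/Hphi|split=> //; apply/Hpsi].
Qed.

Lemma dcl_pend D f c : pend D f -> dcl i c -> D c -> dcl i (f c).
Proof.
move=> pf [phi Hphi] Dc.
apply: (@dcl_Df (fun z w => exists x, sat (copair (fun=> x) w) phi /\ (D x /\ z = f x))).
  apply: Df_ex => /=; apply: Df_and.
    exact: (Df_subst None (fun p => Some (Some p)) phi).
  exact: (Df_graph None (Some None) (pend_graph pf)).
move=> z; split=> [[x [/Hphi -> [_ ->]]]//|->].
by exists c; split; [apply/Hphi|].
Qed.

End Dcl.

Section Cuts.
Variables (L : og_language) (kappa kappa' : Type) (U V : structure L) (e : U -> V).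
Hypothesis S : setting kappa kappa' e.
Local Open Scope og_scope.
Implicit Types x y z c d g h : V.
Local Notation gV := (st_gV S).
Local Notation eE := (st_emb S).
Local Notation base := (base e).
Local Notation ceq := (ceq e).
Local Notation tower := (tower e).

Lemma tower_dcl P (i : P -> V) s y : (forall u, dcl i (e u)) ->
  (forall x, List.In x s -> dcl i x) -> tower s y -> dcl i y.
Proof.
move=> iU; elim: s y => [|a s IH] y is_; first by move=> [u <-].
have IHs z : tower s z -> dcl i z by apply: IH => x xs; apply: is_; right.
move=> /(adjoinP _ _ (tower_closed S s))[d [d1 [D [f [Td Td1 pf Da ->]]]]].
apply: dcl_add; first exact: IHs.
apply: (dcl_pend pf) => //; apply: dcl_add; first by apply: is_; left.
by apply: IHs; exact: (closed_opp gV (tower_closed S s)).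
Qed.

Lemma dcl_tower n (a : 'I_n -> V) c :
  dcl (copair a e) c -> tower (map a (enum 'I_n)) c.
Proof.
apply: (closed_dcl eE gV (st_limV S) (st_senV S) (st_satV S) (st_homV S) (st_lin S)
   (tower_closed S _) (tower_small S _)).
move=> [j|u] /=; last exact: (closed_emb (tower_closed S _)).
by apply: (tower_in S); exact: (@ord_forall_seq n V a (fun x => List.In x _)).1.
Qed.

Lemma tower_in_dcl n (a : 'I_n -> V) c :
  tower (map a (enum 'I_n)) c -> dcl (copair a e) c.
Proof.
apply: tower_dcl => [u|x]; first exact: (dcl_self (copair a e) (inr u)).
elim: (enum _) => //= k s IH [<-|/IH//].
exact: (dcl_self (copair a e) (inl k)).
Qed.

Lemma dcl_invariant n (p : set (formula L ('I_n + U))) (a : 'I_n -> V) c :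
  Sinv kappa p -> realises e a p -> dcl (copair a e) c ->
  Sinv kappa (tp e (fun _ : 'I_1 => c)).
Proof.
move=> [pC [A As Ainv]] ap [phi Hphi].
split; first exact: (tp_complete eE id (fun=> c)).
have [m [w [psi Epsi]]] := formula_support phi.
pose us : seq U := pmap (fun j => if w j is inr (inr u) then Some u else None) (enum 'I_m).
exists (A `|` [set u | List.In u us]).
  by apply: (small_setU (st_limU S)) => //; apply: (small_seq (st_limU S)); exact: (smallT_nat (st_senU S)).
move=> sigma sA sfix chi.
pose r (v : 'I_1 + ('I_n + U)) := if v is inr t then Some t else None.
pose r' (v : 'I_1 + U) : option ('I_n + U) := if v is inr u then Some (inr u) else None.
(* [theta] translates a formula about [c] into one about [a], using the definition [phi] of [c].
   Adding the parameters of [phi] to [A] makes it commute with the automorphism. *)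
pose theta (ch : formula L ('I_1 + U)) := FEx (FAnd (rename r phi) (rename r' ch)).
have thetaE ch : sat (copair a e) (theta ch) <-> sat (copair (fun _ : 'I_1 => c) e) ch.
  rewrite /theta sat_Ex.
  have Er z : oapp (copair a e) z \o r = copair (fun=> z) (copair a e).
    by apply/funext => -[].
  have Er' z : oapp (copair a e) z \o r' = copair (fun=> z) e.
    by apply/funext => -[].
  split=> [[z]|H].
    by rewrite sat_And !sat_rename Er Er' => -[/Hphi ->].
  exists c; rewrite sat_And !sat_rename Er Er'; split=> //.
  exact/Hphi.
have pE := complete_realised pC ap.
have -> : tp e (fun=> c) chi = p (theta chi).
  by rewrite pE /tp /=; apply/propext; exact: iff_sym (thetaE chi).
have -> : tp e (fun=> c) (rename (copair inl (inr \o sigma)) chi) =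
    p (theta (rename (copair inl (inr \o sigma)) chi)).
  by rewrite pE /tp /=; apply/propext; exact: iff_sym (thetaE _).
rewrite (Ainv sigma sA); last by move=> x Ax; apply: sfix; left.
suff -> : rename (copair inl (inr \o sigma)) (theta chi) =
  theta (rename (copair inl (inr \o sigma)) chi) by [].
rewrite /theta /FEx /FAnd /Neg /= !rename_comp; congr (Imp (All (Imp (Imp (Imp _ (Imp _ Bot)) Bot) Bot)) Bot).
  rewrite Epsi !rename_comp; apply: eq_rename => j /=.
  case Ew : (w j) => [t|[t|u]] //=; congr (Some (inr _)); apply: sfix; right.
  have : j \in enum 'I_m by rewrite mem_enum.
  rewrite /us; elim: (enum 'I_m) => //= k s IH; rewrite inE => /orP[/eqP <-|/IH H].
    by rewrite Ew; left.
  by case: (w k) => [//|[//|u']]; right.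
by apply: eq_rename => -[].
Qed.

Definition left_small c : Prop := exists C : set U, [/\ small kappa C,
  forall u, C u -> e u < c & forall u, e u < c -> exists u', C u' /\ e u <= e u'].

Definition right_small c : Prop := exists C : set U, [/\ small kappa C,
  forall u, C u -> c < e u & forall u, c < e u -> exists u', C u' /\ e u' <= e u].

Lemma emb_lt (u w : U) : e u < e w <-> u < w.
Proof.
pose phi : formula L bool := Rel (lt_sym L) (tnth [tuple Var L true; Var L false]).
have E (M : structure L) (v : bool -> M) : sat v phi <-> v true < v false.
  rewrite /phi /=; set k := (X in rint _ X); suff -> : k = tnth [tuple v true; v false] by [].
  by apply/funext => -[[|[|m]] Hm].
have := eE phi (fun b : bool => if b then u else w).
by rewrite !E /=; tauto.
Qed.

(** Let [C] collect the endpoints of all subsets of [U] definable over [A]; it is small. If it is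
    neither cofinal below [c] nor coinitial above, there are [l < c < r] in [U] with no point of [C]
    in between. Then [l] and [r] have the same type over [A], and an automorphism over [A] taking
    [l] to [r] contradicts invariance. *)
Lemma invariant_small_side c : Sinv kappa (tp e (fun _ : 'I_1 => c)) -> ~ base c ->
  left_small c \/ right_small c.
Proof.
move=> [_ [A As Ainv]] nc.

pose W : Type := A.
pose dset (phi : formula L ('I_1 + W)) (x : U) := sat (copair (fun=> x) (set_val : W -> U)) phi.
have udset phi : uset (dset phi).
  exists (rename (copair inl (inr \o set_val)) phi) => v; rewrite sat_rename /dset /=.
  suff -> : copair (fun=> v ord0) set_val = copair v id \o copair inl (inr \o set_val) :> ('I_1 + W -> U) by [].
  by apply/funext => -[j|//]; rewrite /= (ord1 j).
have [E HE] := choice (fun phi => endpoints (st_gU S) (udset phi)).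
pose C : set U := [set u | exists phi, List.In u (E phi)].
have natU := smallT_nat (st_senU S).
have Ws : smallT kappa W by exact: (smallE _ _).1 As.
have Cs : small kappa C.
  apply: (small_bigseq (st_limU S) natU E).
  apply: (smallT_formula (st_limU S) (st_senU S)); apply: (smallT_sum (st_limU S)) => //.
  exact: (smallT_ord natU 1).
apply: contrapT => /not_orP[nL nR].
have [l [lc lC]] : exists l, e l < c /\ forall u, C u -> e u < c -> e u < e l.
  apply: contrapT => N; apply: nL; exists (C `&` [set u | e u < c]); split.
  - by apply: small_sub Cs => u [].
  - by move=> u [].
  - move=> u uc; apply: contrapT => N'; apply: N; exists u; split=> // w Cw wc.
    by apply: contrapT => H; apply: N'; exists w; split; [split|].
have [r [rc rC]] : exists r, c < e r /\ forall u, C u -> c < e u -> e r < e u.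
  apply: contrapT => N; apply: nR; exists (C `&` [set u | c < e u]); split.
  - by apply: small_sub Cs => u [].
  - by move=> u [].
  - move=> u uc; apply: contrapT => N'; apply: N; exists u; split=> // w Cw wc.
    by apply: contrapT => H; apply: N'; exists w; split; [split|].
have lr : l < r by apply/emb_lt; oag.
have same phi : dset phi l <-> dset phi r.
  apply: contrapT => H; have [z [zE lz zr]] := HE phi _ _ lr H.
  have Cz : C z by exists phi.
  have {}lz : ~ e z < e l by rewrite emb_lt.
  have {}zr : ~ e r < e z by rewrite emb_lt.
  case: (olt_total gV (e z) c) => zc.
  - by have := lC z Cz zc.
  - by apply: nc; exists z.
  - by have := rC z Cz zc.
pose i (o : option W) : U := oapp set_val l o; pose j (o : option W) : U := oapp set_val r o.
have [||sigma [sA sE]] := homogeneous_family (i := i) (j := j) (st_homU S).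
- by apply: smallT_image; exact: (smallT_option (st_limU S)).
- move=> phi; have := same (rename (fun o => if o is Some x then inr x else inl ord0) phi).
  rewrite /dset !sat_rename.
  have -> : copair (fun _ : 'I_1 => l) (set_val : W -> U) \o (fun o => if o is Some x then inr x else inl ord0) = i.
    by apply/funext => -[].
  have -> : copair (fun _ : 'I_1 => r) (set_val : W -> U) \o (fun o => if o is Some x then inr x else inl ord0) = j.
    by apply/funext => -[].
  by [].
pose phi : formula L ('I_1 + U) := Rel (lt_sym L) (tnth [tuple Var L (inr l); Var L (inl ord0)]).
have phiE w : tp e (fun _ : 'I_1 => c) (rename (copair inl (inr \o w)) phi) <-> e (w l) < c.
  rewrite /tp /= /olt; set k := (X in rint _ X); suff -> : k = tnth [tuple e (w l); c] by [].
  by apply/funext => -[[|[|m]] Hm].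
have /phiE : tp e (fun _ : 'I_1 => c) (rename (copair inl (inr \o sigma)) phi).
  rewrite -(Ainv sigma sA).
    have := (phiE id).2 lc; suff -> : rename (copair inl (inr \o id)) phi = phi by [].
    by rewrite -[RHS]rename_id; apply: eq_rename => -[].
  by move=> x Ax; exact: (sE (Some (exist _ x (mem_set Ax)))).
have /= -> := sE None; rewrite /j /=; oag.
Qed.

End Cuts.

(** * Normal forms, finitely many classes, extremal elements *)

Section NormalForm.
Variables (L : og_language) (kappa kappa' : Type) (U V : structure L) (e : U -> V).
Hypothesis S : setting kappa kappa' e.
Local Open Scope og_scope.
Implicit Types x y z c d g h : V.
Local Notation gV := (st_gV S).
Local Notation eE := (st_emb S).
Local Notation base := (base e).
Local Notation ceq := (ceq e).
Local Notation tower := (tower e).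

Lemma pend_half_map : pend (fun=> True) (@ohalf L V).
Proof.
split=> //.
- by move=> x y _ _ _; exact: (ohalf_add gV).
- apply: Df_zero_graph; apply: (@Df_iff _ _ _ (fun v : bool -> V => v false + v false = v true)).
    by move=> v; have := ohalfD gV (v true); split=> [?|[_ ->]//]; split=> //; oag.
  exact: (Df_add V false false true).
Qed.

Lemma baseD x y : base x -> base y -> base (x + y).
Proof. exact: (closed_add (base_closed S)). Qed.
Lemma baseN x : base x -> base (- x).
Proof. exact: (closed_opp gV (base_closed S)). Qed.
Lemma base_half x : base x -> base (ohalf x).
Proof. by move=> Bx; exact: (closed_pend (base_closed S) pend_half_map Bx). Qed.

(* [stab] is the stabilizer of the cut of [c]; the difference of [x] and [c] is
   isolated when [y - x] stabilizes the cut for all [y] between [x] and [c].  If no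
   [x] below [c] has this property, saturation of [U] provides one above [c]. *)
Lemma left_small_normal_form c : left_small kappa e c -> ~ base c ->
  exists x (b : bool) g, [/\ base x, isolated base g & c = if b then x + g else x - g].
Proof.
move=> [C [Cs CL Ccof]] nc.
pose stab r := forall l, base l -> l < c -> l + r < c.
have neq x : base x -> ~ x < c -> c < x.
  by move=> Bx xc; case: (olt_total gV x c) => // E; case: nc; rewrite -E.
have nstab r : base r -> ~ stab r -> exists l, [/\ base l, l < c & c < l + r].
  move=> Br /existsNP[l /not_implyP[Bl /not_implyP[lc H]]].
  by exists l; split=> //; apply: neq => //; exact: baseD.
have [[x [Bx xc Hx]]|N1] := pselect (exists x, [/\ base x, x < c &
    forall y, base y -> x < y -> y < c -> stab (y - x)]).
  exists x, true, (c - x); split=> //; last by oag.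
  split=> [|w Bw w0]; first oag.
  have Bh := base_half Bw; have Eh := ohalfD gV w.
  have st t : base t -> 0 < t -> x + t < c -> x + t + t < c.
    move=> Bt t0 xt; have Bxt := baseD Bx Bt.
    have /(_ (x + t) Bxt xt) : stab (x + t - x) by apply: Hx => //; oag.
    by oag.
  have [H|H] := pselect (x + w < c).
    by have := st w Bw w0 H; left; oag.
  have wc := neq _ (baseD Bx Bw) H; right.
  have [K|K] := pselect (x + ohalf w < c).
    have h0 : 0 < ohalf w by oag.
    by have := st (ohalf w) Bh h0 K; oag.
  by have := neq _ (baseD Bx Bh) K; oag.
have [[x [Bx xc Hx]]|N2] := pselect (exists x, [/\ base x, c < x &
    forall y, base y -> y < x -> c < y -> stab (x - y)]).
  exists x, false, (x - c); split=> //; last by oag.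
  split=> [|w Bw w0]; first oag.
  have Bh := base_half Bw; have Eh := ohalfD gV w.
  have st t : base t -> 0 < t -> c < x - t -> c < x - t - t.
    move=> Bt t0 xt; have Bxt := baseD Bx (baseN Bt).
    have stt : stab (x - (x - t)) by apply: Hx => //; oag.
    apply: neq; first exact: baseD Bxt (baseN Bt).
    move=> H; have := stt (x - t - t) (baseD Bxt (baseN Bt)) H; oag.
  have [H|H] := pselect (x - w < c).
    right; have [K|K] := pselect (x - ohalf w < c); first oag.
    have h0 : 0 < ohalf w by oag.
    have := st (ohalf w) Bh h0 (neq _ (baseD Bx (baseN Bh)) K); oag.
  have := st w Bw w0 (neq _ (baseD Bx (baseN Bw)) H); left; oag.
exfalso.
(* [F u] lies above [c] and bears witness that [u] fails. A point [v] of [U] above [C] and below all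
   [F u] is the required [x] on the other side: a failure at [v] would force some [F u] below
   [v]. *)
have /choice[F HF] (u : U) : exists w, C u -> exists l a, [/\ base l, base a, l < c, a < c &
    c < l + (a - e u)] /\ e w = l + (a - e u).
  have [Cu|] := pselect (C u); last by exists u.
  have Bu : base (e u) by exists u.
  apply: contrapT => N; apply: N1; exists (e u); split=> //; first exact: CL.
  move=> a Ba ua ac; apply: contrapT => Nst.
  have [l [Bl lc cl]] := nstab _ (baseD Ba (baseN Bu)) Nst.
  have [w Ew] := baseD Bl (baseD Ba (baseN Bu)).
  by apply: N; exists w => _; exists l, a.
have [||v [vC vF]] := @fill L kappa U (st_limU S) (st_gU S) (st_satU S) C [set F u | u in C] Cs.
- by apply: (small_sub_range (f := fun t : C => F (set_val t)) ((smallE _ _).1 Cs)) => _ [u Cu <-];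
    exists (exist _ u (mem_set Cu)).
- move=> u _ Cu [w Cw <-]; apply/(emb_lt S).
  have [l [a [[_ _ _ _ H] ->]]] := HF w Cw; have := CL u Cu; oag.
have vc : c < e v.
  apply: neq; first by exists v.
  move=> /Ccof[u [/vC]]; rewrite -(emb_lt S); oag.
apply: N2; exists (e v); split=> //; first by exists v.
move=> y By yv cy; apply: contrapT => Nst.
have Bv : base (e v) by exists v.
have [l [Bl lc cl]] := nstab _ (baseD Bv (baseN By)) Nst.
have [u0 Eu0] := Bl; move: (lc); rewrite -Eu0 => /Ccof[u [Cu lu]].
have [m [a [[Bm Ba mc ac cma] EF]]] := HF u Cu.
have : v < F u by apply: vF; exists u.
rewrite -(emb_lt S) EF; oag.
Qed.

Lemma normal_form c : left_small kappa e c \/ right_small kappa e c -> ~ base c ->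
  exists x (b : bool) g, [/\ base x, isolated base g & c = if b then x + g else x - g].
Proof.
move=> [|[C [Cs CR Ccof]]] nc; first by move/left_small_normal_form; apply.
have [||x [b [g [Bx ig E]]]] := @left_small_normal_form (- c).
- exists [set u | exists w, C w /\ e u = - e w]; split.
  + apply: (@small_rel _ _ (C : Type) _ (fun t u => e u = - e (set_val t))).
    * exact: (smallE _ _).1 Cs.
    * by move=> t u w Eu Ew; apply: (elementary_inj eE); rewrite Eu.
    * by move=> u [w [Cw Eu]]; exists (exist _ w (mem_set Cw)).
  + by move=> u [w [/CR cw ->]]; oag.
  + move=> u uc; have [w Ew] : base (- e u) by apply: baseN; exists u.
    have [w' [Cw' H]] : exists u', C u' /\ e u' <= e w by apply: Ccof; rewrite Ew; oag.
    have [u' Eu'] : base (- e w') by apply: baseN; exists w'.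
    by exists u'; split; [exists w'|rewrite Eu'; oag].
- move=> [u Eu]; apply: nc; have [w Ew] : base (- e u) by apply: baseN; exists u.
  by exists w; rewrite Ew; oag.
exists (- x), (~~ b), g; split=> //; first exact: baseN.
by move: E; case: b => /= E; oag.
Qed.

(** Kept abstract in [E] because it is used twice: for [linked] among isolated elements, and for
    mutual [below] inside a single cut. Adjoining one element adds at most one class, by
    [one_step]. *)
Lemma finite_representatives (P : V -> Prop) (E : V -> V -> Prop) s :
  (forall g, P g -> isolated base g) ->
  (forall C g, closed e C -> P g -> (forall d, C d -> P d -> ~ E d g) -> isolated C g) ->
  (forall D f g h, P g -> P h -> pend D f -> increasing D f -> D g ->
     h <= f g + f g -> f g <= h + h -> E g h) ->
  (forall g h k, P g -> P h -> P k -> E g h -> E h k -> E g k) ->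
  exists l : seq V, (forall x, List.In x l -> P x /\ tower s x) /\
    forall h, tower s h -> P h -> exists x, List.In x l /\ E x h.
Proof.
move=> Pi PC PE Etr; elim: s => [|a s [l [lP lE]]] /=.
  by exists [::]; split=> // h Bh /Pi/(@isolated_notin _ _ _ _ _ _ S)/(_ Bh).
have clT := tower_closed S s.
have lT x : List.In x l -> P x /\ adjoin (tower s) a x.
  by move=> /lP[Px Tx]; split=> //; exact: (tower_cons S).
have iso h : P h -> (forall x, List.In x l -> ~ E x h) -> isolated (tower s) h.
  move=> Ph N; apply: PC => // d Td Pd Edh; have [x [xl Exd]] := lE d Td Pd.
  by apply: (N x xl); apply: (Etr _ d) => //; case: (lP x xl).
(* Elements related to no old representative are isolated over the old tower, so [one_step] relates
   any of them to [h0]. *)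
have [[h0 [Th0 Ph0 N0]]|N] := pselect (exists h, [/\ adjoin (tower s) a h, P h &
    forall x, List.In x l -> ~ E x h]); last first.
  exists l; split=> // h Th Ph; apply: contrapT => N'; apply: N; exists h; split=> // x xl Exh.
  by apply: N'; exists x.
exists (h0 :: l); split=> [x [<-|/lT]//|h Th Ph].
have [[x [xl Exh]]|N] := pselect (exists x, List.In x l /\ E x h).
  by exists x; split=> //; right.
have N' x : List.In x l -> ~ E x h by move=> xl Exh; apply: N; exists x.
have [D [f [pf fI Dh0 H1 H2]]] := one_step S clT (iso _ Ph0 N0) (iso _ Ph N') Th0 Th.
by exists h0; split; [left|exact: (PE D f)].
Qed.

Lemma linked_representatives s : exists l : seq V,
  (forall x, List.In x l -> isolated base x /\ tower s x) /\
  forall h, tower s h -> isolated base h -> exists x, List.In x l /\ linked e x h.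
Proof.
apply: finite_representatives => //.
- move=> C g clC ig N; apply: (isolated_extend S clC ig) => d Cd dg.
  have id := isolated_ceq S ig (ceq_sym dg).
  exact: N d Cd id (linked_ceq dg).
- move=> D f g h ig ih pf fI Dg H1 H2; exists D, f; split=> //.
  exact: (isolated_scale S ih H1 H2).
- by move=> g h k _ _ _; exact: (linked_trans S).
Qed.

(** The order inside the cut of [c], made coarser by the endomorphisms that keep [y] in the cut. *)
Definition below c x y : Prop :=
  exists D f, [/\ pend D f, increasing D f, D y, ceq (f y) c & x <= f y].

Section Extremal.
Variable c : V.
Hypothesis ic : isolated base c.

Lemma below_le x y : ceq y c -> x <= y -> below c x y.
Proof. by move=> yc xy; exists (fun=> True), id; split=> //; exact: pend_id. Qed.

Lemma below_trans x y z : ceq y c -> ceq z c -> below c x y -> below c y z -> below c x z.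
Proof.
move=> yc zc [D [f [pf fI Dy fyc xfy]]] [D' [f' [pf' f'I Dz f'zc yfz]]].
have [s [sU sy]] := ceq_auto S (ceq_trans yc (ceq_sym f'zc)).
have [Dsy Esy] := automorphism_pend sU.1 pf Dy; rewrite sy in Dsy Esy.
exists (fun x => D' x /\ D (f' x)), (f \o f'); split.
- exact: (pend_comp gV).
- exact: (increasing_comp pf' pf f'I fI).
- by [].
- rewrite /= Esy; apply: ceq_trans (ceq_sym (auto_U_ceq _ sU)) fyc.
- have := increasing_le gV pf fI Dy Dsy yfz; rewrite /=; oag.
Qed.

Lemma pend_twice D f : pend D f -> increasing D f ->
  pend (fun x => D x /\ D x) (fun x => f x + f x) /\
  increasing (fun x => D x /\ D x) (fun x => f x + f x).
Proof.
move=> pf fI; split; first exact: (pend_sum gV pf pf).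
by move=> x [Dx _] x0; have := fI x Dx x0; oag.
Qed.

(** Finiteness of the classes of mutual [below] is what makes a farthest element exist: the cut
    itself may contain no largest or smallest element of the tower. *)
Lemma extremal_representatives s : exists l : seq V,
  (forall x, List.In x l -> ceq x c /\ tower s x) /\
  forall h, tower s h -> ceq h c -> exists x, List.In x l /\ (below c x h /\ below c h x).
Proof.
have iceq g : ceq g c -> isolated base g by move=> gc; exact: (isolated_ceq S ic (ceq_sym gc)).
have twice g : ceq g c -> ceq (g + g) c.
  move=> gc; apply: (ceq_trans _ gc); have [g0 _] := iceq g gc.
  by apply: (isolated_scale S (iceq g gc)); oag.
have b2 g d : ceq d c -> g <= d + d -> below c g d.
  move=> dc gd; have [p2 I2] := pend_twice (pend_id V) (fun _ _ pos => pos).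
  by exists (fun x => True /\ True), (fun x => x + x); split=> //; exact: twice.
apply: finite_representatives => //.
- move=> C g clC gc N; have ig := iceq g gc; have [g0 _] := ig.
  split=> // d Cd d0; have [dc|ndc] := pselect (ceq d c); last first.
    by apply: (isolated_sep S ig) => // dg; apply: ndc; exact: ceq_trans dg gc.
  apply: contrapT => /not_orP[H1 H2]; apply: (N d Cd dc); split; exact: b2.
- move=> D f g h gc hc pf fI Dg H1 H2; have ih := iceq h hc; have ig := iceq g gc.
  have [h0 _] := ih; have [g0 _] := ig.
  have fgc : ceq (f g) c by exact: ceq_trans (isolated_scale S ih H1 H2) hc.
  split; last first.
    have [p2 I2] := pend_twice pf fI.
    by exists (fun x => D x /\ D x), (fun x => f x + f x); split=> //; exact: twice.
  have pd := pend_dbl gV pf; have dI := dbl_increasing gV fI.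
  have pi := pend_inverse gV pd dI; have iI := inverse_increasing gV pd dI.
  have Eg := ohalfD gV g; have Dg2 := dbl_sub gV pf Dg; have Dh2 := pend_half gV pd Dg2.
  have im : image_dom (dbl_dom D) (dbl f) h.
    have im2 : image_dom (dbl_dom D) (dbl f) (f g + f g).
      by exists (g + g); [exact: (dbl_domD gV pf)|exact: (dbl_fD gV pf)].
    by apply: (pend_conv pi im2); oag.
  have [Dt Et] := inverseP im; have t0 := iI h im h0.
  (* For the converse comparison [h] is pulled back to [t], which lies between half of [g] and twice
     [g]; then [g <= t + t] with [t + t] still in the cut. *)
  move: Dt Et t0; set t := inverse _ _ _ => Dt Et t0.
  have hg : ohalf g <= t.
    move=> tg; have := increasing_lt gV pd dI Dt Dh2 tg; rewrite Et.
    have := pend_add pd Dh2 Dh2; rewrite Eg => /(_ Dg2); rewrite (dblE gV pf Dg); oag.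
  have tg : t <= g + g.
    have Dgg : dbl_dom D (g + g) by exact: (dbl_domD gV pf).
    move=> gt; have := increasing_lt gV pd dI Dgg Dt gt; rewrite Et.
    by rewrite (dbl_fD gV pf) //; oag.
  have tc : ceq t c.
    by apply: (ceq_trans _ gc); apply: (isolated_scale S ig); oag.
  have [p2 I2] := pend_twice pi iI.
  exists (fun y => image_dom (dbl_dom D) (dbl f) y /\ image_dom (dbl_dom D) (dbl f) y).
  exists (fun y => inverse (dbl_dom D) (dbl f) y + inverse (dbl_dom D) (dbl f) y).
  by split=> //; rewrite -/t; [exact: twice|oag].
- move=> g h k gc hc kc [H1 H2] [H3 H4]; by split; [exact: (below_trans hc kc H1 H3)|exact: (below_trans hc gc H4 H2)].
Qed.

Lemma extremal_max s : (exists g, tower s g /\ ceq g c) ->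
  exists m, [/\ tower s m, ceq m c & forall h, tower s h -> ceq h c -> below c h m].
Proof.
move=> [g [Tg gc]]; have [l [lP lE]] := extremal_representatives s.
have [||||m [ml mc mM]] := @seq_extremum _ (fun x => ceq x c) (below c) l.
- by move=> x xc; apply: below_le => //; oag.
- by move=> x y z xc yc zc; exact: below_trans.
- move=> x y xc yc; case: (olt_total gV x y) => xy;
    by [left; apply: below_le => //; oag|right; apply: below_le => //; oag].
- by have [x [xl _]] := lE g Tg gc; exists x; split=> //; case: (lP x xl).
exists m; split=> //; first by case: (lP m ml).
move=> h Th hc; have [x [xl [_ hx]]] := lE h Th hc.
have xc := (lP x xl).1; exact: below_trans xc mc hx (mM x xl xc).
Qed.

Lemma extremal_min s : (exists g, tower s g /\ ceq g c) ->
  exists m, [/\ tower s m, ceq m c & forall h, tower s h -> ceq h c -> below c m h].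
Proof.
move=> [g [Tg gc]]; have [l [lP lE]] := extremal_representatives s.
have [||||m [ml mc mM]] := @seq_extremum _ (fun x => ceq x c) (fun x y => below c y x) l.
- by move=> x xc; apply: below_le => //; oag.
- by move=> x y z xc yc zc H1 H2; exact: below_trans H2 H1.
- move=> x y xc yc; case: (olt_total gV x y) => xy;
    by [left; apply: below_le => //; oag|right; apply: below_le => //; oag].
- by have [x [xl _]] := lE g Tg gc; exists x; split=> //; case: (lP x xl).
exists m; split=> //; first by case: (lP m ml).
move=> h Th hc; have [x [xl [xh _]]] := lE h Th hc.
have xc := (lP x xl).1; exact: below_trans xc hc (mM x xl xc) xh.
Qed.

End Extremal.

End NormalForm.

(** * Orthogonality and products *)

Section Types.
Variables (L : og_language) (kappa kappa' : Type) (U V : structure L) (e : U -> V).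
Hypothesis S : setting kappa kappa' e.
Local Open Scope og_scope.
Implicit Types x y z d g h : V.
Local Notation gV := (st_gV S).
Local Notation eE := (st_emb S).
Local Notation base := (base e).
Local Notation ceq := (ceq e).
Local Notation tower := (tower e).
Local Notation auto_U := (auto_U e).

Lemma tp_auto n (s : V -> V) (a : 'I_n -> V) : auto_U s -> tp e (s \o a) = tp e a.
Proof.
move=> [sA sU]; apply/funext => phi; rewrite /tp /= -[RHS](automorphism_sat _ _ sA).
congr sat; apply/funext => -[//|u] /=.
by rewrite sU.
Qed.

Lemma natV : smallT kappa' nat.
Proof. exact: (smallT_nat (st_senV S)). Qed.

Lemma family_automorphism P (i j : P -> V) : smallT kappa' P ->
  (forall phi : formula L P, sat i phi <-> sat j phi) ->
  exists s, automorphism s /\ forall p, s (i p) = j p.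
Proof. by move=> Ps; apply: homogeneous_family (st_homV S) _; exact: smallT_image. Qed.

Lemma smallT_params n (T : Type) : smallT kappa' T -> smallT kappa' ('I_n + T).
Proof. by move=> Ts; apply: (smallT_sum (st_limV S)) => //; exact: (smallT_ord natV). Qed.

Lemma tp_eq_auto n (a b : 'I_n -> V) : tp e a = tp e b -> exists s, auto_U s /\ s \o a = b.
Proof.
move=> E; have [|s [sA sE]] := @family_automorphism _ (copair a e) (copair b e) (smallT_params n (st_small S)).
  by move=> phi; rewrite -[sat _ _]/(tp e a phi) E.
exists s; split; first by split=> // u; exact: (sE (inr u)).
by apply/funext => i; exact: (sE (inl i)).
Qed.

Lemma realises_tp n (a b : 'I_n -> V) : realises e b (tp e a) -> tp e a = tp e b.
Proof. by apply: complete_realised; exact: (tp_complete eE id). Qed.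

Lemma ceq_tp x y : ceq x y -> tp e (fun _ : 'I_1 => x) = tp e (fun _ : 'I_1 => y).
Proof. by move=> /(ceq_auto S)[s [sU <-]]; rewrite -(tp_auto (fun=> x) sU). Qed.

Lemma tp_ceq x y : tp e (fun _ : 'I_1 => x) = tp e (fun _ : 'I_1 => y) -> ceq x y.
Proof.
move=> /tp_eq_auto[s [sU E]]; have <- := congr1 (fun f => f ord0) E.
exact: auto_U_ceq.
Qed.

Lemma const1 (T : Type) (b : 'I_1 -> T) : b = fun=> b ord0.
Proof. by apply/funext => i; rewrite (ord1 i). Qed.

Lemma realised_base x : realised (tp e (fun _ : 'I_1 => x)) <-> base x.
Proof.
split=> [[u Hu]|[u Eu]].
  apply: contrapT => nx.
  have /Hu : tp e (fun _ : 'I_1 => x) (Neg (Eq (Var L (inl ord0)) (Var L (inr (u ord0))))).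
    by rewrite /tp /= => Ex; apply: nx; exists (u ord0).
  by rewrite /tp /=; apply.
exists (fun=> u) => phi; rewrite /tp /= => H; apply/eE; move: H; congr sat.
by apply/funext => -[].
Qed.

Fixpoint unlinked (l : seq V) : Prop :=
  if l is x :: l' then (forall y, List.In y l' -> ~ linked e x y) /\ unlinked l' else True.

(** By induction, an element linked to none of the earlier ones is isolated over their tower. This
    applies to [g], as the list is unlinked, and to [h] unless it is already done; [one_step] then
    links the two. *)
Lemma tower_linked l h : (forall x, List.In x l -> isolated base x) -> unlinked l ->
  tower l h -> isolated base h -> exists x, List.In x l /\ linked e x h.
Proof.
elim: l h => [|g l IH] h /= li; first by move=> _ Bh /(isolated_notin S).
move=> [gN lN] Th ih.
have ig : isolated base g by apply: li; left.
have IH' d : tower l d -> isolated base d -> exists x, List.In x l /\ linked e x d.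
  by apply: IH => // x xl; apply: li; right.
have [[x [xl xh]]|N] := pselect (exists x, List.In x l /\ linked e x h).
  by exists x; split=> //; right.
have clT := tower_closed S l.
have iTh : isolated (tower l) h.
  apply: (isolated_extend S clT ih) => d Td dh; apply: N.
  have [x [xl xd]] := IH' d Td (isolated_ceq S ih (ceq_sym dh)).
  by exists x; split=> //; apply: (linked_trans S xd); exact: linked_ceq.
have iTg : isolated (tower l) g.
  apply: (isolated_extend S clT ig) => d Td dg.
  have [x [xl xd]] := IH' d Td (isolated_ceq S ig (ceq_sym dg)).
  apply: (gN x xl); apply: (linked_sym S); apply: (linked_trans S xd); exact: linked_ceq.
have Tg : adjoin (tower l) g g by exact: (adjoin_new eE gV _ clT).
have [D [f [pf fI Dg H1 H2]]] := one_step S clT iTg iTh Tg Th.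
exists g; split; first by left.
by exists D, f; split=> //; exact: (isolated_scale S ih H1 H2).
Qed.

Definition affine (b : bool) x g : V := if b then x + g else x - g.

Lemma affine_ceq b x g h : base x -> ceq g h -> ceq (affine b x g) (affine b x h).
Proof.
move=> [u <-] /(ceq_auto S)[s [sU <-]]; have [sA su] := sU.
have -> : affine b (e u) (s g) = s (affine b (e u) g).
  rewrite /affine; case: b.
    by rewrite (automorphism_add _ _ sA) su.
  by rewrite (automorphism_add _ _ sA) (automorphism_opp _ gV sA) su.
exact: auto_U_ceq.
Qed.

Lemma affineK b x g : affine b (if b then - x else x) (affine b x g) = g.
Proof. by rewrite /affine; case: b; oag. Qed.

Lemma affine_inj b x g h : affine b x g = affine b x h -> g = h.
Proof. by move=> E; rewrite -(affineK b x g) E affineK. Qed.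

Lemma affine_tower b x g s : base x -> tower s g -> tower s (affine b x g).
Proof.
move=> [u <-] Tg; have clT := tower_closed S s; have Tu := closed_emb clT u.
by rewrite /affine; case: b; apply: (closed_add clT) => //; exact: (closed_opp gV clT).
Qed.

Lemma affine_towerE b x g s : base x -> tower s (affine b x g) -> tower s g.
Proof.
move=> Bx T; rewrite -(affineK b x g); apply: affine_tower => //.
by case: (b) => //; exact: (baseN S).
Qed.

Lemma affine_auto (s : V -> V) b x g : automorphism s -> s x = x -> s (affine b x g) = affine b x (s g).
Proof.
move=> sA sx; rewrite /affine; case: b.
  by rewrite (automorphism_add _ _ sA) sx.
by rewrite (automorphism_add _ _ sA) (automorphism_opp _ gV sA) sx.
Qed.

Lemma ceq_between x y d : ceq x y -> x <= d -> d <= y -> ceq d y.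
Proof.
move=> xy H1 H2 u; have [K1 K2] := xy u; split; split=> H.
- by oag.
- by have {}H := K1.2 H; oag.
- by have /K2.1 : x < e u by oag.
- by oag.
Qed.

(** Joint conjugacy from separate conjugacy, the independence behind orthogonality. The elements are
    moved one at a time: no element of the tower of those in place lies in the cut of the next one,
    so its cut over [U] already determines its cut over that tower. *)
Lemma align m (c c' x g : 'I_m -> V) (b : 'I_m -> bool) :
  (forall i, base (x i)) -> (forall i, isolated base (g i)) ->
  (forall i, c i = affine (b i) (x i) (g i)) -> (forall i, ceq (c' i) (c i)) ->
  (forall i j, i != j -> ~ linked e (g i) (g j)) ->
  exists s, auto_U s /\ forall i, s (c' i) = c i.
Proof.
move=> Bx ig cE cc' N.
suff H js : uniq js -> exists s, auto_U s /\ forall i, i \in js -> s (c' i) = c i.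
  have [s [sU sE]] := H _ (enum_uniq 'I_m); exists s; split=> // i.
  by apply: sE; rewrite mem_enum.
have InM (ks : seq 'I_m) y : List.In y (map g ks) -> exists2 i, i \in ks & y = g i.
  elim: ks => //= i ks IH [<-|/IH[k kj ->]]; first by exists i; rewrite ?inE ?eqxx.
  by exists k; rewrite // inE kj orbT.
elim: js => [|j js IH] /=; first by move=> _; exists id; split=> //; exact: auto_U_id.
move=> /andP[jN /[dup] uj /IH[s [sU sE]]].
have clT := tower_closed S (map g js).
have unl : unlinked (map g js).
  elim: js {IH sE clT jN} uj => //= i js IH /andP[iN /IH uj]; split=> // y.
  by move=> /InM[k kj ->]; apply: N; apply: contraNneq iN => ->.
have none d : tower (map g js) d -> ~ ceq d (c j).
  move=> Td dc; pose h := affine (b j) (if b j then - x j else x j) d.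
  have Bx' : base (if b j then - x j else x j) by case: (b j) => //; exact: (baseN S).
  have hg : ceq h (g j) by rewrite -(affineK (b j) (x j) (g j)) -cE; exact: affine_ceq.
  have ih : isolated base h by exact: (isolated_ceq S (ig j) (ceq_sym hg)).
  have [|y [/InM[k kj ->] lk]] := tower_linked _ unl (affine_tower (b j) Bx' Td) ih.
    by move=> y /InM[k _ ->].
  apply: (N k j); first by apply: contraNneq jN => <-.
  by apply: (linked_trans S lk); exact: linked_ceq.
have sc : ceq (s (c' j)) (c j).
  exact: ceq_trans (ceq_sym (auto_U_ceq _ sU)) (cc' j).
have [|t [tA tT tc]] := small_closed_automorphism S (c := s (c' j)) (c' := c j) clT (tower_small S _).
  move=> d _ [Td <-]; have nd := none d Td; split; split=> H; apply: contrapT => H'; apply: nd.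
  - by apply: ceq_sym; apply: ceq_trans (ceq_sym sc) _; apply: ceq_sym;
      apply: (ceq_between (ceq_sym sc)) => //; oag.
  - by apply: (ceq_between sc) => //; oag.
  - by apply: (ceq_between sc) => //; oag.
  - by apply: ceq_sym; apply: ceq_trans (ceq_sym sc) _; apply: ceq_sym;
      apply: (ceq_between (ceq_sym sc)) => //; oag.
have tU : auto_U t by split=> // u; apply: tT; exact: closed_emb clT _.
exists (t \o s); split; first exact: auto_U_comp.
move=> i; rewrite inE => /orP[/eqP -> //|ij] /=.
rewrite sE // cE; apply: tT; apply: affine_tower => //.
apply: (tower_in S); clear -ij; elim: js ij => //= k js IH.
by rewrite inE => /orP[/eqP ->|/IH]; [left|right].
Qed.

(** Both [f g] and [f g + f g] lie in the cut of [h]. Orthogonality would give an automorphism over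
    [U] fixing [g] and taking one to the other, although it has to fix [f g]. *)
Lemma linked_not_orthogonal b b' x y g h : base x -> base y -> isolated base g -> isolated base h ->
  linked e g h ->
  ~ weakly_orthogonal e (tp e (fun _ : 'I_1 => affine b x g)) (tp e (fun _ : 'I_1 => affine b' y h)).
Proof.
move=> Bx By ig ih [D [f [pf fI Dg fgh]]] [s sC Hs].
have [g0 _] := ig; have fg0 := fI g Dg g0.
have ifg := isolated_ceq S ih (ceq_sym fgh).
have ffg : ceq (f g + f g) h.
  by apply: (ceq_trans _ fgh); apply: (isolated_scale S ifg); oag.
pose c : 'I_1 -> V := fun=> affine b x g.
pose d (z : V) : 'I_1 -> V := fun=> affine b' y z.
have R z : ceq z h -> s = tp e (tcat c (d z)).
  move=> zh; apply: (complete_realised sC); apply: Hs; first by [].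
  by rewrite /d -(ceq_tp (affine_ceq b' By zh)).
have := R _ fgh; rewrite (R _ ffg) => /tp_eq_auto[t [tU E]].
have tc : t (affine b x g) = affine b x g.
  have := congr1 (fun k => k (lshift 1 ord0)) E.
  by rewrite /= /tcat -[lshift 1 ord0]/(unsplit (inl ord0)) unsplitK.
have td : t (affine b' y (f g + f g)) = affine b' y (f g).
  have := congr1 (fun k => k (rshift 1 ord0)) E.
  by rewrite /= /tcat -[rshift 1 ord0]/(unsplit (inr ord0)) unsplitK.
have tb z : base z -> t z = z by move=> [u <-]; exact: tU.2.
move: tc td; rewrite (affine_auto _ _ tU.1 (tb _ Bx)) (affine_auto _ _ tU.1 (tb _ By)).
move=> /affine_inj tg /affine_inj; rewrite (automorphism_add _ _ tU.1).
have [_ <-] := automorphism_pend tU.1 pf Dg; rewrite tg => ?; oag.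
Qed.

Lemma unlinked_orthogonal b b' x y g h : base x -> base y -> isolated base g -> isolated base h ->
  ~ linked e g h ->
  weakly_orthogonal e (tp e (fun _ : 'I_1 => affine b x g)) (tp e (fun _ : 'I_1 => affine b' y h)).
Proof.
move=> Bx By ig ih N.
pose c (i : 'I_2) := if i == ord0 then affine b x g else affine b' y h.
exists (tp e (tcat (fun _ : 'I_1 => affine b x g) (fun _ : 'I_1 => affine b' y h))).
  exact: (tp_complete eE id).
move=> c1 d1 Hc Hd.
have {}Hc : ceq (c1 ord0) (affine b x g).
  by apply: tp_ceq; rewrite -(const1 c1) -(realises_tp Hc).
have {}Hd : ceq (d1 ord0) (affine b' y h).
  by apply: tp_ceq; rewrite -(const1 d1) -(realises_tp Hd).
have [||||| s [sU sE]] := @align 2 c (fun i => if i == ord0 then c1 ord0 else d1 ord0)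
  (fun i => if i == ord0 then x else y) (fun i => if i == ord0 then g else h)
  (fun i => if i == ord0 then b else b').
- by move=> i; case: eqP.
- by move=> i; case: eqP.
- by move=> i; rewrite /c; case: eqP.
- by move=> i; rewrite /c; case: eqP.
- move=> i j ij; have [i0|i0] := eqVneq i ord0; have [j0|j0] := eqVneq j ord0 => //.
  + by move: ij; rewrite i0 j0.
  + by move=> /(linked_sym S).
  + by move: ij i0 j0; case: i => -[|[|i]] Hi; case: j => -[|[|j]] Hj.
rewrite /realises -(tp_auto (tcat c1 d1) sU).
suff -> : s \o tcat c1 d1 = tcat (fun _ : 'I_1 => affine b x g) (fun _ : 'I_1 => affine b' y h) by [].
apply/funext => i; rewrite /tcat /=; case: (fintype.split i) => k /=; rewrite (ord1 k).
  exact: (sE ord0).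
exact: (sE ord_max).
Qed.

End Types.

(** * Invariant extensions and tensor products *)

Lemma split_support (L : language) n (P : Type) (p0 : P) (chi : formula L ('I_n + P)) :
  exists k (phi : formula L ('I_n + 'I_k)) (b : 'I_k -> P),
    chi = rename (copair inl (inr \o b)) phi.
Proof.
have [k [w [psi ->]]] := formula_support chi.
exists k, (rename (fun i => if w i is inl x then inl x else inr i) psi).
exists (fun i => if w i is inr y then y else p0); rewrite rename_comp.
by apply: eq_rename => i /=; case E : (w i) => //=; rewrite E.
Qed.

Section Tensor.
Variables (L : og_language) (kappa kappa' : Type) (U V : structure L) (e : U -> V).
Hypothesis S : setting kappa kappa' e.
Local Notation eE := (st_emb S).
Local Notation auto_U := (auto_U e).

Lemma small_finite_union (T : Type) k (A : 'I_k -> set T) : (forall j, small kappa (A j)) ->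
  small kappa [set x | exists j, A j x].
Proof.
have natU := smallT_nat (st_senU S).
elim: k A => [|k IH] A As.
  by apply: small_sub (small_seq (st_limU S) natU [::]) => x [[]].
apply: small_sub (small_setU (st_limU S) (As ord0) (IH (fun j => A (lift ord0 j)) (fun j => As _))).
move=> x [j Hj]; case: (unliftP ord0 j) Hj => [i|] -> Hi; [right|by left].
by exists i.
Qed.

Lemma realise_over (A : set U) m (b : 'I_m -> V) : small kappa A ->
  exists d : 'I_m -> U, forall X (w : X -> 'I_m + U),
    (forall x u, w x = inr u -> A u) -> forall psi : formula L X,
    sat (copair d id \o w) psi <-> sat (copair b e \o w) psi.
Proof.
move=> As; have rs : small kappa (range (set_val : A -> U)).
  by apply: small_sub As => _ [x _ <-]; exact: set_valP.
have [d dP] := realise_down eE (i := set_val : A -> U) b (st_satU S) rs.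
exists d => X w wA psi.
have /choice[v vP] (x : X) : exists t : 'I_m + A,
    copair b (e \o set_val) t = copair b e (w x) /\ copair d set_val t = copair d id (w x).
  case E : (w x) => [i|u]; first by exists (inl i).
  by exists (inr (exist _ u (mem_set (wA _ _ E)))).
have := dP (rename v psi); rewrite !sat_rename.
have -> : copair b (e \o set_val) \o v = copair b e \o w by apply/funext => x; case: (vP x).
have -> : copair d set_val \o v = copair d id \o w by apply/funext => x; case: (vP x).
by move=> H; exact: iff_sym.
Qed.

Lemma automorphism_U (A : set U) k (d d' : 'I_k -> U) : small kappa A ->
  (forall phi : formula L ('I_k + A), sat (copair d set_val) phi <-> sat (copair d' set_val) phi) ->
  exists s, [/\ automorphism s, forall x, A x -> s x = x & s \o d = d'].
Proof.
move=> As H; have Ps : smallT kappa ('I_k + A).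
  apply: (smallT_sum (st_limU S)); last exact: (smallE _ _).1 As.
  exact: (smallT_ord (smallT_nat (st_senU S))).
have [s [sA sE]] := homogeneous_family (st_homU S) (smallT_image _ Ps) H.
exists s; split=> //; last by apply/funext => i; exact: (sE (inl i)).
by move=> x Ax; exact: (sE (inr (exist _ x (mem_set Ax)))).
Qed.

Section InvExt.
Variables (n m : nat) (p : set (formula L ('I_n + U))).
Hypothesis pS : Sinv kappa p.
Variable b : 'I_m -> V.
Local Notation i := (copair b e).

(** The finitely many parameters are copied into [U] over [A], where [p] decides. Those already in
    [U] are added to [A] and so stay in place. *)
Lemma inv_ext_total (u0 : U) chi : inv_ext kappa e p i chi \/ inv_ext kappa e p i (Neg chi).
Proof.
have [[_ ptot] [A As Ainv]] := pS.
have [k [phi [w ->]]] := split_support (inr u0 : 'I_m + U) chi.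
pose us : seq U := pmap (fun j => if w j is inr u then Some u else None) (enum 'I_k).
have A's : small kappa (A `|` [set u | List.In u us]).
  by apply: (small_setU (st_limU S)) => //; exact: (small_seq (st_limU S) (smallT_nat (st_senU S))).
have usP j u : w j = inr u -> List.In u us.
  move=> E; have : j \in enum 'I_k by rewrite mem_enum.
  rewrite /us; elim: (enum 'I_k) => //= l s IH; rewrite inE => /orP[/eqP <-|/IH H].
    by rewrite E; left.
  by case: (w l) => [//|u']; right.
have [d dP] := realise_over b A's.
have typ : tp (emb_in e (A := A)) (e \o (copair d id \o w)) = tp (emb_in e (A := A)) (i \o w).
  apply/funext => psi; apply/propext; rewrite /tp /=.
  pose v (t : 'I_k + A) : 'I_m + U := match t with inl j => w j | inr x => inr (set_val x) end.
  have := dP _ v _ psi.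
  have -> : copair b e \o v = copair (i \o w) (emb_in e (A := A)) by apply/funext => -[].
  have -> : sat (copair d id \o v) psi = sat (copair (e \o (copair d id \o w)) (emb_in e (A := A))) psi.
    apply/propext; apply: (iff_trans (eE psi _)).
    by have -> : e \o (copair d id \o v) = copair (e \o (copair d id \o w)) (emb_in e (A := A))
      by apply/funext => -[].
  apply=> -[j|x] u /= E; first by right; exact: usP E.
  by left; case: E => <-; exact: set_valP.
have inv ch : p (rename (copair inl (inr \o (copair d id \o w))) ch) ->
    inv_ext kappa e p i (rename (copair inl (inr \o w)) ch).
  by move=> H; exists A; split=> //; exists k, ch, w, (copair d id \o w).
have [H|H] := ptot (rename (copair inl (inr \o (copair d id \o w))) phi).
  by left; exact: inv.
by right; exact: (inv (Neg phi)).
Qed.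

Lemma inv_ext_incl (u0 : U) phi : p phi -> inv_ext kappa e p i (rename (copair inl (inr \o inr)) phi).
Proof.
have [_ [A As Ainv]] := pS; have [k [psi [w ->]]] := split_support u0 phi => Hp.
exists A; split=> //; exists k, psi, (inr \o w), w; split=> //.
by rewrite rename_comp; apply: eq_rename => -[].
Qed.

(** Each formula comes with its own invariance set and its own copies of the parameters in [U]. All
    parameters are copied anew, simultaneously, over the union of these sets; invariance moves each
    formula to the common copy, where [p] is finitely satisfiable. *)
Lemma inv_ext_finite k (chi : 'I_k -> formula L ('I_n + ('I_m + U))) :
  (forall j, inv_ext kappa e p i (chi j)) -> exists a : 'I_n -> V, forall j, sat (copair a i) (chi j).
Proof.
move=> H; have [[pfin _] _] := pS.
pose data := (set U * {l : nat & (formula L ('I_n + 'I_l) * ('I_l -> 'I_m + U) * ('I_l -> U))%type})%type.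
have /choice[F FP] (j : 'I_k) : exists t : data,
    [/\ small kappa t.1, invariant_over t.1 p,
        chi j = rename (copair inl (inr \o (projT2 t.2).1.2)) (projT2 t.2).1.1,
        tp (emb_in e (A := t.1)) (e \o (projT2 t.2).2) = tp (emb_in e (A := t.1)) (i \o (projT2 t.2).1.2) &
        p (rename (copair inl (inr \o (projT2 t.2).2)) (projT2 t.2).1.1)].
  have [A [As Ainv [l [phi [w [d [E1 E2 E3]]]]]]] := H j.
  by exists (A, existT _ l (phi, w, d)).
pose l j := projT1 (F j).2; pose phi j : formula L ('I_n + 'I_(l j)) := (projT2 (F j).2).1.1.
pose w j : 'I_(l j) -> 'I_m + U := (projT2 (F j).2).1.2.
pose d j : 'I_(l j) -> U := (projT2 (F j).2).2.
pose A : set U := [set x | exists j, (F j).1 x] `|` [set u | exists j, exists t, w j t = inr u].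
have natU := smallT_nat (st_senU S).
have As : small kappa A.
  apply: (small_setU (st_limU S)).
    by apply: small_finite_union => j; case: (FP j).
  apply: small_finite_union => j.
  apply: (small_rel (R := fun t u => w j t = inr u) (smallT_ord natU (l j))) => [t x y -> []//|x [t Et]].
  by exists t.
have [c cP] := realise_over b As.
have good j : p (rename (copair inl (inr \o (copair c id \o w j))) (phi j)).
  have [Fs Finv _ Ftp Fp] := FP j.
  have [|s [sA sfix sd]] := @automorphism_U (F j).1 (l j) (d j) (copair c id \o w j) Fs.
    move=> psi.
    pose v (t : 'I_(l j) + (F j).1) : 'I_m + U := match t with inl x => w j x | inr x => inr (set_val x) end.
    have /(cP _ v) : forall x u, v x = inr u -> A u.
      move=> [x|x] u /= E; first by right; exists j, x.
      by left; exists j; case: E => <-; exact: set_valP.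
    move=> /(_ psi); have -> : copair c id \o v = copair (copair c id \o w j) set_val by apply/funext => -[].
    move=> ->; have -> : copair b e \o v = copair (i \o w j) (emb_in e (A := (F j).1)) by apply/funext => -[].
    have := congr1 (fun T => T psi) Ftp; rewrite /tp /= -/(w j) => <-.
    by rewrite (eE psi _); have -> : e \o copair (d j) set_val = copair (e \o (projT2 (F j).2).2) (emb_in e (A := (F j).1))
      by apply/funext => -[].
  have := (Finv s sA sfix _).1 Fp; rewrite rename_comp.
  rewrite (eq_rename (g := copair inl (inr \o (copair c id \o w j)))) //.
  by rewrite -sd => -[].
have [a aP] := pfin _ _ good.
pose X := {j : 'I_k & 'I_(l j)}.
have [xi xiE] := conj_formula (fun j => rename (copair inl (inr \o (fun t => existT _ j t : X))) (phi j)).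
have [ch chE] := ex_formula xi.
pose v (x : X) : 'I_m + U := w (projT1 x) (projT2 x).
have /(cP _ v)/(_ ch) : forall x u, v x = inr u -> A u.
  by move=> [j t] u E; right; exists j, t.
rewrite !chE => -[+ _].
case=> [|a' /xiE Ha'].
  exists a; apply/xiE => j; rewrite sat_rename; have := aP j; rewrite sat_rename.
  by congr sat; apply/funext => -[].
exists a' => j; have [_ _ -> _ _] := FP j; have := Ha' j; rewrite !sat_rename.
by congr sat; apply/funext => -[].
Qed.

Lemma inv_ext_realised : exists a : 'I_n -> V, forall chi, inv_ext kappa e p i chi -> sat (copair a i) chi.
Proof.
apply: (saturated_family (st_satV S)); last exact: inv_ext_finite.
apply: smallT_image; apply: (smallT_sum (st_limV S)); last exact: st_small S.
exact: (smallT_ord (natV S)).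
Qed.

End InvExt.

Lemma sat_subst_right n m (a : 'I_n -> V) (b : 'I_m -> V) (chi : formula L ('I_(n + m) + U)) :
  sat (copair a (copair b e)) (subst_right chi) = sat (copair (tcat a b) e) chi.
Proof.
rewrite /subst_right sat_rename; congr sat; apply/funext => -[i|u] //=.
by rewrite /tcat; case: (fintype.split i).
Qed.

(** When the two types leave a single completion, the tensor product must be it, so it can be read
    off any pair of realisations. *)
Lemma tensor_tp n m (p : set (formula L ('I_n + U))) (a0 : 'I_n -> V) (b0 : 'I_m -> V) :
  Sinv kappa p -> 
  (forall a b, realises e a p -> realises e b (tp e b0) -> tp e (tcat a b) = tp e (tcat a0 b0)) ->
  tensor kappa e p (tp e b0) = tp e (tcat a0 b0).
Proof.
move=> pS uni; have [u0 _] := emb_zero eE.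
have ext b : realises e b (tp e b0) -> exists a, (forall chi, inv_ext kappa e p (copair b e) chi ->
    sat (copair a (copair b e)) chi) /\ tp e (tcat a b) = tp e (tcat a0 b0).
  move=> Hb; have [a Ha] := inv_ext_realised pS b; exists a; split=> //; apply: uni => // phi Hphi.
  have := Ha _ (inv_ext_incl pS b u0 Hphi); rewrite sat_rename.
  by congr sat; apply/funext => -[].
apply/seteqP; split=> chi.
  move=> [b Hb Hchi]; have [a [Ha <-]] := ext b Hb.
  by have := Ha _ Hchi; rewrite sat_subst_right.
move=> Hchi; have Hb : realises e b0 (tp e b0) by [].
exists b0 => //; have [//|Hn] := inv_ext_total pS b0 u0 (subst_right chi).
have [a [Ha Ea]] := ext b0 Hb; have /= := Ha _ Hn.
by rewrite sat_subst_right -[sat _ _]/(tp e (tcat a b0) chi) Ea.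
Qed.

End Tensor.

Lemma tcat_lshift n m (T : Type) (a : 'I_n -> T) (b : 'I_m -> T) i : tcat a b (lshift m i) = a i.
Proof. by rewrite /tcat -[lshift m i]/(unsplit (inl i)) unsplitK. Qed.

Lemma tcat_rshift n m (T : Type) (a : 'I_n -> T) (b : 'I_m -> T) i : tcat a b (rshift n i) = b i.
Proof. by rewrite /tcat -[rshift n i]/(unsplit (inr i)) unsplitK. Qed.

Lemma tcat_shift n m (T : Type) (c : 'I_(n + m) -> T) :
  tcat (c \o @lshift n m) (c \o @rshift n m) = c.
Proof.
by apply/funext => i; rewrite -(splitK i); case: (fintype.split i) => j /=;
  rewrite ?tcat_lshift ?tcat_rshift.
Qed.

Lemma tcat_comp n m (T T' : Type) (s : T -> T') (a : 'I_n -> T) (b : 'I_m -> T) :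
  s \o tcat a b = tcat (s \o a) (s \o b).
Proof. by apply/funext => i; rewrite /tcat /=; case: (fintype.split i). Qed.

(** [definable_function] asks for a value at every tuple, while [phi j] may define a point at some
    tuples only. The value is set to 0 where there is no unique solution. *)
Lemma total_function (L : og_language) (P : Type) n m (phi : 'I_m -> formula L ('I_1 + ('I_n + P))) :
  exists tau : formula L ('I_(n + m) + P), forall (M : structure L) (v : P -> M)
    (x : 'I_n -> M) (y : 'I_m -> M), sat (copair (tcat x y) v) tau <-> forall j,
    let Q z := sat (copair (fun=> z) (copair x v)) (phi j) in
    ((exists z, forall z', Q z' <-> z' = z) -> Q (y j)) /\
    (~ (exists z, forall z', Q z' <-> z' = z) -> y j = ozero M).
Proof.
pose X : Type := ('I_(n + m) + P)%type.
pose up (o : 'I_n + P) : X := match o with inl i => inl (lshift m i) | inr u => inr u end.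
pose ra (o : 'I_1 + ('I_n + P)) : option (option X) :=
  if o is inr t then Some (Some (up t)) else None.
pose E j : formula L X := FEx (All (FAnd (Imp (rename ra (phi j)) (Eq (Var L None) (Var L (Some None))))
  (Imp (Eq (Var L None) (Var L (Some None))) (rename ra (phi j))))).
pose rb j (o : 'I_1 + ('I_n + P)) : X := if o is inr t then up t else inl (rshift n j).
have [tau tauE] := conj_formula (fun j => FAnd (Imp (E j) (rename (rb j) (phi j)))
  (Imp (Neg (E j)) (Eq (Var L (inl (rshift n j))) (App (zero_sym L) (fun i => ord0_elim _ i))))).
exists tau => M v x y.
have upE w : copair (tcat x y) v (up w) = copair x v w.
  by case: w => //= i; rewrite tcat_lshift.
have Ezero : (fun i => eval (copair (tcat x y) v) (ord0_elim (term L X) i)) = tnth [tuple] by exact: ord0_fun.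
have EE j : sat (copair (tcat x y) v) (E j) <->
    exists z, forall z', sat (copair (fun=> z') (copair x v)) (phi j) <-> z' = z.
  rewrite /E sat_Ex.
  have Er z z' : sat (oapp (oapp (copair (tcat x y) v) z) z') (rename ra (phi j)) =
      sat (copair (fun=> z') (copair x v)) (phi j).
    by rewrite sat_rename; congr sat; apply/funext => -[//|t] /=; rewrite upE.
  have Es z z' : sat (oapp (oapp (copair (tcat x y) v) z) z')
      (FAnd (Imp (rename ra (phi j)) (Eq (Var L None) (Var L (Some None))))
            (Imp (Eq (Var L None) (Var L (Some None))) (rename ra (phi j)))) <->
      (sat (copair (fun=> z') (copair x v)) (phi j) <-> z' = z).
    by rewrite sat_And -(Er z) /=; tauto.
  by split=> -[z Hz]; exists z => z'; apply/Es; exact: Hz.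
have Eb j : sat (copair (tcat x y) v) (rename (rb j) (phi j)) =
    sat (copair (fun=> y j) (copair x v)) (phi j).
  by rewrite sat_rename; congr sat; apply/funext => -[k|t] /=; [rewrite tcat_rshift|rewrite upE].
have sat_Imp (Y : Type) (w : Y -> M) A B : sat w (Imp A B) = (sat w A -> sat w B) by [].
have F j : sat (copair (tcat x y) v) (FAnd (Imp (E j) (rename (rb j) (phi j)))
    (Imp (Neg (E j)) (Eq (Var L (inl (rshift n j))) (App (zero_sym L) (fun i => ord0_elim _ i))))) <->
    (sat (copair (tcat x y) v) (E j) -> sat (copair (fun=> y j) (copair x v)) (phi j)) /\
    (~ sat (copair (tcat x y) v) (E j) -> y j = ozero M).
  rewrite sat_And !sat_Imp Eb /=.
  by rewrite tcat_rshift Ezero.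
rewrite tauE; split=> H j; have := H j; rewrite F EE; exact.
Qed.

(** * Products of unlinked types and the small side of a cut *)

Section Sides.
Variables (L : og_language) (kappa kappa' : Type) (U V : structure L) (e : U -> V).
Hypothesis S : setting kappa kappa' e.
Local Open Scope og_scope.
Implicit Types x y z d g h : V.
Local Notation gV := (st_gV S).
Local Notation eE := (st_emb S).
Local Notation base := (base e).
Local Notation ceq := (ceq e).
Local Notation tower := (tower e).
Local Notation auto_U := (auto_U e).

(** Each tensor step is computed by [tensor_tp]; the uniqueness it asks for is [align] for the whole
    tuple. *)
Lemma tensor_seq_tp (ps : seq (set (formula L ('I_1 + U)))) (c x g : 'I_(size ps) -> V)
    (b : 'I_(size ps) -> bool) :
  (forall i, Sinv kappa (tnth (in_tuple ps) i)) ->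
  (forall i, tnth (in_tuple ps) i = tp e (fun _ : 'I_1 => c i)) ->
  (forall i, base (x i)) -> (forall i, isolated base (g i)) ->
  (forall i, c i = affine (b i) (x i) (g i)) ->
  (forall i j, i != j -> ~ linked e (g i) (g j)) ->
  tensor_seq kappa e ps = tp e c.
Proof.
elim: ps c x g b => [|p ps IH] c x g b pS pE Bx ig cE N.
  apply/seteqP; rewrite /= /empty_product; split=> phi.
    move=> /(_ (fun i => ord0_elim _ i)); rewrite -[tp _ _ _]/(sat _ _).
    by rewrite (eE phi _); congr sat; apply/funext => -[[]|].
  move=> H a; apply/eE; move: H; rewrite /tp /=; congr sat.
  by apply/funext => -[[]|].
have tE (i : 'I_(size ps)) : tnth (in_tuple (p :: ps)) (rshift 1 i) = tnth (in_tuple ps) i.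
  by rewrite !(tnth_nth p).
have tE0 : tnth (in_tuple (p :: ps)) (@lshift 1 (size ps) ord0) = p by rewrite (tnth_nth p).
have IHs : tensor_seq kappa e ps = tp e (c \o @rshift 1 (size ps)).
  apply: (IH _ (x \o @rshift 1 (size ps)) (g \o @rshift 1 (size ps)) (b \o @rshift 1 (size ps))) => i.
  - by rewrite -tE.
  - by rewrite -tE pE.
  - exact: Bx.
  - exact: ig.
  - exact: cE.
  - by move=> j ij; apply: N; apply: contraNneq ij => /(@rshift_inj 1 (size ps)) ->.
rewrite /= IHs -[in RHS](tcat_shift (n := 1) (m := size ps) c).
apply: (@tensor_tp _ _ _ _ _ _ S 1 (size ps) p (c \o @lshift 1 (size ps)) (c \o @rshift 1 (size ps))).
  by rewrite -tE0.
move=> a d Ha Hd.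
have [s [sU sE]] : exists s, auto_U s /\ forall i, s (tcat a d i) = c i.
  apply: (align S (c' := tcat a d) Bx ig cE _ N) => i.
  rewrite -(splitK i); case: (fintype.split i) => j /=.
    rewrite tcat_lshift (ord1 j); apply: (tp_ceq S); rewrite -(const1 a) -pE tE0.
    move: Ha; rewrite -tE0 pE => Ha; exact: esym (realises_tp S Ha).
  rewrite tcat_rshift; have [t [tU <-]] := tp_eq_auto S (realises_tp S Hd).
  by apply: ceq_sym; exact: auto_U_ceq.
rewrite -(tp_auto (tcat a d) sU) tcat_shift; congr (tp e _).
by apply/funext.
Qed.

Definition lts (s : bool) x y : Prop := if s then x < y else y < x.

(* The cut of [c] over [U] has small cofinality on the left ([s = true]) or small
   coinitiality on the right ([s = false]). *)
Definition small_side (s : bool) c : Prop := exists C : set U, [/\ small kappa C,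
  forall u, C u -> lts s (e u) c &
  forall u, lts s (e u) c -> exists u', C u' /\ ~ lts s (e u') (e u)].

Lemma small_side_exists c : left_small kappa e c \/ right_small kappa e c -> exists s, small_side s c.
Proof. by move=> [H|H]; [exists true|exists false]. Qed.

Lemma lts_affine s b x g h : lts (if b then s else ~~ s) (affine b x g) (affine b x h) <-> lts s g h.
Proof. by rewrite /lts /affine; case: b; case: s => /=; split=> ?; oag. Qed.

Lemma lts_total s x y : [\/ lts s x y, x = y | lts s y x].
Proof.
by rewrite /lts; case: s; case: (olt_total gV x y) => ?;
  [exact: Or31|exact: Or32|exact: Or33|exact: Or33|exact: Or32|exact: Or31].
Qed.

Lemma lts_trans s x y z : lts s x y -> lts s y z -> lts s x z.
Proof. by rewrite /lts; case: s => H H'; [exact: (olt_trans gV H H')|exact: (olt_trans gV H' H)]. Qed.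

Lemma ltsxx s x : ~ lts s x x.
Proof. by rewrite /lts; case: s; exact: (oltxx gV). Qed.

Lemma lts_nlts s x y z : lts s x z -> ~ lts s x y -> lts s y z.
Proof. by rewrite /lts; case: s => ? ?; oag. Qed.

Lemma lts_auto s (t : V -> V) x y : automorphism t -> lts s (t x) (t y) <-> lts s x y.
Proof. by move=> tA; rewrite /lts; case: s; rewrite (automorphism_lt _ _ tA). Qed.

Lemma lts_ceq s x y u : ceq x y -> (lts s (e u) x <-> lts s (e u) y) /\ (lts s x (e u) <-> lts s y (e u)).
Proof. by move=> /(_ u); rewrite /lts; case: s; tauto. Qed.

Lemma ceq_lts s x y : ~ base x -> (forall u, lts s (e u) x -> lts s (e u) y) ->
  (forall u, lts s x (e u) -> lts s y (e u)) -> ceq x y.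
Proof.
move=> nx H1 H2 u; have := H1 u; have := H2 u; rewrite /lts.
have ux : e u <> x by move=> E; apply: nx; exists u.
have asym := fun a b (h1 : a < b) (h2 : b < a) => oltxx gV (olt_trans gV h1 h2).
have := asym (e u) x; have := asym (e u) y; have := oltxx gV (x := y).
have [ux'|/ux//|ux'] := olt_total gV (e u) x; case: (s); tauto.
Qed.

End Sides.

(** * Extremal representatives *)

Section Extremal.
Variables (L : og_language) (kappa kappa' : Type) (U V : structure L) (e : U -> V).
Hypothesis S : setting kappa kappa' e.
Local Open Scope og_scope.
Implicit Types x y z d g h : V.
Local Notation gV := (st_gV S).
Local Notation eE := (st_emb S).
Local Notation base := (base e).
Local Notation ceq := (ceq e).
Local Notation tower := (tower e).
Local Notation auto_U := (auto_U e).
Local Notation small_side := (small_side kappa e).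

Lemma small_side_affine s b x g : base x -> small_side s g ->
  small_side (if b then s else ~~ s) (affine b x g).
Proof.
move=> Bx [C [Cs Cg Ccof]].
have [x' [Bx' x'K]] : exists x', base x' /\ forall y, affine b x (affine b x' y) = y.
  exists (if b then - x else x); split; first by case: (b) => //; exact: (baseN S).
  by move=> y; rewrite /affine; case: (b); oag.
have aff_base z z' : base z -> base z' -> base (affine b z z').
  move=> Bz Bz'; rewrite /affine; case: (b); apply: (baseD S) => //; exact: (baseN S).
have Bu u : base (e u) by exists u.
exists [set u | exists w, C w /\ e u = affine b x (e w)]; split.
- apply: (@small_rel _ _ (C : Type) _ (fun t u => e u = affine b x (e (set_val t)))).
  + exact: (smallE _ _).1 Cs.
  + by move=> t u w Eu Ew; apply: (elementary_inj eE); rewrite Eu.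
  + by move=> u [w [Cw Eu]]; exists (exist _ w (mem_set Cw)).
- by move=> u [w [/Cg cw ->]]; apply/(lts_affine S).
- move=> u; have [w Ew] := aff_base _ _ Bx' (Bu u); rewrite -(x'K (e u)) -Ew => /(lts_affine S) wg.
  have [w' [Cw' Hw']] := Ccof _ wg; have [u' Eu'] := aff_base _ _ Bx (Bu w').
  by exists u'; split; [exists w'|rewrite Eu' => /(lts_affine S)].
Qed.

Lemma increasing_ceq D f x y : pend D f -> increasing D f -> D x -> D y -> ceq (f x) (f y) -> ceq x y.
Proof.
move=> pf fI Dx Dy /(ceq_auto S)[s [sU Es]]; have [Dsx Esx] := automorphism_pend sU.1 pf Dx.
have <- : s x = y by apply: (increasing_inj gV pf fI) => //; rewrite Esx.
exact: auto_U_ceq.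
Qed.

(* Up to maps preserving the cut of [c], [g] is the element of that cut in the tower
   which is farthest away from its small side. *)
Definition extremal s c g l : Prop := forall h, tower l h -> ceq h c ->
  exists D k, [/\ pend D k, increasing D k, D h, ceq (k h) c & ~ lts s g (k h)].

(** [extremal] moves [h], not [g]. For a small right side the minimum has this form at once; for a
    small left side the map taking the maximum above [h] has to be inverted. *)
Lemma extremal_exists s c l : isolated base c -> (exists g, tower l g /\ ceq g c) ->
  exists g, [/\ tower l g, ceq g c & extremal s c g l].
Proof.
move=> ic ex; case: s.
  have [m [Tm mc Hm]] := extremal_max S ic ex; exists m; split=> // h Th hc.
  have [D [f [pf fI Dm fmc hfm]]] := Hm h Th hc.
  have h0 : 0 < h by have [] := isolated_ceq S ic (ceq_sym hc).
  have m0 : 0 < m by have [] := isolated_ceq S ic (ceq_sym mc).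
  have pg := pend_inverse gV pf fI; have gI := inverse_increasing gV pf fI.
  have Dfm : image_dom D f (f m) by exists m.
  have Dh : image_dom D f h by apply: (pend_conv pg Dfm); oag.
  have gfm : inverse D f (f m) = m by exact: (inverseK gV pf fI).
  have cE : ceq (inverse D f h) m.
    rewrite -gfm; have [s [sU Es]] := ceq_auto S (ceq_trans hc (ceq_sym fmc)).
    have [_ Esh] := automorphism_pend sU.1 pg Dh; rewrite -Es Esh; exact: auto_U_ceq.
  exists (image_dom D f), (inverse D f); split=> //; first exact: ceq_trans cE mc.
  rewrite /lts -{1}gfm => H; apply: (oltxx gV (x := h)).
  have : f m < h by apply/(increasing_ltE gV pg gI Dfm Dh).
  by move=> ?; oag.
by have [m [Tm mc Hm]] := extremal_min S ic ex; exists m.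
Qed.

(** [h] is trapped between [C], cofinal in the small side, and [g]; both are fixed by [t], so [t h]
    is trapped in the same cut. *)
Lemma side_stable s (C : set U) c g h (t : V -> V) :
  ~ base c -> (forall u, C u -> lts s (e u) c) ->
  (forall u, lts s (e u) c -> exists u', C u' /\ ~ lts s (e u') (e u)) ->
  ceq g c -> ceq h c -> ~ lts s g h -> automorphism t ->
  (forall u, C u -> t (e u) = e u) -> t g = g -> ceq (t h) c.
Proof.
move=> nc Cc Ccof gc hc gh tA tC tg; apply: ceq_sym; apply: (@ceq_lts _ _ _ _ _ _ S s) => // u.
  move=> /Ccof[u' [Cu' H]]; have := (lts_ceq s u' hc).1.2 (Cc _ Cu').
  by rewrite -(lts_auto s (e u') h tA) tC // => H'; exact: (lts_nlts S H' H).
move=> /(lts_ceq s u gc).2.2 gu; have gth : ~ lts s g (t h) by rewrite -tg (lts_auto s _ _ tA).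
by have [//|<-//|H] := lts_total S s g (t h); exact: (lts_trans S H gu).
Qed.

End Extremal.

(** * Failure of the tensor condition; types determined by few cuts *)

Section Determination.
Variables (L : og_language) (kappa kappa' : Type) (U V : structure L) (e : U -> V).
Hypothesis S : setting kappa kappa' e.
Local Open Scope og_scope.
Implicit Types x y z d g h : V.
Local Notation gV := (st_gV S).
Local Notation eE := (st_emb S).
Local Notation base := (base e).
Local Notation ceq := (ceq e).
Local Notation tower := (tower e).
Local Notation auto_U := (auto_U e).
Local Notation small_side := (small_side kappa e).

Lemma auto_fixed_base z : (forall t, auto_U t -> t z = z) -> base z.
Proof.
move=> H; apply: contrapT => nz.
have [x [zx sc]] := same_cut_above (st_gV S) (st_limV S) (st_senV S) (st_satV S) (base_closed S) (base_small S) nz.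
have [t [tA tB tz]] := small_closed_automorphism S (base_closed S) (base_small S) sc.
have : t z = z by apply: H; split=> // u; apply: tB; exists u.
by rewrite tz => E; rewrite E in zx; exact: (oltxx gV zx).
Qed.

Lemma Df_lts X s (a b : X) : Df (fun v : X -> V => lts s (v a) (v b)).
Proof. by rewrite /lts; case: s; exact: Df_lt. Qed.

(** If the type were the tensor product, its definition would replace [t0], up to conjugacy, by a
    point [v] of [U] strictly on the small side of [b i]. The cut of [b i] is invariant over [A],
    and a copy [d2] in [U] of the type of [t1] over [A] and [C] is conjugate to [v] over [A] but
    lies beyond [C], which is cofinal in that side. *)
Lemma not_tensor m (b : 'I_m -> V) (i : 'I_m) s c0 t0 :
  dcl (copair (fun _ : 'I_1 => c0) e) t0 -> ceq t0 (b i) -> ~ base (b i) -> small_side s (b i) ->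
  ~ lts s (b i) t0 ->
  tp e (tcat b (fun _ : 'I_1 => c0)) <> tensor kappa e (tp e b) (tp e (fun _ : 'I_1 => c0)).
Proof.
move=> [theta Htheta] tb nb [C [Cs CC Ccof]] nlt E.
(* [psi] says that the point defined from [c0] does not lie beyond coordinate [i] of the tuple. *)
have [psi Hpsi] : Df (fun v : 'I_(m + 1) + U -> V => exists z,
    sat (copair (fun=> z) (copair (fun _ : 'I_1 => v (inl (rshift m ord0))) (v \o inr))) theta /\
    ~ lts s (v (inl (lshift 1 i))) z).
  apply: Df_ex; apply: Df_and; last first.
    by apply: Df_not; exact: Df_lts.
  have [phi Hphi] := Df_subst V (None : option ('I_(m + 1) + U))
    (copair (fun _ : 'I_1 => Some (inl (rshift m ord0))) (Some \o inr)) theta.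
  exists phi => v; rewrite -Hphi /=; have -> // : copair (fun=> v (Some (inl (rshift m ord0)))) ((v \o Some) \o inr) =
    v \o copair (fun _ : 'I_1 => Some (inl (rshift m ord0))) (Some \o inr).
  by apply/funext => -[].
have psiE (y : 'I_m -> V) (z : V) t : (forall z', sat (copair (fun=> z') (copair (fun _ : 'I_1 => z) e)) theta <-> z' = t) ->
    sat (copair (tcat y (fun=> z)) e) psi <-> ~ lts s (y i) t.
  move=> Ht; rewrite -Hpsi /= tcat_rshift tcat_lshift; split; first by move=> [_ [/Ht ->]].
  by move=> nt; exists t; split=> //; apply/Ht.
have : tensor kappa e (tp e b) (tp e (fun _ : 'I_1 => c0)) psi.
  by rewrite -E; apply/(psiE _ _ t0).
move=> [b1 /(realises_tp S)/(tp_eq_auto S)[r [rU rb]]].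
move=> [A [As Ainv [k [phi [w [d [psiphi dw Hphi]]]]]]].
pose t1 := r t0.
have Ht1 z' : sat (copair (fun=> z') (copair b1 e)) theta <-> z' = t1.
  have [q [qU rK qK]] := auto_U_inv rU.
  have -> : sat (copair (fun=> z') (copair b1 e)) theta =
      sat (copair (fun=> q z') (copair (fun _ : 'I_1 => c0) e)) theta.
    rewrite -[RHS](automorphism_sat _ theta rU.1); congr sat; apply/funext => -[j|[j|u]] /=.
    - by rewrite qK.
    - by rewrite -rb.
    - by rewrite rU.2.
  by rewrite Htheta /t1; split=> [<-|->]; [rewrite qK|rewrite rK].
have phiE (y : 'I_m -> V) : sat (copair y (copair b1 e \o w)) phi <-> ~ lts s (y i) t1.
  rewrite -(psiE y (b1 ord0) t1); last by move=> z'; rewrite -(const1 b1).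
  rewrite -(const1 b1) -sat_subst_right psiphi sat_rename.
  by have -> : copair y (copair b1 e) \o copair inl (inr \o w) = copair y (copair b1 e \o w) by apply/funext => -[].
have As' : smallT kappa' A := smallT_inj (@val_inj _ _ _) (st_small S).
have [q [qA qE]] : exists q, automorphism q /\ forall x : 'I_k + A, q (copair (copair b1 e \o w) (emb_in e (A := A)) x) =
    copair (e \o d) (emb_in e (A := A)) x.
  apply: (family_automorphism S); first exact: (smallT_params S).
  move=> ch; by rewrite -[sat _ _]/(tp _ _ ch) -dw.
have qw : q \o (copair b1 e \o w) = e \o d by apply/funext => j; exact: (qE (inl j)).
have qa u : A u -> q (e u) = e u by move=> Au; exact: (qE (inr (exist _ u (mem_set Au)))).
have [q' [q'A qK q'K]] := automorphism_inv qA.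
have phiE' (y : 'I_m -> V) : sat (copair y (e \o d)) phi <-> ~ lts s (y i) (q t1).
  have -> : sat (copair y (e \o d)) phi = sat (copair (q' \o y) (copair b1 e \o w)) phi.
    rewrite -[RHS](automorphism_sat _ phi qA); congr sat; apply/funext => -[j|j] /=.
      by rewrite q'K.
    by rewrite -[LHS]/((e \o d) j) -qw.
  by rewrite phiE -(lts_auto s (q' (y i)) t1 qA) q'K.
(* The formula [phi] over [d] defines the cut at [q t1], so [q t1] is fixed by all automorphisms
   over [U]. *)
have [v Ev] : base (q t1).
  apply: auto_fixed_base => t tU.
  have H y : ~ lts s y (t (q t1)) <-> ~ lts s y (q t1).
    rewrite -(phiE' (fun=> y)); have [t' [t'U tK t'K]] := auto_U_inv tU.
    rewrite -{1}(t'K y) (lts_auto s _ _ tU.1) -(phiE' (fun=> t' y)).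
    rewrite -(automorphism_sat _ phi tU.1) //.
    have -> // : t \o copair (fun _ : 'I_m => t' y) (e \o d) = copair (fun=> y) (e \o d).
    by apply/funext => -[j|j] /=; rewrite ?t'K ?tU.2.
  have := lts_total S s (t (q t1)) (q t1); have := H (q t1); have := H (t (q t1)).
  have := @ltsxx _ _ _ _ _ _ S s (q t1); have := @ltsxx _ _ _ _ _ _ S s (t (q t1)).
  by move=> ? ? ? ? []; tauto.
have bv : lts s (e v) (b i).
  have nv : ~ lts s (b i) (e v).
    rewrite Ev; apply/phiE'; move: Hphi; rewrite /tp /= sat_rename.
    by have -> : copair b e \o copair inl (inr \o d) = copair b (e \o d) by apply/funext => -[].
  by have [//|E1|/nv//] := lts_total S s (e v) (b i); case: nb; exists v.
have t1b : ceq (b i) t1 := ceq_trans (ceq_sym tb) (auto_U_ceq t0 rU).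
have [d2 Hd2] := realise_over S (fun _ : 'I_1 => t1) (small_setU (st_limU S) As Cs).
have [lt Hlt] := Df_lts s true false.
have v2C u : C u -> lts s (e u) (e (d2 ord0)).
  move=> Cu; pose g (x : bool) : 'I_1 + U := if x then inr u else inl ord0.
  have E1 : e \o (copair d2 id \o g) = fun x : bool => if x then e u else e (d2 ord0) by apply/funext => -[].
  have E2 : copair (fun=> t1) e \o g = fun x : bool => if x then e u else t1 by apply/funext => -[].
  have : sat (copair d2 id \o g) lt.
    rewrite Hd2; last by case=> //= _ [<-]; right.
    by rewrite E2 -Hlt /=; apply: (lts_ceq s u t1b).1.1; exact: CC.
  by rewrite eE E1 -Hlt.
(* [v] and [d2] both have the type of [t1] over [A]: the first through [q], which fixes [A], the
   second by choice. *)
have [|q2 [q2A q2F q2E]] := @automorphism_U _ _ _ _ _ _ S A 1 (fun=> v) d2 As.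
  move=> ch; pose g := copair inl (inr \o set_val) : 'I_1 + A -> 'I_1 + U.
  have -> : copair d2 set_val = copair d2 id \o g by apply/funext => -[].
  rewrite Hd2; last by case=> //= x u [<-]; left; exact: set_valP.
  rewrite eE -(automorphism_sat (copair (fun=> t1) e \o g) ch qA).
  have -> // : q \o (copair (fun=> t1) e \o g) = e \o copair (fun=> v) set_val.
  by apply/funext => -[j|x] /=; rewrite ?Ev // qa //; exact: set_valP.
have [psi' Hpsi'] := Df_lts s (inr v : 'I_m + U) (inl i).
have := (Ainv q2 q2A q2F psi').1; rewrite /tp /= sat_rename.
have -> : copair b e \o copair inl (inr \o q2) = copair b (e \o q2) by apply/funext => -[].
rewrite -!Hpsi' /= => /(_ bv); have -> : q2 v = d2 ord0 by rewrite -q2E.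
by move=> /Ccof[u' [Cu' H]]; exact: (H (v2C _ Cu')).
Qed.
(** By [tower_split], the cut of [x] over the tower of [l] amounts to the cuts over [U] of [x - a]
    for [a] in a small set. Preserving these, and the parameters needed to fix each [a], preserves
    the type of the whole tuple over [U]. *)
Lemma tower_determined l : exists (Y : set V) (W : set U),
  [/\ small kappa Y, small kappa W, forall y, Y y -> tower l y &
  forall t, automorphism t -> (forall u, W u -> t (e u) = e u) -> (forall y, Y y -> ceq (t y) y) ->
  exists r, auto_U r /\ forall x, List.In x l -> r (t x) = x].
Proof.
have natU := smallT_nat (st_senU S).
elim: l => [|x l [Y [W [Ys Ws Yl H]]]].
  exists set0, set0; split=> //; try exact: small_sub (small_seq (st_limU S) natU [::]).
  by move=> t _ _ _; exists id; split=> //; exact: auto_U_id.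
have [A [As Al AE]] := tower_split S l.
have /choice[us usP] (a : A) : exists us : seq U, forall t : V -> V, automorphism t ->
    (forall u, List.In u us -> t (e u) = e u) -> (forall x, List.In x l -> t x = x) ->
    t (set_val a) = set_val a.
  by apply: (tower_support S); apply: Al; exact: set_valP.
have As' : smallT kappa A := (smallE _ _).1 As.
exists (Y `|` [set y | exists a, A a /\ y = x - a]), (W `|` [set u | exists a, List.In u (us a)]); split.
- apply: (small_setU (st_limU S) Ys).
  apply: (small_sub_range (f := fun a : A => x - set_val a) As') => y [a [Aa ->]].
  by exists (exist _ a (mem_set Aa)).
- by apply: (small_setU (st_limU S) Ws); exact: (small_bigseq (st_limU S) natU us As').
- move=> y [/Yl|[a [/Al Ta ->]]]; first exact: (tower_cons S).
  apply: (closed_add (tower_closed S (x :: l))); first by apply: (tower_in S); left.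
  by apply: (closed_opp gV (tower_closed S (x :: l))); exact: (tower_cons S).
move=> t tA tW tY; have [||r [rU rl]] := H t tA.
- by move=> u Wu; apply: tW; left.
- by move=> y Yy; apply: tY; left.
have rtA := automorphism_comp rU.1 tA.
have fixA a : A a -> r (t a) = a.
  move=> Aa; apply: (usP (exist _ a (mem_set Aa)) (r \o t)) => // u Hu /=.
  by rewrite tW ?rU.2 //; right; exists (exist _ a (mem_set Aa)).
(* The comparison of [x] with [e u + a] is that of [x - a] with [e u], which the hypothesis on [Y]
   preserves. *)
have [q [qA qT qx]] : exists q, [/\ automorphism q, forall y, tower l y -> q y = y & q (r (t x)) = x].
  apply: (small_closed_automorphism S (tower_closed S l) (tower_small S l)) => y _ [/AE[u [a [Aa ->]]] <-].
  have xa : ceq (t (x - a)) (x - a) by apply: tY; right; exists a.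
  have := ceq_trans (ceq_sym (auto_U_ceq (t (x - a)) rU)) xa u.
  rewrite (automorphism_add _ _ tA) (automorphism_opp _ gV tA) (automorphism_add _ _ rU.1).
  rewrite (automorphism_opp _ gV rU.1) (fixA _ Aa) => -[[? ?] [? ?]].
  have E1 z : (e u < z - a) <-> (e u + a < z) by split=> ?; oag.
  have E2 z : (z - a < e u) <-> (z < e u + a) by split=> ?; oag.
  by rewrite -!E1 -!E2.
exists (q \o r); split.
  apply: auto_U_comp => //; split=> // u; exact: (qT _ (closed_emb (tower_closed S l) u)).
by move=> y /= [<-//|Hy]; rewrite rl //; apply: qT; exact: (tower_in S).
Qed.
End Determination.

(** * The witness built from extremal representatives *)

Section Core.
Variables (L : og_language) (kappa kappa' : Type) (U V : structure L) (e : U -> V).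
Hypothesis S : setting kappa kappa' e.
Local Open Scope og_scope.
Implicit Types x y z d g h : V.
Local Notation gV := (st_gV S).
Local Notation eE := (st_emb S).
Local Notation base := (base e).
Local Notation ceq := (ceq e).
Local Notation tower := (tower e).
Local Notation auto_U := (auto_U e).
Local Notation small_side := (small_side kappa e).

Lemma realises_auto (A : set U) n (c c' : 'I_n -> V) :
  realises (@emb_in L U V e A) c' (tp (@emb_in L U V e A) c) ->
  exists t, [/\ automorphism t, forall u, A u -> t (e u) = e u & t \o c = c'].
Proof.
move=> H; have As' : smallT kappa' A := smallT_inj (@val_inj _ _ _) (st_small S).
have [|t [tA tE]] := @family_automorphism _ _ _ _ _ _ S _ (copair c (@emb_in L U V e A))
    (copair c' (@emb_in L U V e A)) (smallT_params S n As').
  move=> phi; split; first exact: H.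
  by move=> H'; apply: contrapT => N; exact: (H (Neg phi) N).
exists t; split=> //; last by apply/funext => i; exact: (tE (inl i)).
by move=> u Au; exact: (tE (inr (exist _ u (mem_set Au)))).
Qed.

Lemma auto_realises (A : set U) n r (c : 'I_n -> V) t :
  automorphism t -> (forall u, A u -> t (e u) = e u) ->
  realises (@emb_in L U V e A) c r -> realises (@emb_in L U V e A) (t \o c) r.
Proof.
move=> tA tU H phi /H; rewrite /tp /= -(automorphism_sat _ phi tA); congr sat.
by apply/funext => -[//|u] /=; apply: tU; exact: set_valP.
Qed.

Lemma dcl_automorphism P (i : P -> V) t z : automorphism t -> dcl i z -> dcl (t \o i) (t z).
Proof.
move=> tA [phi Hphi]; have [q [_ tK qK]] := automorphism_inv tA; exists phi => y.
rewrite -{1}(qK y) (_ : copair (fun=> t (q y)) (t \o i) = t \o copair (fun _ : 'I_1 => q y) i).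
  by rewrite (automorphism_sat _ _ tA) Hphi; split=> [<-|->].
by apply/funext => -[].
Qed.

Lemma tcat_inj_left n m (f f' : 'I_n -> V) (h h' : 'I_m -> V) : tcat f h = tcat f' h' -> f = f'.
Proof.
move=> E; apply/funext => j; have := congr1 (fun k => k (lshift m j)) E.
by rewrite /= !tcat_lshift.
Qed.

Lemma tcat_inj_right n m (f f' : 'I_n -> V) (h h' : 'I_m -> V) : tcat f h = tcat f' h' -> h = h'.
Proof.
move=> E; apply/funext => j; have := congr1 (fun k => k (rshift n j)) E.
by rewrite /= !tcat_rshift.
Qed.

Lemma realises_swap (A : set U) n m (f f' : 'I_n -> V) (h h' : 'I_m -> V) :
  realises (@emb_in L U V e A) (tcat h' f') (tp (@emb_in L U V e A) (tcat h f)) ->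
  realises (@emb_in L U V e A) (tcat f' h') (tp (@emb_in L U V e A) (tcat f h)).
Proof.
move=> /realises_auto[t [tA tfix]]; rewrite tcat_comp => E.
rewrite -(tcat_inj_left E) -(tcat_inj_right E) -tcat_comp.
exact: auto_realises.
Qed.


Variables (n : nat) (p : set (formula L ('I_n + U))) (a : 'I_n -> V).
Hypotheses (pS : Sinv kappa p) (ap : realises e a p).
Local Notation l := (map a (enum 'I_n)).

Lemma tower_normal_form y : tower l y -> ~ base y -> exists s x b g,
  [/\ base x, isolated base g, y = affine b x g, tower l g & small_side s y].
Proof.
move=> Ty ny; have yS := dcl_invariant S pS ap (tower_in_dcl S Ty).
have side := invariant_small_side S yS ny.
have [s ss] := small_side_exists side.
have [x [b [g [Bx ig E]]]] := normal_form S side ny.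
exists s, x, b, g; split=> //; apply: (affine_towerE S (b := b) Bx).
by rewrite /affine -E.
Qed.

Variables (m : nat) (x c : 'I_m -> V) (b : 'I_m -> bool).
Hypotheses (Bx : forall i, base (x i)) (ic : forall i, isolated base (c i))
  (Tc : forall i, tower l (c i))
  (cover : forall h, tower l h -> isolated base h -> exists i, linked e h (c i)).

Variables (s : 'I_m -> bool) (C : 'I_m -> set U) (g : 'I_m -> V).
Hypotheses (Cs : forall i, small kappa (C i)) (Cc : forall i u, C i u -> lts (s i) (e u) (c i))
  (Ccof : forall i u, lts (s i) (e u) (c i) -> exists u', C i u' /\ ~ lts (s i) (e u') (e u))
  (Tg : forall i, tower l (g i)) (gc : forall i, ceq (g i) (c i))
  (gext : forall i, extremal e (s i) (c i) (g i) l).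

Lemma extremal_image h : tower l h -> isolated base h -> exists i D k,
  [/\ pend D k, increasing D k, D h, ceq (k h) (c i) & ~ lts (s i) (g i) (k h)].
Proof.
move=> Th ih; have [i [D [f [pf fI Dh fh]]]] := cover Th ih.
have Tfh : tower l (f h) by exact: (closed_pend (tower_closed S l) pf).
have [D' [k [pk kI D'fh kc lt]]] := gext Tfh fh.
exists i, (fun z => D z /\ D' (f z)), (k \o f); split=> //; first exact: (pend_comp gV).
exact: increasing_comp.
Qed.

(** Outside [U], [y] is a translate of an isolated [h] up to sign, and some [k] takes [h] to the
    near side of [g i]. There [side_stable] keeps [k h] in its cut, and the cut of [h] follows since
    [k] is increasing. *)
Lemma controlled y : tower l y -> exists us : seq U, forall t, automorphism t ->
  (forall u, List.In u us -> t (e u) = e u) -> (forall i u, C i u -> t (e u) = e u) ->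
  (forall i, t (g i) = g i) -> ceq (t y) y.
Proof.
move=> Ty; have [[u <-]|ny] := pselect (base y).
  by exists [:: u] => t _ H _ _; rewrite H //; left.
have [_ [_ [b' [h [[u <-] ih Ey Th _]]]]] := tower_normal_form Ty ny.
have [i [D [k [pk kI Dh kc lt]]]] := extremal_image Th ih.
exists [:: u] => t tA tu tC tg; have tu' := tu u (or_introl erefl).
rewrite Ey (affine_auto S _ _ tA tu'); apply: (affine_ceq S); first by exists u.
have [Dth Eth] := automorphism_pend tA pk Dh.
apply: (increasing_ceq S pk kI Dth Dh); apply: ceq_trans (ceq_sym kc); rewrite Eth.
exact: (side_stable S (isolated_notin S (ic i)) (@Cc i) (@Ccof i) (gc i) kc lt tA (@tC i) (tg i)).
Qed.

(** The original realisations are replaced by ones with the same types over [U], built on the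
    extremal [g i]. *)
Definition rep i := affine (b i) (x i) (g i).

Lemma rep_dcl i : dcl (copair a e) (rep i).
Proof. by apply: (tower_in_dcl S); apply: (affine_tower S). Qed.

(** The isolated part of [z] is taken by some [k] to the near side of [g i]. Translating as in
    [rep i] gives an element definable over [U] and [z], in the cut of [rep i] and on its near side,
    so [not_tensor] applies. *)
Lemma extremality z : dcl (copair a e) z -> ~ base z ->
  tp e (tcat rep (fun _ : 'I_1 => z)) <> tensor kappa e (tp e rep) (tp e (fun _ : 'I_1 => z)).
Proof.
move=> dz nz; have Tz := dcl_tower S dz.
have [_ [y [b' [h [By ih Ez Th _]]]]] := tower_normal_form Tz nz.
have [i [D [k [pk kI Dh kc lt]]]] := extremal_image Th ih.
have rg : isolated base (g i) := isolated_ceq S (ic i) (ceq_sym (gc i)).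
apply: (@not_tensor _ _ _ _ _ _ S m rep i (if b i then s i else ~~ s i) z (affine (b i) (x i) (k h))).
- apply: (@tower_dcl _ _ _ _ _ _ S _ _ [:: z]).
  + by move=> u; exact: (dcl_self (copair (fun _ : 'I_1 => z) e) (inr u)).
  + by move=> _ [<-|//]; exact: (dcl_self (copair (fun _ : 'I_1 => z) e) (inl ord0)).
  + apply: (affine_tower S) => //; apply: (closed_pend (tower_closed S _) pk) => //.
    by apply: (affine_towerE S (b := b') By); rewrite -Ez; apply: (tower_in S); left.
- apply: (affine_ceq S) => //; apply: ceq_trans kc (ceq_sym (gc i)).
- move=> Br; apply: (isolated_notin S rg); exact: (affine_towerE S (b := b i) (s := [::]) (Bx i) Br).
- apply: (small_side_affine S) => //; exists (C i); split=> // u.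
    by move=> Cu; apply: (lts_ceq (s i) u (gc i)).1.2; exact: Cc.
  by move=> /(lts_ceq (s i) u (gc i)).1.1; exact: Ccof.
- by move=> /(lts_affine S).
Qed.

(** The parameters of the definable function are exposed as a finite family [w], so that they can be
    put into the parameter set of the witness. *)
Lemma rep_function : exists k (phi : formula L ('I_(n + m) + 'I_k)) (w : 'I_k -> U),
  definable_function (rename (copair inl (inr \o w)) phi) /\
  sat (copair (tcat a rep) e) (rename (copair inl (inr \o w)) phi).
Proof.
have /choice[theta Ht] := rep_dcl; have [u0 _] := emb_zero eE.
have [tau tauE] := total_function theta.
have [k [phi [w E]]] := split_support u0 tau; exists k, phi, w; rewrite -E; split.
  move=> x'; pose Q j (z : U) := sat (copair (fun=> z) (copair x' id)) (theta j).
  pose uniq j := exists z : U, forall z' : U, Q j z' <-> z' = z.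
  have /choice[y yP] (j : 'I_m) : exists y : U, (uniq j -> Q j y) /\ (~ uniq j -> y = ozero U).
    have [[z Hz]|N] := pselect (uniq j); last by exists (ozero U).
    by exists z; split=> [_|[]]; [exact/Hz|exists z].
  exists y; split; first by apply/tauE => j; exact: yP.
  move=> y' /tauE Hy'; apply/funext => j; have [y1 y2] := Hy' j; have [y3 y4] := yP j.
  have [Hu|N] := pselect (uniq j); last by rewrite (y2 N) (y4 N).
  by have [z Hz] := Hu; have /Hz -> := y1 Hu; have /Hz -> := y3 Hu.
apply/tauE => j; split=> [_|[]]; first exact/Ht.
by exists (rep j) => z; exact: Ht.
Qed.

Lemma witness_set (B : set U) : small kappa B -> exists A : set U, [/\ small kappa A, B `<=` A,
  (forall t, automorphism t -> (forall u, A u -> t (e u) = e u) -> (forall j, t (a j) = a j) ->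
     forall i, t (rep i) = rep i) &
  (forall t, automorphism t -> (forall u, A u -> t (e u) = e u) -> (forall i, t (rep i) = rep i) ->
     exists r, auto_U r /\ forall j, r (t (a j)) = a j)].
Proof.
move=> Bs; have natU := smallT_nat (st_senU S); have limU := st_limU S.
have [Y [W [Ys Ws Yl H]]] := tower_determined S l.
have /choice[us usP] (y : Y) : exists us : seq U, forall t, automorphism t ->
    (forall u, List.In u us -> t (e u) = e u) -> (forall i u, C i u -> t (e u) = e u) ->
    (forall i, t (g i) = g i) -> ceq (t (set_val y)) (set_val y).
  by apply: controlled; apply: Yl; exact: set_valP.
have /choice[ws wsP] (i : 'I_m) : exists ws : seq U, forall t : V -> V, automorphism t ->
    (forall u, List.In u ws -> t (e u) = e u) -> (forall y, List.In y l -> t y = y) -> t (rep i) = rep i.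
  by apply: (tower_support S); apply: (affine_tower S).
have /choice[ux uxE] := Bx.
(* [W], the [us y] and the [C i] keep the cuts that determine [a]; the [ws i] make [rep] definable
   from [a]; the [ux i] recover [g i] from [rep i]. *)
pose A := B `|` W `|` [set u | exists y : Y, List.In u (us y)] `|` [set u | exists i, C i u] `|`
  [set u | exists i, List.In u (ws i)] `|` range ux.
have AB u : B u -> A u by move=> ?; do 5 left.
have AW u : W u -> A u by move=> ?; do 4 left; right.
have Aus (y : Y) u : List.In u (us y) -> A u by move=> ?; do 3 left; right; exists y.
have AC i u : C i u -> A u by move=> ?; do 2 left; right; exists i.
have Aws i u : List.In u (ws i) -> A u by move=> ?; left; right; exists i.
have Aux i : A (ux i) by right; exists i.
exists A; split=> //.
- have ordU := smallT_ord (natU).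
  do 5?[apply: (small_setU limU)] => //.
  + exact: (small_bigseq limU natU us ((smallE _ _).1 Ys)).
  + exact: (small_finite_union S).
  + exact: (small_bigseq limU natU ws (ordU m)).
  + exact: (smallT_image _ (ordU m)).
- move=> t tA tfix ta i; apply: wsP => // [u Hu|y]; first exact: tfix (Aws _ _ Hu).
  exact: (ord_forall_seq a (fun y => t y = y)).2.
- move=> t tA tfix trep.
  have tg i : t (g i) = g i.
    apply: (@affine_inj _ _ _ _ _ _ S (b i) (x i)).
    by rewrite -(affine_auto S _ _ tA) ?trep // -uxE tfix.
  have [|y Yy|r [rU rl]] := H t tA; first by move=> u /AW; exact: tfix.
    apply: (usP (exist _ y (mem_set Yy))) => // [u /Aus|i u /AC]; exact: tfix.
  by exists r; split=> // j; exact: (ord_forall_seq a (fun y => r (t y) = y)).1.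
Qed.

Lemma pE : p = tp e a.
Proof. exact: (complete_realised pS.1 ap). Qed.

Lemma rep_witness : exists (A : set U) (r : set (formula L ('I_(n + m) + A))),
  extremal_equiv_witness kappa e p (tp e rep) r /\ dominates kappa e (tp e rep) p.
Proof.
have [k [phi [w [taufun tausat]]]] := rep_function.
have ws : small kappa (range w).
  exact: (smallT_image _ (smallT_ord (smallT_nat (st_senU S)) k)).
have [A [As wA detb deta]] := witness_set ws.
pose iA := @emb_in L U V e A; pose r := tp iA (tcat a rep).
(* After conjugating [a'] to [a] over [U], the second component is conjugate to [rep] over [A] and
   [a], hence equal to it by [detb]. *)
have fwd a' b' : realises e a' p -> realises iA (tcat a' b') r ->
    exists t, [/\ auto_U t, t \o a' = a & t \o b' = rep].
  rewrite {1}pE => /(realises_tp S)/esym/(tp_eq_auto S)[t [tU ta]].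
  move=> /(auto_realises tU.1 (fun u _ => tU.2 u)); rewrite tcat_comp ta => /realises_auto[t' [t'A t'fix]].
  rewrite tcat_comp => E; exists t; split=> //; rewrite -(tcat_inj_right E); apply/funext => i /=.
  by apply: detb => // j; exact: (congr1 (fun f => f j) (tcat_inj_left E)).
(* Here [b'] is conjugated to [rep]; the first component is then an image of [a] under an
   automorphism fixing [A] and [rep], so by [deta] it has the type of [a] over [U]. *)
have bwd a' b' : realises e b' (tp e rep) -> realises iA (tcat a' b') r -> realises e a' p.
  move=> /(realises_tp S)/esym/(tp_eq_auto S)[t [tU tb]].
  move=> /(auto_realises tU.1 (fun u _ => tU.2 u)); rewrite tcat_comp tb => /realises_auto[t' [t'A t'fix]].
  rewrite tcat_comp => E.
  have [|q [qU qa]] := deta t' t'A t'fix; first by move=> i; exact: (congr1 (fun f => f i) (tcat_inj_right E)).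
  have E' : q \o (t \o a') = a.
    by apply/funext => j; rewrite -(tcat_inj_left E); exact: qa.
  by rewrite /realises pE -E' (tp_auto _ qU) (tp_auto _ tU).
have restrE n' m' (h : 'I_n' -> 'I_m') (d : 'I_m' -> V) (ph : formula L ('I_n' + A)) :
    restr (tp e (d \o h)) ph -> tp iA d (rename (copair (inl \o h) inr) ph).
  rewrite /restr /tp /= /param_incl !sat_rename; set w1 := _ \o _; set w2 := _ \o _.
  by have -> : w1 = w2 by apply/funext => -[].
have rl N M (f : 'I_N -> V) (h : 'I_M -> V) : tcat f h \o @lshift N M = f.
  by apply/funext => i /=; rewrite tcat_lshift.
have rr N M (f : 'I_N -> V) (h : 'I_M -> V) : tcat f h \o @rshift N M = h.
  by apply/funext => i /=; rewrite tcat_rshift.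
exists A, r; split; first split.
- split; first split=> //.
  + exact: (tp_complete eE set_val (tcat a rep)).
  + by move=> ph; rewrite pE -(rl n m a rep); exact: restrE.
  + by move=> ph; rewrite -[in restr _](rr n m a rep); exact: restrE.
  + by move=> a' b' [pa /(fwd _ _ pa)[t [tU ta tb]]]; rewrite /realises -tb (tp_auto _ tU).
- exists (rename (copair inl (inr \o w)) phi) => // a' b' H.
  pose wj (j : 'I_k) : A := exist _ (w j) (mem_set (wA _ (imageT w j))).
  have /H : r (rename (copair inl (inr \o wj)) phi).
    move: tausat; rewrite /r /tp /= !sat_rename; set w1 := _ \o _; set w2 := _ \o _.
    by have -> : w1 = w2 by apply/funext => -[].
  rewrite /tp /= !sat_rename; set w1 := _ \o _; set w2 := _ \o _.
  by have -> : w1 = w2 by apply/funext => -[].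
- move=> a' b' [pa H] [z [dz nz _ E]]; have [t [tU ta tb]] := fwd _ _ pa H.
  apply: (@extremality (t z)).
  + rewrite -ta (_ : copair (t \o a') e = t \o copair a' e); last first.
      by apply/funext => -[//|u] /=; rewrite tU.2.
    exact: dcl_automorphism tU.1 dz.
  + move=> [u Eu]; apply: nz; exists u => //; have [q [_ tK _]] := auto_U_inv tU.
    by rewrite -(tK z) -Eu -{2}(tU.2 u) tK.
  + rewrite -tb -[fun=> t z]/(t \o (fun _ : 'I_1 => z)).
    by rewrite -tcat_comp !(tp_auto _ tU); exact: E.
- exact: bwd.
(* Domination in the other direction needs the same type with its two blocks of variables
   exchanged. *)
exists A, (tp iA (tcat rep a)); split=> //.
- exact: (tp_complete eE set_val (tcat rep a)).
- by move=> ph; rewrite -[in restr _](rl m n rep a); exact: restrE.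
- by move=> ph; rewrite pE -[in restr _](rr m n rep a); exact: restrE.
- by move=> b' a' [Hb /realises_swap]; exact: bwd.
Qed.

End Core.

(** * Maximal orthogonal tuples and existence of products *)

Section Products.
Variables (L : og_language) (kappa kappa' : Type) (U V : structure L) (e : U -> V).
Hypothesis S : setting kappa kappa' e.
Local Open Scope og_scope.
Implicit Types x y z d g h : V.
Local Notation gV := (st_gV S).
Local Notation eE := (st_emb S).
Local Notation base := (base e).
Local Notation ceq := (ceq e).
Local Notation tower := (tower e).
Local Notation auto_U := (auto_U e).
Local Notation small_side := (small_side kappa e).

Lemma realised_in_V n (p : set (formula L ('I_n + U))) : Sinv kappa p -> exists a, realises e a p.
Proof.
move=> [[fin _] _]; apply: (saturated_family (st_satV S)).
  exact: smallT_image _ (st_small S).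
move=> k phi /fin[d Hd]; exists (e \o d) => j; have := (eE _ _).1 (Hd j); congr sat.
by apply/funext => -[].
Qed.

Section Tuple.
Variables (n : nat) (p : set (formula L ('I_n + U))) (a : 'I_n -> V).
Hypotheses (pS : Sinv kappa p) (ap : realises e a p).
Local Notation l := (map a (enum 'I_n)).

Lemma product_witness (ps : seq (set (formula L ('I_1 + U)))) (x c : 'I_(size ps) -> V)
    (b : 'I_(size ps) -> bool) :
  (forall i, Sinv kappa (tnth (in_tuple ps) i)) ->
  (forall i, tnth (in_tuple ps) i = tp e (fun _ : 'I_1 => affine (b i) (x i) (c i))) ->
  (forall i, base (x i)) -> (forall i, isolated base (c i)) -> (forall i, tower l (c i)) ->
  (forall i j, i != j -> ~ linked e (c i) (c j)) ->
  (forall h, tower l h -> isolated base h -> exists i, linked e h (c i)) ->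
  exists (A : set U) (r : set (formula L ('I_(n + size ps) + A))),
    extremal_equiv_witness kappa e p (tensor_seq kappa e ps) r /\
    dominates kappa e (tensor_seq kappa e ps) p.
Proof.
move=> psS psE Bx ic Tc N cover.
have /choice[s /choice[C HC]] (i : 'I_(size ps)) : exists s, small_side s (c i).
  have [s [_ [_ [_ [_ _ _ _ H]]]]] := tower_normal_form S pS ap (Tc i) (isolated_notin S (ic i)).
  by exists s.
have /choice[g Hg] (i : 'I_(size ps)) : exists g, [/\ tower l g, ceq g (c i) & extremal e (s i) (c i) g l].
  by apply: (extremal_exists S) => //; exists (c i); split=> //; exact: ceq_refl.
have ig i : isolated base (g i) by have [_ gc _] := Hg i; exact (isolated_ceq S (ic i) (ceq_sym gc)).
rewrite (tensor_seq_tp S (c := rep x b g) (x := x) (g := g) (b := b)) => //.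
- apply: (@rep_witness _ _ _ _ _ _ S _ _ _ pS ap _ x c b Bx ic cover s C g) => // i; by [have [] := HC i | have [] := Hg i].
- move=> i; rewrite psE; apply/esym; apply: (ceq_tp S); apply: (affine_ceq S) => //.
  by have [] := Hg i.
- move=> i j /N H H'; apply: H; have [_ gi _] := Hg i; have [_ gj _] := Hg j.
  apply: (linked_trans S (linked_ceq (ceq_sym gi))); apply: (linked_trans S H'); exact: linked_ceq.
Qed.

(** Orthogonality makes the isolated parts of the given realisations pairwise unlinked. Maximality
    makes them represent every class: the type of an isolated element linked to none of them could
    be appended to the tuple. *)
Lemma maximal_witness (ps : seq (set (formula L ('I_1 + U)))) : maximal_orthogonal_tuple kappa e a ps ->
  exists (A : set U) (r : set (formula L ('I_(n + size ps) + A))),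
    extremal_equiv_witness kappa e p (tensor_seq kappa e ps) r.
Proof.
move=> [[psP orth] maxi].
pose data := (V * V * bool)%type.
have /choice[f fP] (i : 'I_(size ps)) : exists d : data, [/\ base d.1.1, isolated base d.1.2, tower l d.1.2 &
    tnth (in_tuple ps) i = tp e (fun _ : 'I_1 => affine d.2 d.1.1 d.1.2)].
  have [qS qr [c dc cq]] := psP i; have qE := complete_realised qS.1 cq.
  have nc : ~ base c by move=> /(realised_base S); rewrite -qE.
  have [_ [x [b [g [Bx ig E Tg _]]]]] := tower_normal_form S pS ap (dcl_tower S dc) nc.
  by exists (x, g, b); split=> //=; rewrite -E.
have unl i j : i != j -> ~ linked e (f i).1.2 (f j).1.2.
  move=> ij; have := orth _ _ ij; have [Bi ii _ ->] := fP i; have [Bj ij' _ ->] := fP j.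
  by move=> wo H; exact: (linked_not_orthogonal S Bi Bj ii ij' H wo).
have [|||||||A [r [Hr _]]] := @product_witness ps (fun i => (f i).1.1) (fun i => (f i).1.2) (fun i => (f i).2);
  try by move=> i; have [] := fP i.
- by move=> i; have [] := psP i.
- exact: unl.
- move=> h Th ih; apply: contrapT => /forallNP N.
  have [o Eo] := emb_zero eE; have B0 : base 0 by exists o.
  (* Writing [h] as [affine true 0 h] gives it the shape that the orthogonality lemmas expect. *)
  pose q := tp e (fun _ : 'I_1 => affine true 0 h).
  have nT : ~ base (affine true 0 h).
    by move=> B; apply: (isolated_notin S ih); exact: (affine_towerE S (s := [::]) B0 B).
  have dh : dcl (copair a e) (affine true 0 h) by apply: (tower_in_dcl S); exact: (affine_tower S).
  have tq (i : 'I_(size (rcons ps q))) :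
      tnth (in_tuple (rcons ps q)) i = q /\ val i = size ps \/
      exists i' : 'I_(size ps), val i' = val i /\ tnth (in_tuple (rcons ps q)) i = tnth (in_tuple ps) i'.
    rewrite (tnth_nth q) /= nth_rcons; have := ltn_ord i; rewrite {2}size_rcons ltnS leq_eqVlt.
    case: ltnP => [lt _|_ /orP[/eqP E|//]]; first by right; exists (Ordinal lt); rewrite (tnth_nth q).
    by left; rewrite E eqxx.
  apply: (maxi q); split=> [i|i j ij].
    have [[-> _]|[i' [_ ->]]] := tq i; last exact: psP.
    split; [exact: (dcl_invariant S pS ap dh)|by move/(realised_base S)|].
    by exists (affine true 0 h).
  have [[-> vi]|[i' [vi ->]]] := tq i; have [[-> vj]|[j' [vj ->]]] := tq j.
  - by case/eqP: ij; apply: val_inj; rewrite vi vj.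
  - have [Bj ij' _ ->] := fP j'; apply: (unlinked_orthogonal S) => //; exact: N.
  - have [Bi ii' _ ->] := fP i'; apply: (unlinked_orthogonal S) => // /(linked_sym S); exact: N.
  - by apply: orth; apply: contraNneq ij => E; apply/eqP; apply: val_inj; rewrite -vi -vj E.
by exists A, r.
Qed.

Lemma InP_nth (T : Type) (d y : T) k : List.In y k <-> exists2 i, (i < size k)%N & nth d k i = y.
Proof.
elim: k y => [|z k IH] y /=; first by split=> // -[].
split=> [[<-|/IH[i ik <-]]|[[|i] ik <-]]; [by exists 0%N|by exists i.+1|by left|].
by right; apply/IH; exists i.
Qed.

Lemma unlinked_nth k i j : unlinked e k -> (i < j)%N -> (j < size k)%N -> ~ linked e (nth 0 k i) (nth 0 k j).
Proof.
elim: k i j => [|y k IH] [|i] [|j] //= [yk uk] ij jk; last exact: IH.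
by apply: yk; apply/(InP_nth (0 : V)); exists j.
Qed.

Lemma unlinked_representatives (k : seq V) : exists k' : seq V,
  [/\ unlinked e k', forall y, List.In y k' -> List.In y k &
   forall y, List.In y k -> exists z, List.In z k' /\ linked e z y].
Proof.
elim: k => [|y k [k' [uk' sub cov]]]; first by exists [::].
have [[z [zk zy]]|N] := pselect (exists z, List.In z k' /\ linked e z y).
  exists k'; split=> // [w /sub|w [<-|/cov//]]; [by right|by exists z].
exists (y :: k'); split=> /=.
- by split=> // z zk H; apply: N; exists z; split=> //; exact: (linked_sym S).
- by move=> w [|/sub]; [left|right].
- move=> w [<-|/cov[z [zk zw]]]; last by exists z; split=> //; right.
  by exists y; split; [left|apply: linked_ceq; exact: ceq_refl].
Qed.

(** A product is obtained directly from a finite list of representatives of the classes, thinned out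
    to be unlinked, without first choosing a maximal tuple. *)
Lemma orthogonal_product : exists ps : seq (set (formula L ('I_1 + U))),
  (forall i : 'I_(size ps), Sinv kappa (tnth (in_tuple ps) i)) /\
  dom_equiv kappa e p (tensor_seq kappa e ps).
Proof.
have [k [kP kcov]] := linked_representatives S l.
have [k' [uk' sub cov]] := unlinked_representatives k.
have [o Eo] := emb_zero eE; have B0 : base 0 by exists o.
pose ps := [seq tp e (fun _ : 'I_1 => affine true 0 g) | g <- k'].
pose g (i : 'I_(size ps)) := nth 0 k' i.
have sk : size ps = size k' by rewrite size_map.
have gk i : List.In (g i) k' by apply/(InP_nth (0 : V)); exists i; rewrite // -sk.
have psE i : tnth (in_tuple ps) i = tp e (fun _ : 'I_1 => affine true 0 (g i)).
  by rewrite (tnth_nth (tp e (fun _ : 'I_1 => 0))) /= (nth_map 0) // -sk.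
have Tg i : tower l (g i) by have [_] := kP _ (sub _ (gk i)).
have psS i : Sinv kappa (tnth (in_tuple ps) i).
  rewrite psE; apply: (dcl_invariant S pS ap); apply: (tower_in_dcl S); exact: (affine_tower S).
have [|||A [r [[[dw _ _] _] rev]]] := @product_witness ps (fun=> 0) g (fun=> true) psS psE (fun=> B0) _ Tg.
- by move=> i; have [] := kP _ (sub _ (gk i)).
- move=> i j; rewrite neq_ltn => /orP[ij|ji]; first by apply: unlinked_nth; rewrite -?sk.
  by move=> /(linked_sym S); apply: unlinked_nth; rewrite -?sk.
- move=> h Th ih; have [y [yk yh]] := kcov h Th ih; have [z [/(InP_nth (0 : V))[i ik <-] zy]] := cov _ yk.
  rewrite -sk in ik; exists (Ordinal ik); apply: (linked_sym S); exact: (linked_trans S zy yh).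
- by exists ps; split=> //; split=> //; exists A, r.
Qed.

End Tuple.
End Products.

Lemma ogroup_of_doag (L : og_language) (M : structure L) : doag M -> o_minimal M -> ogroup M.
Proof.
move=> [og [x x0] div] om; split=> // [z|].
  by have [y /= Ey] := div 1%N z; exists y; rewrite -Ey (oaddr0 og).
have [x0'|/esym//|x0'] := olt_total og (ozero M) x; first by exists x.
exists (oopp x); have := olt_add2r og (oopp x) x0'.
by rewrite (oaddN og) (oadd0 og).
Qed.

Lemma monster_setting (L : og_language) (T : set (sentence L))
    (kappa kappa' : Type) (U V : structure L) (e : U -> V) :
  linear_o_minimal_doag T -> monster kappa T U -> larger_monster e kappa' T ->
  setting kappa kappa' e.
Proof.
move=> lin [limU senU mU satU homU] [[limV senV mV satV homV] Us eE].
have [dU oU _] := lin U mU; have [dV oV lV] := lin V mV.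
by split=> //; apply: ogroup_of_doag.
Qed.

Theorem theorem2p23 (L : og_language) (T : set (sentence L))
    (kappa kappa' : Type) (U V : structure L) (e : U -> V)
    (T_complete : complete_theory T)
    (T_linear : linear_o_minimal_doag T)
    (U_monster : monster kappa T U)
    (V_monster : larger_monster e kappa' T) :
  (forall (n : nat) (p : set (formula L ('I_n + U))), Sinv kappa p ->
     exists ps : seq (set (formula L ('I_1 + U))),
       (forall i : 'I_(size ps), Sinv kappa (tnth (in_tuple ps) i)) /\
       dom_equiv kappa e p (tensor_seq kappa e ps)) /\
  (forall (n : nat) (p : set (formula L ('I_n + U))), Sinv kappa p ->
   forall a : 'I_n -> V, realises e a p ->
   forall ps : seq (set (formula L ('I_1 + U))),
     maximal_orthogonal_tuple kappa e a ps ->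
     exists (A : set U) (r : set (formula L ('I_(n + size ps) + A))),
       extremal_equiv_witness kappa e p (tensor_seq kappa e ps) r).
Proof.
have S := monster_setting T_linear U_monster V_monster; split=> n p pS.
  by have [a ap] := realised_in_V S pS; exact: (orthogonal_product S pS ap).
by move=> a ap ps; exact: (maximal_witness S pS ap).
Qed.
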